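(* Let $k\in\{1,2,3,4\}$, $0<\alpha<1$ and $\epsilon>0$. Then there is $c=c(\alpha,\epsilon)>0$ such that for any $N\ge1$ and any $A\subseteq[N]$ with $|A|\ge\alpha N$, there are at least $cN$ values of $d\in[-N,N]$ for which the number of $n$ such that $n,n+d,\dots,n+(k-1)d$ all lie in $A$ is at least $(\alpha^k-\epsilon)N$.
   Context: $[N]=\{1,\dots,N\}$ and $[-N,N]$ denotes the integers in that interval. *)

(* Defs.v *)
From Stdlib Require Import Reals ZArith List.
Open Scope R_scope.

Definition Zrange (a b : Z) : list Z :=
  map (fun i => (a + Z.of_nat i)%Z) (seq 0 (Z.to_nat (b - a + 1))).

Definition countZ (P : Z -> bool) (a b : Z) : nat :=
  length (filter P (Zrange a b)).

Definition ap_in (A : Z -> bool) (k : nat) (n d : Z) : bool :=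
  forallb (fun j => A (n + Z.of_nat j * d)%Z) (seq 0 k).

(* Number of n with n, n+d, ..., n+(k-1)d all in A, for A a subset of [1,N]
   and k >= 1: such n lies in A, hence in [1, N]. *)
Definition apcount (A : Z -> bool) (k : nat) (d N : Z) : nat :=
  countZ (fun n => ap_in A k n d) 1 N.

Definition Rleb (x y : R) : bool := if Rle_dec x y then true else false.

(* Main.v *)
Require Import Defs.
From Stdlib Require Import Reals ZArith List.
From Stdlib Require Lia Lra FinFun.
From HB Require structures.
From mathcomp Require all_boot all_order all_algebra reals ring lra complex.
From mathcomp Require cyclic separable cyclotomic zify Rstruct.
Open Scope R_scope.

(* In a finite commutative ring G with a nondegenerate character, where 2 and 3 are invertible, a bounded function with
   large U^3 norm correlates with a function g such that, for many shifts d, x |-> g(x + d) is close in L^1 to a linear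
   character times a fixed function. This soft inverse theorem needs no additive combinatorics: the large values of the
   ambiguity function E_x f(x) f(x + a)^* chi(xi x) are positive definite, so many pairs of them have a large difference, and
   total boundedness of averages (sampling) with a pigeonhole argument then produces g.
   For a polynomial F in finitely many such phases there is a set E of positive density, inside one colour class of any given
   colouring, such that the average over d in E - E of E_x F(x) F(x + d) ... F(x + (k-1) d) is at least (E F)^k up to a small
   error. For k = 4, writing F, conj F, F, conj F for the four factors, the main term is the sum over the frequencies kappa of
   E |F_kappa|^2 |F_(3 kappa)|^2, which is at least (E |F_0|^2)^2 >= |E F_0|^4; this positivity fails for k >= 5.
   For general f, a double energy increment finds such an F that is U^3-close to f up to a small L^2 error and whose set E is
   chosen with density bounded in terms of this closeness; the generalized von Neumann inequality, weighted by E, transfers the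
   bound to f. Finally G is Z/N' with N' prime to 6 and slightly larger than N, and the colour classes are short intervals, so
   that the differences d are short integers and almost no progression wraps around. *)

(** The double increment answers a circularity. The set E is built from F, and the transfer to f
    loses a power of the density of E, so f - F must be small in U^3 compared with a density that
    depends on F itself. Hence E is fixed from a coarse F, and a copy F1 of F is then corrected
    until f - F1 is that small. If F1 is still close to F in L^2, the set of F serves f. Otherwise
    the midpoint of F and F1 is closer to f by a fixed amount and takes the place of F. Every
    correction adds a phase and changes the polynomial and the constants of the phases. The
    induction therefore runs over the data that describe F without reference to G, and this is why
    each statement fixes its constants before it introduces the ring. No structure of E - E is
    needed in the transfer: d is weighted by the autocorrelation of the indicator of E, a product of
    two factors that two points of the progression absorb. *)

Module FiniteRing.

Import HB.structures.
Import all_boot all_order all_algebra reals ring lra.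
Set Implicit Arguments. Unset Strict Implicit. Unset Printing Implicit Defensive.
Import Order.TTheory GRing.Theory Num.Theory.
Import complex.
Local Open Scope ring_scope.
Local Notation "x %:C" := (real_complex _ x) : ring_scope.
Local Notation "R [i]" := (complex R) : type_scope.

(** * Averages and characters *)
Section Cn.
Variable R : realType.
Implicit Types z w : R[i].

(** The norm of [R[i]] takes its values in [R[i]]; this is its real-valued counterpart, so that all
    estimates are inequalities in [R]. *)
Definition cn z : R := Num.sqrt (Re z ^+ 2 + Im z ^+ 2).

Lemma cnE z : (cn z)%:C = `|z|. Proof. by rewrite normc_def. Qed.
Lemma cn_ge0 z : 0 <= cn z. Proof. exact: sqrtr_ge0. Qed.
Lemma cnM z w : cn (z * w) = cn z * cn w.
Proof. by apply: (@complexI R); rewrite rmorphM /= !cnE normrM. Qed.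
Lemma cnD z w : cn (z + w) <= cn z + cn w.
Proof. by rewrite -lecR rmorphD /= !cnE ler_normD. Qed.
Lemma cnN z : cn (- z) = cn z.
Proof. by apply: (@complexI R); rewrite !cnE normrN. Qed.
Lemma cnB z w : cn (z - w) = cn (w - z).
Proof. by rewrite -cnN opprB. Qed.
Lemma cn0 : cn 0 = 0. Proof. by apply: (@complexI R); rewrite cnE normr0. Qed.
Lemma cn1 : cn 1 = 1. Proof. by apply: (@complexI R); rewrite cnE normr1. Qed.
Lemma cn_conj z : cn z^* = cn z.
Proof. by case: z => a b; rewrite /cn /= sqrrN. Qed.
Lemma cnR (a : R) : cn a%:C = `|a|.
Proof. by rewrite /cn /= expr0n addr0 sqrtr_sqr. Qed.
Lemma sqr_cn z : ((cn z) ^+ 2)%:C = z * z^*.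
Proof. by rewrite rmorphXn /= cnE sqr_normc. Qed.
Lemma cn_sqE z : cn z ^+ 2 = Re z ^+ 2 + Im z ^+ 2.
Proof. by rewrite /cn sqr_sqrtr // addr_ge0 // sqr_ge0. Qed.
Lemma Re_le_cn z : `|Re z| <= cn z.
Proof. by rewrite -lecR cnE normc_ge_Re. Qed.
Lemma Im_le_cn z : `|Im z| <= cn z.
Proof.
rewrite -(@ler_pXn2r _ 2) ?nnegrE ?normr_ge0 ?cn_ge0 // cn_sqE real_normK ?num_real //.
by rewrite lerDr sqr_ge0.
Qed.
Lemma cn_le_ReIm z : cn z <= `|Re z| + `|Im z|.
Proof.
rewrite -(@ler_pXn2r _ 2) ?nnegrE ?addr_ge0 ?normr_ge0 ?cn_ge0 // cn_sqE.
rewrite sqrrD !real_normK ?num_real // -subr_ge0.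
rewrite (_ : _ - _ = `|Re z| * `|Im z| *+ 2); last by ring.
by rewrite mulrn_wge0 // mulr_ge0.
Qed.
Lemma cn_sum (I : Type) (r : seq I) (P : pred I) (f : I -> R[i]) :
  cn (\sum_(i <- r | P i) f i) <= \sum_(i <- r | P i) cn (f i).
Proof.
elim/big_ind2 : _ => //; first by rewrite cn0.
by move=> x x' y y' h h'; apply: le_trans (cnD _ _) _; apply: lerD.
Qed.
Lemma conjR (a : R) : (a%:C)^* = a%:C :> R[i].
Proof. exact: conjc_real. Qed.
Lemma cn_nat n : cn n%:R = n%:R.
Proof. by rewrite (_ : n%:R = (n%:R : R)%:C) ?cnR ?normr_nat // rmorph_nat. Qed.
Lemma cnV z : cn z^-1 = (cn z)^-1.
Proof. by apply: (@complexI R); rewrite fmorphV /= !cnE normfV. Qed.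
End Cn.

(** Locked, so that rewriting and simplification treat an average as a unit; over a [numFieldType],
    so that real and complex averages share one theory. *)
HB.lock Definition ex (K : numFieldType) (T : finType) (f : T -> K) : K :=
  #|T|%:R^-1 * \sum_t f t.

Section Ex.
Variable K : numFieldType.

Lemma exE (T : finType) (f : T -> K) : ex f = #|T|%:R^-1 * \sum_t f t.
Proof. by rewrite ex.unlock. Qed.

Lemma eq_ex (T : finType) (f g : T -> K) : f =1 g -> ex f = ex g.
Proof. by move=> h; rewrite !exE; congr (_ * _); apply: eq_bigr => t _. Qed.
Lemma exD (T : finType) (f g : T -> K) : ex (fun t => f t + g t) = ex f + ex g.
Proof. by rewrite !exE big_split mulrDr. Qed.
Lemma exN (T : finType) (f : T -> K) : ex (fun t => - f t) = - ex f.
Proof. by rewrite !exE sumrN mulrN. Qed.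
Lemma exB (T : finType) (f g : T -> K) : ex (fun t => f t - g t) = ex f - ex g.
Proof. by rewrite exD exN. Qed.
Lemma exZ (T : finType) c (f : T -> K) : ex (fun t => c * f t) = c * ex f.
Proof. by rewrite !exE -mulr_sumr mulrCA. Qed.
Lemma exZr (T : finType) c (f : T -> K) : ex (fun t => f t * c) = ex f * c.
Proof. by rewrite !exE -mulr_suml mulrA. Qed.
Lemma ex_sum (T : finType) (I : Type) (r : seq I) (P : pred I) (f : I -> T -> K) :
  ex (fun t => \sum_(i <- r | P i) f i t) = \sum_(i <- r | P i) ex (f i).
Proof.
rewrite exE exchange_big mulr_sumr /=; apply: eq_bigr => i _; by rewrite exE.
Qed.
Lemma ex_exchange (T S : finType) (f : T -> S -> K) :
  ex (fun t => ex (f t)) = ex (fun s => ex (fun t => f t s)).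
Proof.
rewrite !exE; under eq_bigr do rewrite exE.
rewrite -mulr_sumr exchange_big mulrCA /=; congr (_ * _).
by rewrite mulr_sumr; apply: eq_bigr => s _; rewrite exE.
Qed.
Lemma ex_reindex (T : finType) (h : T -> T) (f : T -> K) :
  injective h -> ex (fun t => f (h t)) = ex f.
Proof. by move=> hi; rewrite !exE [in RHS](reindex_inj hi). Qed.
Lemma ex_const (T : finType) (x0 : T) (c : K) : ex (fun _ : T => c) = c.
Proof.
have h : (0 < #|T|)%N by apply/card_gt0P; exists x0.
by rewrite !exE sumr_const -[c *+ _]mulr_natl mulKf // pnatr_eq0 -lt0n.
Qed.
Lemma sum_ex (T : finType) (x0 : T) (f : T -> K) : \sum_t f t = #|T|%:R * ex f.
Proof.
have h : (0 < #|T|)%N by apply/card_gt0P; exists x0.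
by rewrite !exE mulVKf // pnatr_eq0 -lt0n.
Qed.
End Ex.

Notation "\E_ x F" := (ex (fun x => F)) (at level 41, x name, F at level 41, right associativity).

Lemma ex_shift (K : numFieldType) (G : finZmodType) (a : G) (f : G -> K) :
  \E_ x f (x + a) = ex f.
Proof. by apply: (ex_reindex f (h := fun x => x + a)) => x y /addIr. Qed.

Section ExR.
Variable R : realType.

Lemma ler_ex (T : finType) (f g : T -> R) : (forall t, f t <= g t) -> ex f <= ex g.
Proof. by move=> h; rewrite !exE ler_wpM2l ?invr_ge0 //; apply: ler_sum. Qed.
Lemma ex_ge0 (T : finType) (f : T -> R) : (forall t, 0 <= f t) -> 0 <= ex f.
Proof. by move=> h; rewrite exE mulr_ge0 ?invr_ge0 // sumr_ge0. Qed.
Lemma cn_ex (T : finType) (f : T -> R[i]) : cn (ex f) <= \E_ t cn (f t).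
Proof.
rewrite !exE cnM cnV cn_nat ler_wpM2l ?invr_ge0 //; exact: cn_sum.
Qed.
Lemma ex_le (T : finType) (x0 : T) (f : T -> R) c : (forall t, f t <= c) -> ex f <= c.
Proof. by move=> h; rewrite -[leRHS](ex_const x0); apply: ler_ex. Qed.
Lemma ex_ge (T : finType) (x0 : T) (f : T -> R) c : (forall t, c <= f t) -> c <= ex f.
Proof. by move=> h; rewrite -[leLHS](ex_const x0); apply: ler_ex. Qed.
Lemma ex_conj (T : finType) (f : T -> R[i]) : (ex f)^* = \E_ t (f t)^*.
Proof. by rewrite !exE rmorphM /= fmorphV /= rmorph_sum /= rmorph_nat. Qed.
Lemma ex_real (T : finType) (f : T -> R) : (ex f)%:C = \E_ t (f t)%:C.
Proof. by rewrite !exE rmorphM /= fmorphV /= rmorph_sum /= rmorph_nat. Qed.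
Lemma Re_sum (I : Type) (r : seq I) (P : pred I) (f : I -> R[i]) :
  Re (\sum_(i <- r | P i) f i) = \sum_(i <- r | P i) Re (f i).
Proof. by apply: (big_morph (@Re R)) => // -[a b] [c d]. Qed.
Lemma ReM_real (a : R) (z : R[i]) : Re (a%:C * z) = a * Re z.
Proof. by case: z => x y /=; rewrite mul0r subr0. Qed.
Lemma Re_ex (T : finType) (f : T -> R[i]) : Re (ex f) = \E_ t Re (f t).
Proof.
rewrite !exE (_ : #|T|%:R^-1 = (#|T|%:R^-1 : R)%:C); first by rewrite ReM_real Re_sum.
by rewrite fmorphV /= rmorph_nat.
Qed.

Lemma CS_sum (I : finType) (P : pred I) (a b : I -> R) :
  (\sum_(i | P i) a i * b i) ^+ 2 <=
  (\sum_(i | P i) a i ^+ 2) * (\sum_(i | P i) b i ^+ 2).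
Proof.
set S := \sum_(i | P i) a i * b i; set A := \sum_(i | P i) a i ^+ 2.
set B := \sum_(i | P i) b i ^+ 2.
have A0 : 0 <= A by apply: sumr_ge0 => i _; rewrite sqr_ge0.
have B0 : 0 <= B by apply: sumr_ge0 => i _; rewrite sqr_ge0.
have key t : 0 <= A * t ^+ 2 - 2 * S * t + B.
  have : 0 <= \sum_(i | P i) (a i * t - b i) ^+ 2 by apply: sumr_ge0 => i _; rewrite sqr_ge0.
  congr (_ <= _); rewrite /A /B /S mulr_suml !mulr_sumr mulr_suml -sumrB -big_split /=.
  by apply: eq_bigr => i _; ring.
have [A0'|An0] := eqVneq A 0.
  have [->|Sn0] := eqVneq S 0; first by rewrite expr0n mulr_ge0.
  (* With A = 0 the quadratic in t is linear, and at this t it equals -1. *)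
  have := key ((B + 1) / (2 * S)).
  rewrite A0' mul0r add0r mulrC divfK; last by rewrite mulf_neq0 ?pnatr_eq0.
  by lra.
have := key (S / A).
have -> : A * (S / A) ^+ 2 - 2 * S * (S / A) + B = B - S ^+ 2 / A by field.
by rewrite subr_ge0 ler_pdivrMr ?lt_def ?An0 // mulrC.
Qed.

Lemma CS_ex (T : finType) (a b : T -> R) :
  (\E_ t a t * b t) ^+ 2 <= (\E_ t a t ^+ 2) * (\E_ t b t ^+ 2).
Proof.
rewrite !exE mulrACA exprMn -expr2 ler_wpM2l ?sqr_ge0 //; exact: CS_sum.
Qed.
Lemma sqr_ex_le (T : finType) (a : T -> R) : (ex a) ^+ 2 <= \E_ t a t ^+ 2.
Proof.
case: (pickP (fun _ : T => true)) => [x0 _|h0].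
  have := CS_ex a (fun _ => 1); under eq_ex do rewrite mulr1.
  by rewrite (eq_ex (f := fun _ : T => 1 ^+ 2) (g := fun=> 1)) ?ex_const ?mulr1 // => t; rewrite expr1n.
rewrite !exE !big_pred0 ?mulr0 ?expr0n // => t; exact: h0.
Qed.
Lemma sqr_cn_ex (T : finType) (f : T -> R[i]) : cn (ex f) ^+ 2 <= \E_ t cn (f t) ^+ 2.
Proof.
apply: le_trans (sqr_ex_le _).
by rewrite ler_pXn2r ?nnegrE ?cn_ge0 ?ex_ge0 ?cn_ex // => t; apply: cn_ge0.
Qed.
End ExR.

(* In a finite ring, injectivity of doubling and tripling says that 2 and 3 are invertible. *)
Definition charsys (R : realType) (G : finComNzRingType) (chi : G -> R[i]) : Prop :=
  [/\ forall x y, chi (x + y) = chi x * chi y,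
      forall x, cn (chi x) = 1,
      forall k, k != 0 -> \sum_x chi (k * x) = 0,
      injective (fun x : G => x + x) &
      injective (fun x : G => x + x + x)].

Section Char.
Variables (R : realType) (G : finComNzRingType) (chi : G -> R[i]).
Hypothesis hchi : charsys chi.

Lemma chiD x y : chi (x + y) = chi x * chi y. Proof. by case: hchi. Qed.
Lemma cn_chi x : cn (chi x) = 1. Proof. by case: hchi. Qed.
Lemma chi_neq0 x : chi x != 0.
Proof. by apply/eqP => h; have := cn_chi x; rewrite h cn0 => /eqP; rewrite eq_sym oner_eq0. Qed.
Lemma chi0 : chi 0 = 1.
Proof. by apply: (mulfI (chi_neq0 0)); rewrite -chiD addr0 mulr1. Qed.
Lemma chi_conj x : (chi x)^* = chi (- x).
Proof.
apply: (mulfI (chi_neq0 x)); rewrite -sqr_cn cn_chi expr1n -chiD subrr chi0.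
by rewrite rmorph1.
Qed.
Lemma chiN x : chi (- x) = (chi x)^*. Proof. by rewrite chi_conj. Qed.

Lemma chi_orth k : \E_ x chi (k * x) = (k == 0)%:R.
Proof.
have [->|k0] := eqVneq k 0.
  by rewrite -[RHS](ex_const (0 : G)); apply: eq_ex => x; rewrite mul0r chi0.
by rewrite !exE; case: hchi => _ _ h _ _; rewrite h ?mulr0.
Qed.

Definition fourier (f : G -> R[i]) (k : G) : R[i] := \E_ x f x * chi (k * x).

Lemma parseval (f : G -> R[i]) : \sum_k cn (fourier f k) ^+ 2 = \E_ x cn (f x) ^+ 2.
Proof.
apply: (@complexI R); rewrite ex_real rmorph_sum /=.
transitivity (\sum_k \E_ x \E_ y (f x * (f y)^*) * chi ((x - y) * k)).
  apply: eq_bigr => k _; rewrite sqr_cn /fourier. rewrite ex_conj -exZr; apply: eq_ex => x.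
  rewrite -exZ; apply: eq_ex => y.
  by rewrite rmorphM /= -chiN mulrBl chiD mulrACA (mulrC x) (mulrC y).
rewrite -ex_sum; apply: eq_ex => x; rewrite -ex_sum.
transitivity (\E_ y #|G|%:R * (f x * (f y)^*) * (x - y == 0)%:R).
  by apply: eq_ex => y; rewrite -mulr_sumr (sum_ex (0 : G)) chi_orth; ring.
rewrite !exE (bigD1 x) //= big1 ?addr0 => [|y yx]; last first.
  by rewrite subr_eq0 eq_sym (negPf yx) mulr0.
rewrite subrr eqxx mulr1 mulKf ?sqr_cn //.
by rewrite pnatr_eq0 -lt0n; apply/card_gt0P; exists (0 : G).
Qed.
End Char.

(** * Gowers norms *)
Section GvN.
Variables (R : realType) (G : finComNzRingType) (chi : G -> R[i]).
Hypothesis hchi : charsys chi.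
Implicit Types f F : G -> R[i].

Definition bounded1 f := forall x, cn (f x) <= 1.
Definition mdiff f a : G -> R[i] := fun x => f x * (f (x + a))^*.
(* U2 and U3 are the fourth and eighth powers of the Gowers norms. *)
Definition U2 f : R := \E_t cn (ex (mdiff f t)) ^+ 2.
Definition U3 f : R := \E_a U2 (mdiff f a).

Lemma dbl_inj : injective (fun x : G => x + x). Proof. by case: hchi. Qed.
Lemma tpl_inj : injective (fun x : G => x + x + x). Proof. by case: hchi. Qed.

Lemma sqr_cn_exE f : (cn (ex f) ^+ 2)%:C = \E_a \E_x f x * (f (x + a))^*.
Proof.
rewrite sqr_cn ex_conj -exZr ex_exchange; apply: eq_ex => x.
rewrite -exZ -(ex_shift x); apply: eq_ex => a; by rewrite addrC.
Qed.

(** The Fourier coefficient of the autocorrelation [t |-> ex (mdiff f t)] at -k is the squared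
    modulus of the coefficient of f at k; Parseval does the rest. *)
Lemma U2_fourier f : U2 f = \sum_k cn (fourier chi f k) ^+ 4.
Proof.
rewrite /U2 -(parseval hchi) (reindex_inj oppr_inj) /=; apply: eq_bigr => k _.
rewrite (_ : fourier _ _ _ = ((cn (fourier chi f k)) ^+ 2)%:C); last first.
  rewrite sqr_cn_exE; apply: eq_ex => a; rewrite -exZr; apply: eq_ex => x.
  rewrite rmorphM /= (chi_conj hchi) mulrDr opprD (chiD hchi) (chiN hchi (k * x)) mulNr.
  rewrite /mdiff; set c := chi (k * x).
  have cc : c * c^* = 1 by rewrite -sqr_cn (cn_chi hchi) expr1n.
  by rewrite -[LHS]mulr1 -cc; ring.
by rewrite cnR ger0_norm ?sqr_ge0 // -exprM.
Qed.

Lemma cs_bounded1 f F : bounded1 f -> cn (\E_x f x * F x) ^+ 2 <= \E_x cn (F x) ^+ 2.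
Proof.
move=> hf; apply: le_trans (sqr_cn_ex _) _; apply: ler_ex => x.
by rewrite cnM exprMn ler_piMl ?sqr_ge0 // expr_le1 ?cn_ge0.
Qed.

Lemma bounded1M f F : bounded1 f -> bounded1 F -> bounded1 (fun x => f x * F x).
Proof. by move=> h k x; rewrite cnM mulr_ile1 ?cn_ge0. Qed.
Lemma bounded1_mdiff f a : bounded1 f -> bounded1 (mdiff f a).
Proof. by move=> h x; rewrite cnM mulr_ile1 ?cn_ge0 ?cn_conj. Qed.
Lemma cn_ex_le1 f : bounded1 f -> cn (ex f) <= 1.
Proof. by move=> h; apply: le_trans (cn_ex _) _; apply: (ex_le (0 : G)). Qed.

(** Cauchy-Schwarz in y removes F2. The two remaining factors then decouple, because y and y + 2d
    vary independently once doubling is a bijection. The autocorrelation of F1 is bounded by 1, and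
    a second Cauchy-Schwarz yields U2. *)
Lemma ap3_end F1 F2 F3 : bounded1 F1 -> bounded1 F2 ->
  cn (\E_d \E_y F1 (y - d) * F2 y * F3 (y + d)) ^+ 4 <= U2 F3.
Proof.
move=> b1 b2; rewrite ex_exchange.
pose H y := \E_d F1 (y - d) * F3 (y + d).
rewrite (eq_ex (g := fun y => F2 y * H y)); last first.
  by move=> y; rewrite -exZ; apply: eq_ex => d; ring.
have h1 := cs_bounded1 H b2.
have h2 : \E_y cn (H y) ^+ 2 = Re (\E_a ex (mdiff F1 (- a)) * ex (mdiff F3 a)).
  rewrite -[LHS]/(Re (_)%:C) ex_real; congr Re.
  under eq_ex do rewrite sqr_cn_exE.
  rewrite ex_exchange; apply: eq_ex => a; rewrite ex_exchange.
  transitivity (\E_d \E_y mdiff F1 (- a) y * mdiff F3 a (y + (d + d))).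
    apply: eq_ex => d; rewrite -(ex_shift d); apply: eq_ex => y.
    rewrite addrK !rmorphM /= /mdiff (_ : y + d - (d + a) = y - a); last by ring.
    rewrite (_ : y + d + (d + a) = y + (d + d) + a); last by ring.
    by rewrite addrA; ring.
  rewrite ex_exchange -exZr; apply: eq_ex => y; rewrite exZ; congr (_ * _).
  rewrite (ex_reindex (fun d => mdiff F3 a (y + d)) dbl_inj).
  by rewrite -[RHS](ex_shift y); apply: eq_ex => d; rewrite addrC.
rewrite h2 in h1; move: h1; set P := cn _; set Q := ex _ => h1.
have h3 : P ^+ 2 <= \E_a cn (ex (mdiff F3 a)).
  apply: le_trans h1 _; apply: le_trans (le_trans (ler_norm _) (Re_le_cn _)) _.
  apply: le_trans (cn_ex _) _; apply: ler_ex => a.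
  by rewrite cnM ler_piMl ?cn_ge0 // cn_ex_le1 //; apply: bounded1_mdiff.
rewrite (_ : 4 = 2 * 2)%N // exprM; apply: le_trans (sqr_ex_le _).
by rewrite ler_pXn2r ?nnegrE ?sqr_ge0 ?ex_ge0 // => a; apply: cn_ge0.
Qed.

Definition lam4 (f0 f1 f2 f3 : G -> R[i]) d :=
  \E_x f0 x * f1 (x + d) * f2 (x + d + d) * f3 (x + d + d + d).

(** Cauchy-Schwarz in x removes f0 and doubles d into d and d + a. The other factors become
    derivatives in the directions a, 2a, 3a, along a three-term progression centred at y = x +
    2d. *)
Lemma ap4_mdiff f0 f1 f2 f3 : bounded1 f0 ->
  cn (\E_d lam4 f0 f1 f2 f3 d) ^+ 2 <=
  \E_a cn (\E_d \E_y mdiff f1 a (y - d) * mdiff f2 (a + a) y * mdiff f3 (a + a + a) (y + d)).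
Proof.
move=> b0; rewrite ex_exchange.
pose H x := \E_d f1 (x + d) * f2 (x + d + d) * f3 (x + d + d + d).
rewrite (eq_ex (g := fun y => f0 y * H y)); last first.
  by move=> y; rewrite -exZ; apply: eq_ex => d; ring.
apply: le_trans (cs_bounded1 H b0) _.
rewrite [leLHS](_ : _ = Re (\E_a \E_d \E_y mdiff f1 a (y - d) * mdiff f2 (a + a) y * mdiff f3 (a + a + a) (y + d))).
  by apply: le_trans (le_trans (ler_norm _) (Re_le_cn _)) _; apply: cn_ex.
rewrite -[LHS]/(Re (_)%:C) ex_real; congr Re.
under eq_ex do rewrite sqr_cn_exE.
rewrite ex_exchange; apply: eq_ex => a; rewrite ex_exchange; apply: eq_ex => d.
rewrite -[RHS](ex_shift (d + d)); apply: eq_ex => x.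
rewrite /mdiff !rmorphM /= (_ : x + (d + d) - d = x + d); last by ring.
rewrite (_ : x + (d + a) + (d + a) + (d + a) = x + d + d + d + (a + a + a)); last by ring.
rewrite (_ : x + (d + a) + (d + a) = x + d + d + (a + a)); last by ring.
rewrite [x + (d + a)]addrA [x + (d + d)]addrA.
move: (f1 _) (f1 _)^* (f2 _) (f2 _)^* (f3 _) (f3 _)^* => u1 u2 u3 u4 u5 u6.
by ring.
Qed.

Lemma pow8_le (a : R) (s : G -> R) u : 0 <= a -> (forall t, 0 <= s t) ->
  a ^+ 2 <= ex s -> \E_t s t ^+ 4 <= u -> a ^+ 8 <= u.
Proof.
move=> a0 s0 h1 h2; have e0 : 0 <= ex s by apply: ex_ge0.
apply: le_trans h2; rewrite (_ : 8 = 2 * 4)%N // exprM.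
have h3 : (a ^+ 2) ^+ 4 <= ex s ^+ 4 by rewrite ler_pXn2r ?nnegrE ?sqr_ge0.
apply: (le_trans h3); rewrite (_ : 4 = 2 * 2)%N // !exprM.
have h4 : (ex s ^+ 2) ^+ 2 <= (\E_t s t ^+ 2) ^+ 2.
  by rewrite ler_pXn2r ?nnegrE ?sqr_ge0 ?sqr_ex_le // ex_ge0 // => t; rewrite sqr_ge0.
apply: (le_trans h4); apply: le_trans (sqr_ex_le _) _.
by apply: ler_ex => t; rewrite exprM.
Qed.

(** The last derivative has direction 3a; tripling being a bijection, its U2 averages to U3. For f1
    the direction is a itself, and reversing the progression reduces f0 and f2 to f3 and f1. *)
Lemma gvn3 f0 f1 f2 f3 : bounded1 f0 -> bounded1 f1 -> bounded1 f2 ->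
  cn (\E_d lam4 f0 f1 f2 f3 d) ^+ 8 <= U3 f3.
Proof.
move=> b0 b1 b2; apply: pow8_le (ap4_mdiff f1 f2 f3 b0) _; rewrite ?cn_ge0 //.
  by move=> t; apply: cn_ge0.
rewrite /U3 -(ex_reindex _ tpl_inj); apply: ler_ex => a.
by apply: ap3_end; apply: bounded1_mdiff.
Qed.

Lemma gvn1 f0 f1 f2 f3 : bounded1 f0 -> bounded1 f2 -> bounded1 f3 ->
  cn (\E_d lam4 f0 f1 f2 f3 d) ^+ 8 <= U3 f1.
Proof.
move=> b0 b2 b3; apply: pow8_le (ap4_mdiff f1 f2 f3 b0) _; rewrite ?cn_ge0 //.
  by move=> t; apply: cn_ge0.
apply: ler_ex => a; rewrite -(ex_reindex _ oppr_inj).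
rewrite (eq_ex (g := fun d => \E_y mdiff f3 (a + a + a) (y - d) * mdiff f2 (a + a) y * mdiff f1 a (y + d))).
  by apply: ap3_end; apply: bounded1_mdiff.
by move=> d; apply: eq_ex => y; rewrite opprK; ring.
Qed.

Lemma lam4_rev f0 f1 f2 f3 d : lam4 f3 f2 f1 f0 (- d) = lam4 f0 f1 f2 f3 d.
Proof.
rewrite /lam4 -[LHS](ex_shift (d + d + d)); apply: eq_ex => x.
rewrite (_ : x + (d + d + d) - d = x + d + d); last by ring.
rewrite (_ : x + (d + d + d) = x + d + d + d); last by ring.
by rewrite !addrK; ring.
Qed.

Lemma ex_lam4_rev f0 f1 f2 f3 : \E_d lam4 f0 f1 f2 f3 d = \E_d lam4 f3 f2 f1 f0 d.
Proof.
by rewrite -[RHS](ex_reindex _ oppr_inj); apply: eq_ex => d; rewrite lam4_rev.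
Qed.

Lemma gvn0 f0 f1 f2 f3 : bounded1 f1 -> bounded1 f2 -> bounded1 f3 ->
  cn (\E_d lam4 f0 f1 f2 f3 d) ^+ 8 <= U3 f0.
Proof. by move=> *; rewrite ex_lam4_rev; apply: gvn3. Qed.

Lemma gvn2 f0 f1 f2 f3 : bounded1 f0 -> bounded1 f1 -> bounded1 f3 ->
  cn (\E_d lam4 f0 f1 f2 f3 d) ^+ 8 <= U3 f2.
Proof. by move=> *; rewrite ex_lam4_rev; apply: gvn1. Qed.
End GvN.

(** * Pigeonhole principles and sampling *)
Section Pigeonhole.
Variable R : realType.

Lemma exists_le_avg (Y : finType) (P : pred Y) (F : Y -> R) (b : R) :
  (exists y, P y) -> \sum_(y | P y) F y <= (\sum_(y | P y) b) -> exists2 y, P y & F y <= b.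
Proof.
move=> [y0 Py0] h.
case: (pickP (fun y => P y && (F y <= b))) => [y /andP[Py Fy]|no]; first by exists y.
suff : \sum_(y | P y) b < \sum_(y | P y) F y by rewrite ltNge h.
have lt y : P y -> b < F y by move=> Py; have := no y; rewrite Py /= leNgt => /negbFE.
rewrite (bigD1 y0) //= [ltRHS](bigD1 y0) //=; apply: ltr_leD; first exact: lt.
by apply: ler_sum => y /andP[Py _]; apply/ltW/lt.
Qed.

Lemma exists_ge_avg (Y : finType) (P : pred Y) (F : Y -> R) (b : R) :
  (exists y, P y) -> (\sum_(y | P y) b) <= \sum_(y | P y) F y -> exists2 y, P y & b <= F y.
Proof.
move=> h1 h2; have [|y Py] := @exists_le_avg _ P (fun y => - F y) (- b) h1.
  by rewrite !sumrN lerN2.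
by rewrite lerN2; exists y.
Qed.

Lemma pigeonhole (I J : finType) (S : {set I}) (f : I -> J) : (0 < #|J|)%N ->
  exists2 S' : {set I}, S' \subset S /\ (#|S|%:R <= #|J|%:R * #|S'|%:R :> R) &
    {in S' &, forall i j, f i = f j}.
Proof.
move=> J0.
have [||j _ hj] := @exists_ge_avg J predT (fun j => #|[set i in S | f i == j]|%:R) (#|S|%:R / #|J|%:R).
- by have /card_gt0P[j _] := J0; exists j.
- rewrite sumr_const -[X in X <= _]mulr_natr (eq_card (B := J)) // divfK; last by rewrite pnatr_eq0 -lt0n.
  rewrite -natr_sum ler_nat -sum1_card (partition_big f predT) //=.
  by apply: leq_sum => j _; rewrite -sum1_card; apply/eq_leq/eq_bigl => i; rewrite inE.
exists [set i in S | f i == j].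
  split; first by apply/subsetP => i; rewrite inE => /andP[].
  by rewrite mulrC -ler_pdivrMr // ltr0n.
by move=> i i'; rewrite !inE => /andP[_ /eqP->] /andP[_ /eqP->].
Qed.

Lemma pigeonhole_cplx (d : R) : 0 < d -> exists2 c : R, 0 < c &
  forall (I : finType) (S : {set I}) (z : I -> R[i]), (forall i, cn (z i) <= 1) ->
  exists2 S' : {set I}, S' \subset S /\ c * #|S|%:R <= #|S'|%:R &
    {in S' &, forall i j, cn (z i - z j) <= d}.
Proof.
(* The square that contains the unit disc is cut into cells of side d/2, so two points of one cell
   differ by at most d in the sum of their coordinates. *)
move=> d0; pose s := d / 2; have s0 : 0 < s by rewrite divr_gt0.
pose K := Num.bound (2 / s).
have Kb : 2 / s < K%:R by apply: archi_boundP; rewrite divr_ge0 // ltW.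
pose q (x : R) : 'I_K.+1 := inord (Num.truncn ((x + 1) / s)).
have qP x y : `|x| <= 1 -> `|y| <= 1 -> q x = q y -> `|x - y| <= s.
  move=> hx hy e.
  have tb t : `|t| <= 1 -> (Num.truncn ((t + 1) / s))%:R <= (t + 1) / s < (Num.truncn ((t + 1) / s)).+1%:R.
    by rewrite ler_norml => /andP[h1 _]; apply: truncn_itv; rewrite divr_ge0 ?(ltW s0) //; lra.
  have tK t : `|t| <= 1 -> (Num.truncn ((t + 1) / s) < K.+1)%N.
    move=> ht; have /andP[h _] := tb t ht; rewrite ltnS -(ler_nat R) ltW //.
    apply: (le_lt_trans h); apply: le_lt_trans Kb; rewrite ler_pM2r ?invr_gt0 //.
    by move: ht; rewrite ler_norml; lra.
  have e' : Num.truncn ((x + 1) / s) = Num.truncn ((y + 1) / s).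
    by have := congr1 (@nat_of_ord _) e; rewrite /q !inordK ?tK.
  have /andP[a1 a2] := tb _ hx; have /andP[b1 b2] := tb _ hy.
  rewrite e' -natr1 in a1 a2; rewrite -natr1 in b2; move: a1 a2 b1 b2.
  move: (_%:R) => n; rewrite ler_pdivlMr // ltr_pdivrMr // ler_pdivlMr // ltr_pdivrMr //.
  by rewrite ler_norml; nra.
exists (#|{: 'I_K.+1 * 'I_K.+1}|%:R^-1).
  by rewrite invr_gt0 ltr0n; apply/card_gt0P; exists (ord0, ord0).
move=> I S z z1.
have [|S' [sS cS] hS] := @pigeonhole I ('I_K.+1 * 'I_K.+1)%type S (fun i => (q (Re (z i)), q (Im (z i)))).
  by apply/card_gt0P; exists (ord0, ord0).
exists S'; first by split => //; rewrite ler_pdivrMl // ltr0n; apply/card_gt0P; exists (ord0, ord0).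
move=> i j Si Sj; have [e1 e2] := hS i j Si Sj.
apply: le_trans (cn_le_ReIm _) _; rewrite (_ : d = s + s); last by rewrite /s; lra.
have bR i' : `|Re (z i')| <= 1 by apply: le_trans (Re_le_cn _) _.
have bI i' : `|Im (z i')| <= 1 by apply: le_trans (Im_le_cn _) _.
have -> : Re (z i - z j) = Re (z i) - Re (z j) by case: (z i); case: (z j).
have -> : Im (z i - z j) = Im (z i) - Im (z j) by case: (z i); case: (z j).
by apply: lerD; apply: qP.
Qed.

Lemma pigeonhole_seq (d : R) (m : nat) : 0 < d -> exists2 c : R, 0 < c &
  forall (I : finType) (S : {set I}) (J : eqType) (r : seq J) (z : J -> I -> R[i]), (size r <= m)%N ->
  (forall j i, cn (z j i) <= 1) ->
  exists2 S' : {set I}, S' \subset S /\ c * #|S|%:R <= #|S'|%:R &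
    {in S' &, forall i j, forall l, l \in r -> cn (z l i - z l j) <= d}.
Proof.
move=> d0; have [c c0 hc] := pigeonhole_cplx d0.
have cm0 n : 0 < (Num.min c 1) ^+ n by rewrite exprn_gt0 // lt_min c0 ltr01.
exists (Num.min c 1 ^+ m) => // I S J r; elim: m r S => [|m IH] [|l r] S z //= rm z1.
- by exists S; rewrite ?mul1r.
- exists S => //; split => //; apply: ler_piMl => //.
  by apply: exprn_ile1; rewrite ?ge_min ?lexx ?orbT // le_min ltW //= ler01.
have [S1 [sS1 cS1] hS1] := hc I S (z l) (z1 l).
have [S2 [sS2 cS2] hS2] := IH r S1 z rm z1.
exists S2.
  split; first exact: subset_trans sS2 sS1.
  apply: le_trans cS2; rewrite exprSr -mulrA ler_wpM2l ?(ltW (cm0 _)) //.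
  by apply: le_trans cS1; rewrite ler_wpM2r // ge_min lexx.
move=> i j Si Sj l'; rewrite inE => /orP[/eqP->|]; last exact: hS2.
by apply: hS1; apply: (subsetP sS2).
Qed.
End Pigeonhole.

Section Sampling.
Variable R : realType.

(** Since a - w has mean 0, the cross term vanishes and the mean of |D + a - w|^2 is |D|^2 + E|w|^2
    - |a|^2. The mean a is given through a product, so that an empty P needs no separate
    treatment. *)
Lemma avg_sq_le (Y : finType) (P : pred Y) (D a : R[i]) (w : Y -> R[i]) :
  (forall y, cn (w y) <= 1) -> (\sum_(y | P y) 1) * a = \sum_(y | P y) w y ->
  \sum_(y | P y) cn (D + a - w y) ^+ 2 <= \sum_(y | P y) (cn D ^+ 2 + 1).
Proof.
move=> w1 ha; set n : R := \sum_(y | P y) 1.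
have nC : \sum_(y | P y) 1 = n%:C by rewrite /n rmorph_sum.
rewrite nC in ha.
have hR : n * Re a = \sum_(y | P y) Re (w y) by rewrite -ReM_real ha Re_sum.
have hI : n * Im a = \sum_(y | P y) Im (w y).
  transitivity (Im (n%:C * a)); first by case: (a) => p q /=; rewrite mul0r addr0.
  by rewrite ha; apply: (big_morph (@Im R)) => // -[? ?] [? ?].
have n0 : 0 <= n by apply: sumr_ge0.
have -> : \sum_(y | P y) (cn D ^+ 2 + 1) = n * cn D ^+ 2 + n.
  by rewrite big_split /= /n mulr_suml; congr (_ + _); apply: eq_bigr => y _; rewrite mul1r.
apply: (@le_trans _ _ (n * (cn D ^+ 2 - cn a ^+ 2) + n)); last first.
  by rewrite lerD2r ler_wpM2l // gerBl sqr_ge0.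
have step y : P y -> cn (D + a - w y) ^+ 2 <=
   ((Re D + Re a) ^+ 2 + (Im D + Im a) ^+ 2) * 1 + 1 - 2 * (Re D + Re a) * Re (w y) - 2 * (Im D + Im a) * Im (w y).
  have : cn (w y) ^+ 2 <= 1 by rewrite expr_le1 ?cn_ge0.
  by move=> + _; rewrite !cn_sqE; case: (D) (a) (w y) => [p q] [p' q'] [p2 q2] /=; lra.
apply: le_trans (ler_sum _ step) _.
rewrite !sumrB big_split /= -!mulr_sumr -/n -hR -hI !cn_sqE.
by move: (Re D) (Im D) (Re a) (Im a) => p q p' q'; lra.
Qed.

(** Sampling without probability: the y are picked one at a time, each at least as good as the
    average choice, which by [avg_sq_le] adds at most 1 to the squared error of each i. After
    division by m the mean square error is 1/m, whatever the size of X. *)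
Lemma sampling (I X T : finType) (S : {set I}) (Y : {set X}) (w : I -> X -> T -> R[i])
    (a : I -> T -> R[i]) (m : nat) (x0 : T) :
  (exists y, y \in Y) -> (forall i y x, cn (w i y x) <= 1) ->
  (forall i x, #|Y|%:R * a i x = \sum_(y in Y) w i y x) ->
  exists2 r : seq X, size r = m &
    \sum_(i in S) \E_x cn (m%:R * a i x - \sum_(y <- r) w i y x) ^+ 2 <= m%:R * #|S|%:R.
Proof.
move=> Y0 w1 ha; elim: m => [|m [r sr IH]].
  exists [::] => //; rewrite mul0r; apply: sumr_le0 => i _.
  by rewrite exE; under eq_bigr do rewrite big_nil mul0r subr0 cn0 expr0n; rewrite big1_eq mulr0.
pose D i x := m%:R * a i x - \sum_(y <- r) w i y x.
have [y Yy hy] : exists2 y, y \in Y &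
    \sum_(i in S) \E_x cn (D i x + a i x - w i y x) ^+ 2 <= m.+1%:R * #|S|%:R.
  apply: exists_le_avg => //; rewrite exchange_big /=.
  apply: (@le_trans _ _ (\sum_(i in S) \sum_(y in Y) \E_x (cn (D i x) ^+ 2 + 1))).
    apply: ler_sum => i _; rewrite -!ex_sum; apply: ler_ex => x.
    by apply: avg_sq_le => //; rewrite sumr_const.
  rewrite exchange_big /=; apply: ler_sum => y _.
  under eq_bigr do rewrite exD (ex_const x0).
  by rewrite big_split /= -natr1 mulrDl mul1r sumr_const lerD2r.
exists (y :: r) => /=; first by rewrite sr.
congr (_ <= _): hy; apply: eq_bigr => i _; apply: eq_ex => x; congr (cn _ ^+ 2).
by rewrite big_cons /D -natr1; ring.
Qed.

Lemma sqr_le_abs (x y : R) : 0 <= y -> x ^+ 2 <= y ^+ 2 -> x <= y.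
Proof. by move=> y0 h; rewrite leNgt; apply/negP => k; nra. Qed.

(** All a i are averages of the same bounded functions v y. After sampling m of the y, a i is nearly
    determined by its m coefficients u i y in the unit disc, and the pigeonhole principle applies to
    these. So c does not depend on the sizes of I, X and T. *)
Lemma totally_bounded (eps : R) : 0 < eps -> exists2 c : R, 0 < c &
  forall (I X T : finType) (x0 : T) (S : {set I}) (Y : {set X}) (u : I -> X -> R[i])
    (v : X -> T -> R[i]) (a : I -> T -> R[i]),
  (exists y, y \in Y) -> (forall i y, cn (u i y) <= 1) -> (forall y x, cn (v y x) <= 1) ->
  (forall i x, #|Y|%:R * a i x = \sum_(y in Y) u i y * v y x) ->
  exists2 S' : {set I}, S' \subset S /\ c * #|S|%:R <= #|S'|%:R &
    {in S' &, forall i j, \E_x cn (a i x - a j x) <= eps}.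
Proof.
move=> e0; pose e := eps / 3; have e0' : 0 < e by rewrite divr_gt0.
pose m := (Num.bound (2 / e ^+ 2)).+1.
have mb : 2 / m%:R <= e ^+ 2.
  rewrite ler_pdivrMr ?ltr0n // -ler_pdivrMl ?exprn_gt0 // mulrC.
  apply: (@le_trans _ _ (Num.bound (2 / e ^+ 2))%:R); last by rewrite ler_nat.
  by apply/ltW/archi_boundP; rewrite divr_ge0 // sqr_ge0.
have [c c0 hc] := pigeonhole_seq m e0'.
exists (c / 2); first by rewrite divr_gt0.
move=> I X T x0 S Y u v a Y0 u1 v1 ha.
have [|r sr hr] := @sampling I X T S Y (fun i y x => u i y * v y x) a m x0 Y0 _ ha.
  by move=> i y x; rewrite cnM mulr_ile1 ?cn_ge0.
pose b i x := m%:R^-1 * \sum_(y <- r) u i y * v y x.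
have m0 : (m%:R : R) != 0 by rewrite pnatr_eq0.
have m0C : (m%:R : R[i]) != 0 by rewrite pnatr_eq0.
pose err i := \E_x cn (a i x - b i x) ^+ 2.
have err0 i : 0 <= err i by apply: ex_ge0 => x; rewrite sqr_ge0.
have hr' : \sum_(i in S) err i <= #|S|%:R / m%:R.
  rewrite ler_pdivlMr ?ltr0n // -(ler_pM2l (x := m%:R)) ?ltr0n //.
  apply: le_trans hr; rewrite mulrCA -expr2 mulr_suml; apply: ler_sum => i _.
  rewrite /err -exZr; apply: ler_ex => x; rewrite -(cn_nat R m) -exprMn -cnM.
  by rewrite mulrBl /b mulrAC mulVf // mul1r mulrC.
(* The i with small sampling error; by Markov's inequality they are at least half of S, whence the
   factor 1/2 in the constant. *)
pose S1 := [set i in S | err i <= e ^+ 2].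
have cS1 : #|S|%:R / 2 <= (#|S1|%:R : R).
  have : \sum_(i in S :\: S1) (2 / m%:R) <= \sum_(i in S) err i.
    rewrite [leRHS](bigID (fun i => i \in S1)) /= addrC ler_wpDr //; first exact: sumr_ge0.
    rewrite (eq_bigl (fun i => (i \in S) && (i \notin S1))); last by move=> i; rewrite !inE andbC.
    apply: ler_sum => i /andP[iS]; rewrite inE iS /= -ltNge => /ltW; exact: le_trans.
  move=> h; have := le_trans h hr'; rewrite sumr_const -[leLHS]mulr_natr.
  rewrite -mulrA [_^-1 * _]mulrC mulrA ler_pM2r ?invr_gt0 ?ltr0n // => h'.
  have := cardsID S1 S; rewrite (setIidPr _); last by apply/subsetP => i; rewrite inE => /andP[].
  by move=> /(congr1 (fun n => n%:R : R)); rewrite natrD; lra.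
have [|S2 [sS2 cS2] hS2] := hc I S1 X r (fun y i => u i y) (eq_leq sr).
  by move=> y i; apply: u1.
exists S2.
  split; first by apply: subset_trans sS2 _; apply/subsetP => i; rewrite inE => /andP[].
  by apply: le_trans cS2; rewrite mulrAC -mulrA ler_pM2l.
have ab i : i \in S2 -> \E_x cn (a i x - b i x) <= e.
  move=> /(subsetP sS2); rewrite inE => /andP[_ h].
  by apply: sqr_le_abs; [exact: ltW|apply: le_trans (sqr_ex_le _) _].
move=> i j Si Sj.
have bb : \E_x cn (b i x - b j x) <= e.
  apply: (ex_le x0) => x; rewrite /b -mulrBr -sumrB cnM cnV cn_nat ler_pdivrMl ?ltr0n //.
  apply: le_trans (cn_sum _ _ _) _.
  apply: (@le_trans _ _ (\sum_(y <- r) e)).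
    rewrite big_seq [leRHS]big_seq; apply: ler_sum => y yr; rewrite -mulrBl cnM.
    by apply: le_trans (hS2 i j Si Sj y yr); apply: ler_piMr; rewrite ?cn_ge0.
  by rewrite big_const_seq count_predT iter_addr_0 sr mulr_natl.
have -> : eps = e + e + e by rewrite /e; lra.
apply: (@le_trans _ _ (\E_x (cn (a i x - b i x) + cn (b i x - b j x) + cn (a j x - b j x)))).
  apply: ler_ex => x; rewrite [cn (a j x - _)]cnB; apply: le_trans (lerD (cnD _ _) (lexx _)).
  by apply: le_trans (cnD _ _); rewrite (_ : _ + _ = a i x - a j x) //; ring.
by rewrite !exD; apply: lerD; [apply: lerD|]; rewrite ?ab.
Qed.
End Sampling.

(** * The inverse theorem for the U^3 norm *)
Section NestedPigeonhole.
Variable R : realType.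

(** In [qphase] one g must serve every accuracy eps, so one p0 has to serve all j. The refinements
    are therefore nested: the decreasing sequence of sets is eventually constant because I is
    finite, and p0 is taken from the eventual set, which lies inside all of them. *)
Lemma nested_pigeonhole (I : finType) (rel : nat -> I -> I -> bool) (c : nat -> R) (S : {set I}) :
  (forall j, 0 < c j) -> S != set0 ->
  (forall j (S1 : {set I}), S1 \subset S -> exists2 S2 : {set I}, S2 \subset S1 /\ c j * #|S1|%:R <= #|S2|%:R &
     {in S2 &, forall p q, rel j p q}) ->
  exists2 p0, p0 \in S & forall j, exists2 S' : {set I},
    [/\ S' \subset S, p0 \in S' & (\prod_(l < j.+1) c l) * #|S|%:R <= #|S'|%:R] &
    {in S', forall p, rel j p p0}.
Proof.
move=> c0 S0 hS.
pose ok j (S1 S2 : {set I}) := [&& S2 \subset S1, c j * #|S1|%:R <= #|S2|%:R &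
  [forall p in S2, forall q in S2, rel j p q]].
pose next j (S1 : {set I}) := odflt S1 [pick S2 | ok j S1 S2].
have nextP j (S1 : {set I}) : S1 \subset S -> ok j S1 (next j S1).
  move=> s1; rewrite /next; case: pickP => //= no.
  have [S2 [h1 h2] h3] := hS j S1 s1; have := no S2; rewrite /ok h1 h2 /= => /negP[].
  by apply/forall_inP => p hp; apply/forall_inP => q hq; apply: h3.
pose Sq := fix F j := if j is j'.+1 then next j' (F j') else S.
have Sqsub j : Sq j \subset S.
  by elim: j => //= j IH; have /and3P[h _ _] := nextP j _ IH; apply: subset_trans IH.
have Sqmono j k : Sq (j + k)%N \subset Sq j.
  elim: k => [|k IH]; first by rewrite addn0.
  by rewrite addnS /=; have /and3P[h _ _] := nextP (j + k)%N _ (Sqsub (j + k)%N); apply: subset_trans IH.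
have Sqcard j : (\prod_(l < j) c l) * #|S|%:R <= #|Sq j|%:R.
  elim: j => [|j IH]; first by rewrite big_ord0 mul1r.
  rewrite big_ord_recr /= mulrAC mulrC; have /and3P[_ h _] := nextP j _ (Sqsub j).
  by apply: le_trans h; rewrite ler_pM2l.
have Sqn0 j : Sq j != set0.
  rewrite -card_gt0 -(ltr0n R); apply: lt_le_trans (Sqcard j).
  by rewrite mulr_gt0 ?ltr0n ?card_gt0 // prodr_gt0.
have [j0 hj0] : exists j0, forall k, Sq (j0 + k)%N = Sq j0.
  suff H n : forall j, (#|Sq j| <= n)%N -> exists j0, forall k, Sq (j0 + k)%N = Sq j0 by apply: (H _ 0%N (leqnn _)).
  elim: n => [|n IH] j.
    by rewrite leqn0 cards_eq0 (negPf (Sqn0 j)).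
  move=> hn; have [/forallP|] := boolP [forall T : {set I}, T == T].
    move=> _; have [[k hk]|no] : (exists k, Sq (j + k)%N != Sq j) \/ ~ (exists k, Sq (j + k)%N != Sq j) by apply: boolp.EM.
      apply: (IH (j + k)%N); rewrite -ltnS; apply: leq_trans hn.
      by apply: proper_card; rewrite properEneq hk Sqmono.
    exists j => k; apply/eqP/negPn/negP => h; apply: no; by exists k.
  by rewrite negb_forall => /existsP[T]; rewrite eqxx.
have /set0Pn[p0 hp0] := Sqn0 j0.
exists p0; first exact: (subsetP (Sqsub j0)).
move=> j; exists (Sq j.+1).
  split; [exact: Sqsub| |exact: Sqcard].
  have [h|h] := leqP j.+1 j0.
    by apply: (subsetP (Sqmono j.+1 (j0 - j.+1)%N)); rewrite subnKC.
  by rewrite -(subnKC (ltnW h)) hj0.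
have /and3P[_ _ /forall_inP h] := nextP j _ (Sqsub j).
move=> p hp; have /forall_inP := h p hp; apply.
have [h'|h'] := leqP j.+1 j0.
  by apply: (subsetP (Sqmono j.+1 (j0 - j.+1)%N)); rewrite subnKC.
by rewrite -[next j _]/(Sq j.+1) -(subnKC (ltnW h')) hj0.
Qed.
End NestedPigeonhole.

Section Ambiguity.
Variables (R : realType) (G : finComNzRingType) (chi : G -> R[i]).
Hypothesis hchi : charsys chi.
Implicit Types (f g : G -> R[i]) (p q : G * G).

(** Time-frequency shifts: a translation by p.1 and a modulation by p.2. They compose up to a scalar
    of modulus 1 ([tfshiftC]), and [ambig f p] is the inner product of f with its shift by p
    ([ambigE]). *)
Definition tfshift p f : G -> R[i] := fun x => chi (- (p.2 * x)) * f (x + p.1).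
Definition ambig f p : R[i] := fourier chi (mdiff f p.1) p.2.
Definition ambig2 f p : R := cn (ambig f p) ^+ 2.

Lemma ambigE f p : ambig f p = \E_x f x * (tfshift p f x)^*.
Proof.
apply: eq_ex => x; rewrite /mdiff /tfshift rmorphM /= (chi_conj hchi) opprK; by ring.
Qed.

Lemma ambig2_ge0 f p : 0 <= ambig2 f p. Proof. exact: sqr_ge0. Qed.

Lemma cn_tfshift p f x : cn (tfshift p f x) = cn (f (x + p.1)).
Proof. by rewrite cnM (cn_chi hchi) mul1r. Qed.
Lemma bounded1_tfshift p f : bounded1 f -> bounded1 (tfshift p f).
Proof. by move=> h x; rewrite cn_tfshift. Qed.

Lemma tfshiftC p q f x : tfshift (- p) (tfshift q f) x = chi (q.2 * p.1) * tfshift (q - p) f x.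
Proof.
rewrite /tfshift /= mulrA mulrA -!(chiD hchi); congr (_ * f _); last by ring.
by congr chi; ring.
Qed.

Lemma inner_tfshift p q f :
  cn (\E_x tfshift p f x * (tfshift q f x)^*) ^+ 2 = ambig2 f (q - p).
Proof.
rewrite /ambig2 ambigE -[X in cn X](ex_shift (- p.1)).
rewrite [in LHS](eq_ex (g := fun x => chi ((p.2 - q.2) * p.1) * (f x * (tfshift (q - p) f x)^*))).
  by rewrite [in LHS]exZ [in LHS](cnM (chi _)) (cn_chi hchi) mul1r.
move=> x; rewrite /tfshift /= subrK !rmorphM /= !(chi_conj hchi) !opprK.
rewrite (_ : x - p.1 + q.1 = x + (q.1 - p.1)); last by ring.
have e : chi (- (p.2 * (x - p.1))) * chi (q.2 * (x - p.1)) =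
         chi ((p.2 - q.2) * p.1) * chi ((q.2 - p.2) * x).
  by rewrite -!(chiD hchi); congr chi; ring.
by rewrite mulrACA e; ring.
Qed.

Lemma ambig2_sum f a : bounded1 f -> \sum_k ambig2 f (a, k) <= 1.
Proof.
move=> hf; rewrite /ambig2 /ambig /= (parseval hchi (mdiff f a)); apply: (ex_le (0 : G)) => x.
by rewrite expr_le1 ?cn_ge0 //; apply: bounded1_mdiff.
Qed.

Lemma cardG_gt0 : 0 < #|G|%:R :> R.
Proof. by rewrite ltr0n; apply/card_gt0P; exists (0 : G). Qed.

Lemma ambig2_sum_all f : bounded1 f -> \sum_p ambig2 f p <= #|G|%:R.
Proof.
move=> hf; rewrite -(pair_bigA _ (fun a k => ambig2 f (a, k))) /=.
rewrite (_ : #|G|%:R = \sum_(a : G) 1); last by rewrite sumr_const.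
by apply: ler_sum => a _; apply: ambig2_sum.
Qed.

Lemma U3_ambig f : #|G|%:R * U3 f = \sum_p ambig2 f p ^+ 2.
Proof.
rewrite -(pair_bigA _ (fun a k => ambig2 f (a, k) ^+ 2)) /= -(sum_ex (0 : G)).
by apply: eq_bigr => a _; rewrite (U2_fourier hchi); apply: eq_bigr => k _; rewrite /ambig2 -exprM.
Qed.

(** The sum of [ambig2] is a form in f with kernel K, a sum of rank-one kernels. Two applications of
    Cauchy-Schwarz remove f. The squared Hilbert-Schmidt norm of K is the sum of the squared inner
    products of the shifts of f by p and q, which [inner_tfshift] evaluates. *)
Lemma ambig2_psd f (Gam : {set G * G}) : bounded1 f ->
  (\sum_(p in Gam) ambig2 f p) ^+ 2 <= \sum_(p in Gam) \sum_(q in Gam) ambig2 f (q - p).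
Proof.
move=> hf.
pose K x y := \sum_(p in Gam) (tfshift p f x)^* * tfshift p f y.
have h1 : (\sum_(p in Gam) ambig2 f p)%:C = \E_x f x * \E_y (f y)^* * K x y.
  rewrite rmorph_sum /=.
  transitivity (\sum_(p in Gam) \E_x \E_y f x * (f y)^* * ((tfshift p f x)^* * tfshift p f y)).
    apply: eq_bigr => p _; rewrite /ambig2 sqr_cn ambigE ex_conj -exZr; apply: eq_ex => x.
    rewrite -exZ; apply: eq_ex => y; rewrite (rmorphM _ (f y)) /= conjCK; by ring.
  rewrite -ex_sum; apply: eq_ex => x; rewrite -ex_sum -exZ; apply: eq_ex => y.
  by rewrite /K -mulr_sumr mulrA.
have h2 : (\sum_(p in Gam) ambig2 f p) ^+ 2 <= \E_x \E_y cn (K x y) ^+ 2.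
  have -> : \sum_(p in Gam) ambig2 f p = cn (\E_x f x * \E_y (f y)^* * K x y).
    by rewrite -h1 cnR ger0_norm // sumr_ge0 // => p _; apply: ambig2_ge0.
  apply: le_trans (cs_bounded1 _ hf) _; apply: ler_ex => x.
  by apply: cs_bounded1 => y; rewrite cn_conj.
apply: le_trans h2 _; rewrite le_eqVlt; apply/orP; left; apply/eqP; apply: (@complexI R).
rewrite ex_real; under eq_ex do rewrite ex_real.
transitivity (\sum_(p in Gam) \sum_(q in Gam) \E_x \E_y
   ((tfshift p f x)^* * tfshift p f y) * ((tfshift q f x)^* * tfshift q f y)^*).
  under eq_ex => x.
    under eq_ex do rewrite sqr_cn /K rmorph_sum /= mulr_suml.
    rewrite ex_sum; under eq_bigr do under eq_ex do rewrite mulr_sumr.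
    under eq_bigr do rewrite ex_sum.
    over.
  by rewrite ex_sum; apply: eq_bigr => p _; rewrite ex_sum.
rewrite rmorph_sum /=; apply: eq_bigr => p _; rewrite rmorph_sum /=; apply: eq_bigr => q _.
rewrite -inner_tfshift sqr_cn ex_conj mulrC -exZr; apply: eq_ex => x.
rewrite -exZ; apply: eq_ex => y; rewrite !(rmorphM _ (tfshift _ _ _)^*) !(rmorphM _ (tfshift _ _ _)) /= !conjCK; by ring.
Qed.

(* A soft substitute for quadratic phases: in many directions d the derivative of g is linear up to a factor that does not
   depend on d. *)
Definition qphase (prof : R -> R) (nu : R) g :=
  [/\ bounded1 g, nu <= \E_x cn (g x) &
   forall eps, 0 < eps -> exists (E : {set G}) (xi : G -> G) (h : G -> R[i]),
     prof eps * #|G|%:R <= #|E|%:R /\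
     {in E, forall d, \E_x cn (g (x + d) - chi (xi d * x) * h x) <= eps}].
End Ambiguity.

(** * Large values of the ambiguity function *)

Section LargeSpectrum.
Variables (R : realType) (G : finComNzRingType) (chi : G -> R[i]).
Hypothesis hchi : charsys chi.
Variable f : G -> R[i].
Hypothesis hf : bounded1 f.

Definition lset (t : R) := [set p : G * G | t <= ambig2 chi f p].

Lemma ambig2_le1 p : ambig2 chi f p <= 1.
Proof.
case: p => a k; apply: le_trans (ambig2_sum hchi a hf).
by rewrite (bigD1 k) //= lerDl sumr_ge0 // => i _; apply: ambig2_ge0.
Qed.

Lemma card_lset t : t * #|lset t|%:R <= #|G|%:R.
Proof.
apply: le_trans (ambig2_sum_all hchi hf).
rewrite [leRHS](bigID (mem (lset t))) /= ler_wpDr ?sumr_ge0 // => [p _|]; first exact: ambig2_ge0.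
rewrite mulr_natr -sumr_const; apply: ler_sum => p; by rewrite inE.
Qed.

Lemma card_lset_fiber t a : t * #|[set k | (a, k) \in lset t]|%:R <= 1.
Proof.
apply: le_trans (ambig2_sum hchi a hf).
rewrite [leRHS](bigID (mem [set k | (a, k) \in lset t])) /= ler_wpDr ?sumr_ge0 // => [p _|]; first exact: ambig2_ge0.
rewrite mulr_natr -sumr_const; apply: ler_sum => p; by rewrite !inE.
Qed.

(** By [U3_ambig] the squares of [ambig2] sum to at least eta |G|; values below eta/2 account for at
    most half of this, because [ambig2] itself sums to at most |G|. *)
Lemma lset_mass eta : 0 < eta -> eta <= U3 f ->
  eta / 2 * #|G|%:R <= \sum_(p in lset (eta / 2)) ambig2 chi f p.
Proof.
move=> e0 hU; have := U3_ambig hchi f; set N := #|G|%:R => hN.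
have N0 : 0 < N by apply: cardG_gt0.
have h1 : eta * N <= \sum_p ambig2 chi f p ^+ 2 by rewrite -hN mulrC ler_wpM2l // ltW.
rewrite (bigID (mem (lset (eta / 2)))) /= in h1.
have h2 : \sum_(p in lset (eta / 2)) ambig2 chi f p ^+ 2 <= \sum_(p in lset (eta / 2)) ambig2 chi f p.
  by apply: ler_sum => p _; rewrite expr2 ler_piMl ?ambig2_ge0 ?ambig2_le1.
have h3 : \sum_(p | p \notin lset (eta / 2)) ambig2 chi f p ^+ 2 <= eta / 2 * N.
  apply: (@le_trans _ _ (eta / 2 * \sum_p ambig2 chi f p)); last first.
    by rewrite ler_wpM2l ?divr_ge0 ?(ltW e0) //; apply: ambig2_sum_all.
  rewrite [X in _ <= _ * X](bigID (mem (lset (eta / 2)))) /= mulrDr ler_wpDl //.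
    by rewrite mulr_ge0 ?divr_ge0 ?(ltW e0) ?sumr_ge0 // => p _; apply: ambig2_ge0.
  rewrite mulr_sumr; apply: ler_sum => p; rewrite inE -ltNge => /ltW h.
  by rewrite expr2 ler_wpM2r ?ambig2_ge0.
by lra.
Qed.

Lemma lset_card_ge eta : 0 < eta -> eta <= U3 f -> eta / 2 * #|G|%:R <= #|lset (eta / 2)|%:R.
Proof.
move=> e0 hU; apply: le_trans (lset_mass e0 hU) _.
by rewrite -sumr_const; apply: ler_sum => p _; apply: ambig2_le1.
Qed.

(** In terms of t = eta/2 the constants are t' = t^4/2 and k = t^3/4. By [ambig2_psd] and
    [lset_mass] the values at q - p over pairs from [lset t] sum to at least (t|G|)^2. As [lset t]
    has at most |G|/t elements, the values below t' contribute at most half of this and the p with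
    fewer than k|G| partners at most a quarter; the last quarter forces P to be large. *)
Lemma popular_shifts eta (t := eta / 2) (t' := eta ^+ 2 * t ^+ 2 / 8) (k := eta ^+ 2 * t / 16)
  (P := [set p in lset t | k * #|G|%:R <= #|[set q in lset t | (q - p)%R \in lset t']|%:R]) :
  0 < eta -> eta <= U3 f -> k * #|G|%:R <= #|P|%:R.
Proof.
move=> e0 hU.
have t0 : 0 < t by rewrite divr_gt0.
have N0 : 0 < #|G|%:R :> R by apply: cardG_gt0.
have hG := card_lset t; have hm := lset_mass e0 hU; rewrite -/t in hm.
have psd := ambig2_psd hchi (lset t) hf.
have k0 : 0 <= k by rewrite /k divr_ge0 // mulr_ge0 ?sqr_ge0 // ltW.
have t'0 : 0 <= t' by rewrite /t' divr_ge0 // mulr_ge0 ?sqr_ge0.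
pose cnt p : R := #|[set q in lset t | q - p \in lset t']|%:R.
have h1 p : \sum_(q in lset t) ambig2 chi f (q - p) <= cnt p + t' * #|lset t|%:R.
  rewrite (bigID (fun q => q - p \in lset t')) /=; apply: lerD.
    rewrite /cnt -sumr_const; under [leRHS]eq_bigl do rewrite inE.
    by apply: ler_sum => q _; apply: ambig2_le1.
  apply: (@le_trans _ _ (\sum_(q in lset t) t')); last by rewrite sumr_const mulr_natr.
  rewrite [leRHS](bigID (fun q => q - p \in lset t')) /= ler_wpDl //.
    by apply: sumr_ge0 => q _.
  by apply: ler_sum => q /andP[_]; rewrite !inE -ltNge => /ltW.
have h2 : \sum_(p in lset t) cnt p <= #|P|%:R * #|lset t|%:R + k * #|G|%:R * #|lset t|%:R.
  rewrite (bigID (mem P)) /=; apply: lerD.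
    apply: (@le_trans _ _ (\sum_(p in P) #|lset t|%:R)); last by rewrite sumr_const mulr_natl.
    rewrite [leLHS](eq_bigl (mem P)); last first.
      by move=> p; rewrite !inE andbA andbb.
    by apply: ler_sum => p _; rewrite ler_nat; apply: subset_leq_card; apply/subsetP => q; rewrite inE => /andP[].
  apply: (@le_trans _ _ (\sum_(p in lset t) k * #|G|%:R)); last by rewrite sumr_const -[leLHS]mulr_natr.
  rewrite [leRHS](bigID (mem P)) /= ler_wpDl //.
    by apply: sumr_ge0 => q _; rewrite mulr_ge0.
  by apply: ler_sum => p /andP[pl]; rewrite inE pl /= -ltNge => /ltW.
have h3 : (t * #|G|%:R) ^+ 2 <= \sum_(p in lset t) (cnt p + t' * #|lset t|%:R).
  apply: le_trans (le_trans psd _); last by apply: ler_sum => p _; apply: h1.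
  have tN0 : 0 <= t * #|G|%:R by rewrite mulr_ge0 // ltW.
  by rewrite ler_pXn2r ?nnegrE //; apply: le_trans hm.
rewrite big_split /= sumr_const -[X in _ <= _ + X]mulr_natr in h3.
have -> : k = 4 * t ^+ 3 / 16 by rewrite /k /t; field.
have e1 : t' = t ^+ 4 / 2 by rewrite /t' /t; field.
have e2 : k = t ^+ 3 / 4 by rewrite /k /t; field.
rewrite e1 in h3; rewrite e2 in h2.
move: h2 h3 hG; move: (\sum_(p in _) _) => S.
have : 0 <= #|lset t|%:R :> R by []. have : 0 <= #|P|%:R :> R by [].
move: (#|lset t|%:R) (#|P|%:R) (#|G|%:R) N0 => L Q N N0 Q0 L0 h2 h3 hG.
have tN0 : 0 < t * N by rewrite mulr_gt0.
have a1 : (t * L) ^+ 2 <= N ^+ 2 by have : 0 <= t * L by [rewrite mulr_ge0 // ltW]; nra.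
have a1' : t ^+ 2 * (t * L) ^+ 2 <= t ^+ 2 * N ^+ 2 by rewrite ler_wpM2l ?sqr_ge0.
have a2 : (t * N) ^+ 2 / 2 <= S by nra.
have a3 : Q * (t * L) <= Q * N by rewrite ler_wpM2l.
have a4 : t ^+ 3 / 4 * N * (t * L) <= t ^+ 3 / 4 * N * N.
  by rewrite ler_wpM2l // mulr_ge0 ?(ltW N0) // divr_ge0 // exprn_ge0 // ltW.
have a5 : t * S <= Q * N + t ^+ 3 / 4 * N * N by nra.
have a6 : t ^+ 3 * N ^+ 2 / 2 <= t * S by nra.
have a7 : N * (t ^+ 3 * N / 4) <= N * Q by nra.
by rewrite ler_pM2l // in a7; lra.
Qed.
End LargeSpectrum.

Section InverseU3.
Variable R : realType.

Lemma tb_choice (e : nat -> R) : (forall j, 0 < e j) -> exists c : nat -> R, forall j, 0 < c j /\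
  forall (I X T : finType) (x0 : T) (S : {set I}) (Y : {set X}) (u : I -> X -> R[i])
    (v : X -> T -> R[i]) (a : I -> T -> R[i]),
  (exists y, y \in Y) -> (forall i y, cn (u i y) <= 1) -> (forall y x, cn (v y x) <= 1) ->
  (forall i x, #|Y|%:R * a i x = \sum_(y in Y) u i y * v y x) ->
  exists2 S' : {set I}, S' \subset S /\ c j * #|S|%:R <= #|S'|%:R &
    {in S' &, forall i k, \E_x cn (a i x - a k x) <= e j}.
Proof.
move=> e0; suff H : forall j, exists c : R, 0 < c /\
  forall (I X T : finType) (x0 : T) (S : {set I}) (Y : {set X}) (u : I -> X -> R[i])
    (v : X -> T -> R[i]) (a : I -> T -> R[i]),
  (exists y, y \in Y) -> (forall i y, cn (u i y) <= 1) -> (forall y x, cn (v y x) <= 1) ->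
  (forall i x, #|Y|%:R * a i x = \sum_(y in Y) u i y * v y x) ->
  exists2 S' : {set I}, S' \subset S /\ c * #|S|%:R <= #|S'|%:R &
    {in S' &, forall i k, \E_x cn (a i x - a k x) <= e j}.
  by have [c hc] := boolp.choice H; exists c.
by move=> j; have [c c0 hc] := totally_bounded (e0 j); exists c; split.
Qed.

(** A superposition of the shifts of f that correlate with f. The parameter p enters only through
    the weights, so [totally_bounded] applies to this family in p. By [tfshiftN_avgV] it also
    applies to the family shifted back by p, a superposition over r = q - p in Z. *)
Definition avgV (G : finComNzRingType) (chi : G -> R[i]) f (Y Z : {set G * G}) p : G -> R[i] :=
  fun x => #|Y|%:R^-1 * \sum_(q in Y) (q - p \in Z)%:R * ambig chi f q * tfshift chi q f x.

Section Avg.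
Variables (G : finComNzRingType) (chi : G -> R[i]).
Hypothesis hchi : charsys chi.
Variable f : G -> R[i].
Hypothesis hf : bounded1 f.

Lemma cn_ambig_le1 p : cn (ambig chi f p) <= 1.
Proof. by rewrite -(@expr_le1 _ 2) ?cn_ge0 //; apply: (ambig2_le1 hchi hf). Qed.

Lemma cn_bool_le1 (b : bool) : cn (b%:R : R[i]) <= 1.
Proof. by case: b; rewrite ?cn1 ?cn0 ?ler01. Qed.

Lemma bounded1_avgV (Y Z : {set G * G}) p : bounded1 (avgV chi f Y Z p).
Proof.
move=> x; rewrite cnM cnV cn_nat.
have [->|Y0] := eqVneq Y set0; first by rewrite cards0 invr0 mul0r ler01.
rewrite ler_pdivrMl ?ltr0n ?card_gt0 // mulr1; apply: le_trans (cn_sum _ _ _) _.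
rewrite -sumr_const; apply: ler_sum => q _.
rewrite (cnM (_ * _)) mulr_ile1 ?cn_ge0 //; last exact: (bounded1_tfshift hchi q hf x).
by rewrite (cnM _%:R) mulr_ile1 ?cn_ge0 ?cn_bool_le1 ?cn_ambig_le1.
Qed.

Lemma inner_avgV (Y Z : {set G * G}) p :
  Re (\E_x f x * (avgV chi f Y Z p x)^*) =
  #|Y|%:R^-1 * \sum_(q in Y) (q - p \in Z)%:R * ambig2 chi f q.
Proof.
have -> : \E_x f x * (avgV chi f Y Z p x)^* =
   (#|Y|%:R^-1 * \sum_(q in Y) (q - p \in Z)%:R * ambig2 chi f q)%:C.
  rewrite rmorphM /= fmorphV /= rmorph_nat rmorph_sum /=.
  transitivity (\E_x #|Y|%:R^-1 * \sum_(q in Y) ((q - p \in Z)%:R * (ambig chi f q)^*) * (f x * (tfshift chi q f x)^*)).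
    apply: eq_ex => x; rewrite /avgV (rmorphM _ (#|Y|%:R^-1)) /= fmorphV /= rmorph_nat mulrCA; congr (_ * _).
    rewrite rmorph_sum mulr_sumr; apply: eq_bigr => q _.
    by rewrite (rmorphM _ (_ * _)) (rmorphM _ _%:R) /= rmorph_nat; ring.
  rewrite exZ ex_sum; congr (_ * _); apply: eq_bigr => q _.
  by rewrite exZ -(ambigE hchi) -mulrA [_^* * _]mulrC -sqr_cn [in RHS]rmorphM /= rmorph_nat.
by [].
Qed.

Lemma tfshiftN_avgV (Y Z : {set G * G}) p x :
  tfshift chi (- p) (avgV chi f Y Z p) x = #|Y|%:R^-1 * \sum_(r in Z)
    (r + p \in Y)%:R * ambig chi f (r + p) * chi ((r + p).2 * p.1) * tfshift chi r f x.
Proof.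
have tsum c (K : finType) (P : pred K) (a : K -> R[i]) (h : K -> G -> R[i]) q y :
  tfshift chi q (fun z => c * \sum_(k | P k) a k * h k z) y =
  c * \sum_(k | P k) a k * tfshift chi q (h k) y.
  by rewrite /tfshift mulrCA; congr (_ * _); rewrite mulr_sumr; apply: eq_bigr => k _; ring.
rewrite /avgV tsum.
congr (_ * _).
rewrite [LHS]big_mkcond /= (reindex_inj (addIr p)) /= [RHS]big_mkcond /=.
apply: eq_bigr => r _; rewrite addrK (tfshiftC hchi) addrK.
by case: (r \in Z); case: (r + p \in Y); rewrite ?mul0r ?mul1r //; ring.
Qed.
End Avg.

(** Write a_p for [avgV chi f Y Z p]. For many p both a_p is close to a_p0 and its shift by -p is
    close to the shift of a_p0 by -p0. Hence the shift of a_p0 by -p hardly depends on p, which says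
    that a_p0, translated by d = -p.1, is a linear character times a fixed h. *)
Theorem inverse_U3 (eta : R) : 0 < eta -> exists (c1 : R) (prof : R -> R),
  [/\ 0 < c1, (forall e, 0 < e -> 0 < prof e) &
   forall (G : finComNzRingType) (chi : G -> R[i]), charsys chi ->
   forall f : G -> R[i], bounded1 f -> eta <= U3 f ->
   exists2 g : G -> R[i], qphase chi prof c1 g & c1 <= Re (\E_x f x * (g x)^*)].
Proof.
move=> e0; pose t := eta / 2; pose t' := eta ^+ 2 * t ^+ 2 / 8; pose k := eta ^+ 2 * t / 16.
have t0 : 0 < t by rewrite divr_gt0.
have t'0 : 0 < t' by rewrite /t' divr_gt0 // mulr_gt0 // exprn_gt0.
have k0 : 0 < k by rewrite /k divr_gt0 // mulr_gt0 // exprn_gt0.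
(* C bounds |Z| / |Y|, the factor between averages over Z and over Y; the accuracy [eb] is smaller
   than [ea] by this factor. *)
pose C := (t * t')^-1; have C0 : 0 < C by rewrite invr_gt0 mulr_gt0.
pose ea (j : nat) : R := 1 / (2 * j.+1%:R).
pose eb (j : nat) : R := 1 / (2 * C * j.+1%:R).
have ea0 j : 0 < ea j by rewrite divr_gt0 // mulr_gt0 // ltr0n.
have eb0 j : 0 < eb j by rewrite divr_gt0 // !mulr_gt0 // ltr0n.
have [ca hca] := tb_choice ea0; have [cb hcb] := tb_choice eb0.
pose c j := ca j * cb j.
have c0 j : 0 < c j by rewrite mulr_gt0 //; [case: (hca j)|case: (hcb j)].
(* At least k|G| of the q in Y contribute at least t each to the correlation, and |Y| <= |G|/t. *)
pose c1 := t ^+ 2 * k; have c10 : 0 < c1 by rewrite mulr_gt0 ?exprn_gt0.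
(* Passing from p to its first coordinate costs the factor t: at most 1/t frequencies lie above one
   shift ([card_lset_fiber]). *)
exists c1, (fun e => t * (\prod_(l < (Num.bound (1 / e)).+1) c l) * k); split => //.
  by move=> e _; rewrite mulr_gt0 // mulr_gt0 //; apply: prodr_gt0 => l _.
move=> G chi hchi f hf hU.
pose N : R := #|G|%:R; have N0 : 0 < N by apply: cardG_gt0.
pose Y := lset chi f t; pose Z := lset chi f t'.
pose P := [set p in Y | k * N <= #|[set q in Y | q - p \in Z]|%:R].
have hP : k * N <= #|P|%:R := popular_shifts hchi hf e0 hU.
have P0 : P != set0 by rewrite -card_gt0 -(ltr0n R); apply: lt_le_trans hP; rewrite mulr_gt0.
have YG := card_lset hchi hf t; rewrite -/N -/Y in YG.
have ZG := card_lset hchi hf t'; rewrite -/N -/Z in ZG.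
have Yge := lset_card_ge hchi hf e0 hU; rewrite -/t -/N -/Y in Yge.
have Y0 : 0 < #|Y|%:R :> R by apply: lt_le_trans Yge; rewrite mulr_gt0.
have Y0' : exists y, y \in Y by apply/card_gt0P; rewrite -(ltr0n R).
pose a p := avgV chi f Y Z p.
pose rel j p q := (\E_x cn (a p x - a q x) <= ea j) &&
  (\E_x cn (tfshift chi (- p) (a p) x - tfshift chi (- q) (a q) x) <= ea j).
have [|p0 p0P hp0] := nested_pigeonhole (rel := rel) c0 P0.
  move=> j S1 sS1.
  have [_ /(_ _ _ _ (0 : G) S1 Y (fun p q => (q - p \in Z)%:R * ambig chi f q) (fun q => tfshift chi q f) a Y0')] := hca j.
  case.
  - by move=> p q; rewrite (cnM _%:R) mulr_ile1 ?cn_ge0 ?cn_bool_le1 ?(cn_ambig_le1 hchi hf).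
  - by move=> q; apply: (bounded1_tfshift hchi q hf).
  - by move=> p x; rewrite mulVKf // pnatr_eq0 -lt0n -(ltr0n R).
  move=> S2 [sS2 cS2] hS2.
  have [Z0|Z0] := eqVneq Z set0.
    have /set0Pn[p1] := P0; rewrite inE => /andP[_]; rewrite leNgt => /negP[].
    rewrite (_ : [set q in Y | q - p1 \in Z] = set0); first by rewrite cards0 mulr_gt0.
    by apply/setP => q; rewrite in_set Z0 !in_set0 andbF.
  have Z0' : exists y, y \in Z by apply/set0Pn.
  pose b p x := #|Y|%:R / #|Z|%:R * tfshift chi (- p) (a p) x.
  have [_ /(_ _ _ _ (0 : G) S2 Z (fun p r => (r + p \in Y)%:R * ambig chi f (r + p) * chi ((r + p).2 * p.1)) (fun q => tfshift chi q f) b Z0')] := hcb j.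
  case.
  - move=> p q; rewrite (cnM (_ * _)) (cnM _%:R) (cn_chi hchi) mulr1.
    by rewrite mulr_ile1 ?cn_ge0 ?cn_bool_le1 ?(cn_ambig_le1 hchi hf).
  - by move=> q; apply: (bounded1_tfshift hchi q hf).
  - move=> p x; rewrite /b (tfshiftN_avgV hchi) mulrA.
    have y0 : (#|Y|%:R : R[i]) != 0 by rewrite pnatr_eq0 -lt0n -(ltr0n R).
    have z0 : (#|Z|%:R : R[i]) != 0 by rewrite pnatr_eq0 cards_eq0.
    move: (\sum_(r in Z) _) => W.
    by field; rewrite y0 z0.
  move=> S3 [sS3 cS3] hS3; exists S3.
    split; first exact: subset_trans sS2.
    by apply: le_trans cS3; rewrite /c -mulrA mulrCA ler_wpM2l // ltW //; case: (hcb j).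
  move=> p q hp hq; rewrite /rel hS2 ?(subsetP sS3) //=.
  have := hS3 p q hp hq; rewrite /b.
  under eq_ex do rewrite -mulrBr cnM cnM cnV !cn_nat; rewrite exZ => h.
  have zp : 0 < #|Z|%:R :> R by rewrite ltr0n card_gt0.
  rewrite -(ler_pM2l (x := #|Y|%:R / #|Z|%:R)); last by rewrite divr_gt0.
  apply: le_trans h _; have -> : eb j = t * t' * ea j.
    rewrite /eb /ea /C !mul1r; move: (t * t') => u; move: (j.+1%:R) => v.
    by rewrite !invfM invrK; ring.
  rewrite ler_wpM2r ?(ltW (ea0 j)) // ler_pdivlMr //.
  by apply: le_trans Yge; rewrite -mulrA ler_pM2l.
have corr : c1 <= Re (\E_x f x * (a p0 x)^*).
  rewrite (inner_avgV hchi) ler_pdivlMl //.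
  apply: (@le_trans _ _ (t * (k * N))).
    by rewrite (_ : _ * c1 = t * (k * (t * #|Y|%:R))); [rewrite !ler_pM2l|rewrite /c1; ring].
  move: p0P; rewrite inE => /andP[_ h].
  apply: (@le_trans _ _ (t * #|[set q in Y | q - p0 \in Z]|%:R)); first by rewrite ler_pM2l.
  rewrite mulr_natr -sumr_const [leRHS](bigID (fun q => q - p0 \in Z)) /= ler_wpDr //.
    by apply: sumr_ge0 => q _; rewrite mulr_ge0 ?ambig2_ge0.
  rewrite [leLHS](eq_bigl (fun q => (q \in Y) && (q - p0 \in Z))); last by move=> q; rewrite in_set.
  by apply: ler_sum => q /andP[qY ->]; rewrite mul1r; move: qY; rewrite inE.
exists (a p0) => //; split.
- exact: (bounded1_avgV hchi hf).
- apply: le_trans corr _; apply: le_trans (le_trans (ler_norm _) (Re_le_cn _)) _.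
  apply: le_trans (cn_ex _) _; apply: ler_ex => x.
  by rewrite (cnM (f x)) cn_conj ler_piMl ?cn_ge0.
move=> e ee0.
pose j := Num.bound (1 / e).
have [S' [sS' p0S' cS'] hS'] := hp0 j.
pose E := [set - p.1 | p in S'].
pose xi d := if [pick p in S' | - p.1 == d] is Some p then - p.2 else 0.
exists E, xi, (tfshift chi (- p0) (a p0)); split.
  have SE : t * #|S'|%:R <= #|E|%:R.
    rewrite -[in leRHS]sum1_card natr_sum -sum1_card natr_sum mulr_sumr.
    rewrite (partition_big_imset (fun p => - p.1)) /=; apply: ler_sum => d _.
    rewrite -mulr_sumr -natr_sum sum1dep_card.
    apply: le_trans (card_lset_fiber hchi hf t (- d)); rewrite ler_pM2l // ler_nat.
    rewrite -(card_in_imset (f := snd)) /=; last first.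
      move=> [a1 b1] [a2 b2]; rewrite !inE /= => /andP[_ /eqP h1] /andP[_ /eqP h2] ->.
      by rewrite -[a1]opprK h1 -h2 opprK.
    apply: subset_leq_card; apply/subsetP => b' /imsetP[[a1 b1] h0 ->].
    have /andP[h1 /eqP h2] : ((a1, b1) \in S') && (- a1 == d) by move: h0; rewrite in_set.
    rewrite in_set -h2 opprK; have := subsetP sS' _ h1; by rewrite in_set => /andP[].
  apply: le_trans SE; rewrite -/N -(mulrA (_ * _) k N) -(mulrA t) ler_pM2l //.
  apply: le_trans cS'.
  by rewrite ler_pM2l //; apply: prodr_gt0.
move=> d /imsetP[p pS' ->].
rewrite /xi; case: pickP => [p' /andP[p'S' /eqP e']|/(_ p)]; last by rewrite pS' eqxx.
rewrite -e'.
have /andP[r1 r2] := hS' p' p'S'.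
have ea2 : ea j + ea j <= e.
  have hj : 1 / e < j.+1%:R.
    apply: (@lt_trans _ _ j%:R); last by rewrite ltr_nat.
    by apply: archi_boundP; rewrite divr_ge0 // ltW.
  rewrite /ea -mulrDl ler_pdivrMr ?mulr_gt0 ?ltr0n //.
  by rewrite ltr_pdivrMr // in hj; lra.
apply: le_trans ea2.
apply: (@le_trans _ _ (\E_x (cn (a p' (x - p'.1) - a p0 (x - p'.1)) +
   cn (tfshift chi (- p') (a p') x - tfshift chi (- p0) (a p0) x)))).
  apply: ler_ex => x.
  have -> : a p0 (x - p'.1) - chi (- p'.2 * x) * tfshift chi (- p0) (a p0) x =
     chi (- p'.2 * x) * (tfshift chi (- p') (a p0) x - tfshift chi (- p0) (a p0) x).
    rewrite mulrBr; congr (_ - _); rewrite /tfshift /= mulrA -(chiD hchi).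
    by rewrite subrr (chi0 hchi) mul1r.
  rewrite (cnM (chi _)) (cn_chi hchi) mul1r.
  have -> : cn (a p' (x - p'.1) - a p0 (x - p'.1)) = cn (tfshift chi (- p') (a p0) x - tfshift chi (- p') (a p') x).
    have -> : tfshift chi (- p') (a p0) x - tfshift chi (- p') (a p') x =
      chi (- ((- p').2 * x)) * (a p0 (x - p'.1) - a p' (x - p'.1)) by rewrite mulrBr.
    by rewrite (cnM (chi _)) (cn_chi hchi) mul1r cnB.
  by apply: le_trans (cnD _ _); rewrite addrA subrK.
rewrite exD; apply: lerD => //.
by rewrite (ex_shift (- p'.1) (fun x => cn (a p' x - a p0 x))).
Qed.
End InverseU3.

(** * Averages along differences *)
Section QuadraticFunctions.
Variables (R : realType) (G : finComNzRingType) (chi : G -> R[i]).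
Hypothesis hchi : charsys chi.
Variables (D : finType) (v : D -> G).
Hypothesis vinj : injective v.
Implicit Types (xi : D -> G) (f g P : G -> R[i]) (e s : R).

(* What remains of a quadratic phase after eliminating h by comparing the shifts by d1 and d2. *)
Definition quadf xi e g := bounded1 g /\ forall d1 d2,
  \E_x cn (g (x + (v d1 - v d2)) - chi ((xi d1 - xi d2) * (x - v d2)) * g x) <= e.

Lemma cn_chiM x z : cn (chi x * z) = cn z.
Proof. by rewrite (cnM (chi _)) (cn_chi hchi) mul1r. Qed.

Lemma cn_tri (a b c : R[i]) : cn (a - c) <= cn (a - b) + cn (b - c).
Proof. by rewrite (_ : a - c = (a - b) + (b - c)) ?cnD //; ring. Qed.

Lemma quadf_mul xi1 xi2 e1 e2 g1 g2 : quadf xi1 e1 g1 -> quadf xi2 e2 g2 ->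
  quadf (fun d => xi1 d + xi2 d) (e1 + e2) (fun x => g1 x * g2 x).
Proof.
move=> [b1 h1] [b2 h2]; split; first exact: bounded1M.
move=> d1 d2; apply: le_trans (lerD (h1 d1 d2) (h2 d1 d2)); rewrite -exD; apply: ler_ex => x.
set y := x + _; set c1 := chi ((xi1 d1 - _) * _); set c2 := chi ((xi2 d1 - _) * _).
have -> : chi ((xi1 d1 + xi2 d1 - (xi1 d2 + xi2 d2)) * (x - v d2)) = c1 * c2.
  by rewrite -(chiD hchi); congr chi; ring.
have -> : g1 y * g2 y - c1 * c2 * (g1 x * g2 x) =
  (g1 y - c1 * g1 x) * g2 y + (c1 * g1 x) * (g2 y - c2 * g2 x) by ring.
apply: le_trans (cnD _ _) _; apply: lerD.
  by rewrite (cnM (_ - _)) ler_piMr ?cn_ge0.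
by rewrite (cnM (c1 * _)) (cnM c1) (cn_chi hchi) mul1r ler_piMl ?cn_ge0.
Qed.

Lemma quadf_conj xi e g : quadf xi e g -> quadf (fun d => - xi d) e (fun x => (g x)^*).
Proof.
move=> [b h]; split; first by move=> x; rewrite cn_conj.
move=> d1 d2; apply: le_trans (h d1 d2); apply: ler_ex => x.
rewrite -[leLHS]cn_conj rmorphB /= conjCK (rmorphM _ (chi _)) /= conjCK (chi_conj hchi).
by rewrite (_ : - ((- xi d1 - - xi d2) * _) = (xi d1 - xi d2) * (x - v d2)) //; ring.
Qed.

Lemma quadf1 : quadf (fun=> 0) 0 (fun=> 1).
Proof.
split; first by move=> x; rewrite cn1.
move=> d1 d2; apply: (ex_le (0 : G)) => x.
by rewrite subrr mul0r (chi0 hchi) mulr1 subrr cn0.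
Qed.

(** The relation at x + d is composed with the one at x; moving the base point from x to x + d
    produces the term z * d. *)
Lemma quadf2 xi e g d1 d2 (d := v d1 - v d2) (z := xi d1 - xi d2) : quadf xi e g ->
  \E_x cn (g (x + d + d) - chi (z * (x - v d2) + z * (x - v d2) + z * d) * g x) <= e + e.
Proof.
move=> [b h]; have h1 := h d1 d2; rewrite -/d -/z in h1.
rewrite -{1}(ex_shift d) in h1.
apply: le_trans (lerD h1 (h d1 d2)); rewrite -exD -/d -/z; apply: ler_ex => x.
rewrite (_ : chi _ = chi (z * (x + d - v d2)) * chi (z * (x - v d2))); last first.
  by rewrite -(chiD hchi); congr chi; ring.
rewrite -[X in _ <= _ + X](cn_chiM (z * (x + d - v d2))).
apply: le_trans (cn_tri _ (chi (z * (x + d - v d2)) * g (x + d)) _) _.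
by rewrite -(mulrA (chi _)) -(mulrBr (chi _)) cn_chiM.
Qed.

Lemma quadf3 xi e g d1 d2 (d := v d1 - v d2) (z := xi d1 - xi d2) : quadf xi e g ->
  \E_x cn (g (x + d + d + d) -
    chi (z * (x - v d2) + z * (x - v d2) + z * (x - v d2) + z * d + z * d + z * d) * g x) <= e + e + e.
Proof.
move=> q; have [b h] := q; have h1 := h d1 d2; rewrite -/d -/z in h1.
rewrite -(ex_shift (d + d)) in h1.
apply: le_trans (lerD (quadf2 d1 d2 q) h1); rewrite -exD -/d -/z; apply: ler_ex => x.
rewrite [x + (d + d)]addrA (_ : chi _ = chi (z * (x + d + d - v d2)) * chi (z * (x - v d2) + z * (x - v d2) + z * d)); last first.
  by rewrite -(chiD hchi); congr chi; ring.
rewrite -[X in _ <= X + _](cn_chiM (z * (x + d + d - v d2))) [leRHS]addrC.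
apply: le_trans (cn_tri _ (chi (z * (x + d + d - v d2)) * g (x + d + d)) _) _.
by rewrite -(mulrA (chi _)) -(mulrBr (chi _)) cn_chiM.
Qed.

(** Each g_i (x + i d) is replaced by a character times g_i (x). Iterating i times gives the
    frequency i xi_i in x and, from the moved base points, i (i - 1) / 2 times xi_i in d; these are
    the coefficients in M1 and M2. The error is e + 2e + 3e. *)
Lemma lam4_quadf xi1 xi2 xi3 e g0 g1 g2 g3 d1 d2 (d := v d1 - v d2)
  (M1 := fun d => xi1 d + xi2 d + xi2 d + xi3 d + xi3 d + xi3 d)
  (M2 := fun d => xi2 d + xi3 d + xi3 d + xi3 d) :
  bounded1 g0 -> quadf xi1 e g1 -> quadf xi2 e g2 -> quadf xi3 e g3 ->
  cn (lam4 g0 g1 g2 g3 d - chi ((M2 d1 - M2 d2) * d - (M1 d1 - M1 d2) * v d2) *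
      fourier chi (fun x => g0 x * g1 x * g2 x * g3 x) (M1 d1 - M1 d2)) <= 6 * e.
Proof.
move=> b0 q1 q2 q3; have [b1 h1] := q1; have [b2 _] := q2; have [b3 _] := q3.
rewrite /lam4 /fourier -exZ -exB; apply: le_trans (cn_ex _) _.
have -> : 6 * e = e + (e + e) + (e + e + e) by ring.
apply: le_trans (lerD (lerD (h1 d1 d2) (quadf2 d1 d2 q2)) (quadf3 d1 d2 q3)).
rewrite -!exD -/d; apply: ler_ex => x.
set c1 := chi ((xi1 d1 - _) * _); set c2 := chi (_ + _ * d); set c3 := chi (_ + _ * d + _ + _).
have -> : chi ((M2 d1 - M2 d2) * d - (M1 d1 - M1 d2) * v d2) *
  (g0 x * g1 x * g2 x * g3 x * chi ((M1 d1 - M1 d2) * x)) =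
  c1 * c2 * c3 * (g0 x * g1 x * g2 x * g3 x).
  rewrite mulrCA [LHS]mulrC -(chiD hchi) -!(chiD hchi); congr (chi _ * _).
  by rewrite /M1 /M2; ring.
have u1 : cn c1 = 1 by apply: cn_chi. have u2 : cn c2 = 1 by apply: cn_chi.
move: (x + d) (x + d + d) (x + d + d + d) => y1 y2 y3.
have -> : g0 x * g1 y1 * g2 y2 * g3 y3 - c1 * c2 * c3 * (g0 x * g1 x * g2 x * g3 x) =
  (g0 x * (g2 y2 * g3 y3)) * (g1 y1 - c1 * g1 x) +
  (g0 x * (c1 * g1 x) * g3 y3) * (g2 y2 - c2 * g2 x) +
  (g0 x * (c1 * g1 x) * (c2 * g2 x)) * (g3 y3 - c3 * g3 x) by ring.
have m1 (a b : R[i]) : cn a <= 1 -> cn b <= 1 -> cn (a * b) <= 1.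
  by move=> ha hb; rewrite (cnM a) mulr_ile1 ?cn_ge0.
have bc1 : cn (c1 * g1 x) <= 1 by rewrite (cnM c1) u1 mul1r.
have bc2 : cn (c2 * g2 x) <= 1 by rewrite (cnM c2) u2 mul1r.
have c0 : cn (g0 x) <= 1 by apply: b0. have c1' : cn (g1 y1) <= 1 by apply: b1.
have c2' : cn (g2 y2) <= 1 by apply: b2. have c3' : cn (g3 y3) <= 1 by apply: b3.
have step (a b : R[i]) : cn a <= 1 -> cn (a * b) <= cn b.
  by move=> ha; rewrite (cnM a) ler_piMl ?cn_ge0.
apply: le_trans (cnD _ _) _; apply: lerD; last first.
  by apply: step; apply: (m1 _ _ (m1 _ _ c0 bc1) bc2).
apply: le_trans (cnD _ _) _; apply: lerD; apply: step.
  exact: (m1 _ _ c0 (m1 _ _ c2' c3')).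
exact: (m1 _ _ (m1 _ _ c0 bc1) c3').
Qed.

(** With this normalisation Parseval over G turns the bound on the fibres of xi into the bound s of
    [fourier_spread]. *)
Definition spread s xi := forall eta, #|G|%:R * #|[set d | xi d == eta]|%:R <= s ^+ 2 * #|D|%:R ^+ 2.

(* A quadratic phase comes from a symmetric bilinear form; symf is the approximate trace of this symmetry. *)
Definition symf e xi := forall d1 d2 d3 d4,
  cn (chi ((xi d1 - xi d2) * (v d3 - v d4)) - chi ((xi d3 - xi d4) * (v d1 - v d2))) <= e.

Lemma card_DG : #|D|%:R <= #|G|%:R :> R.
Proof. by rewrite ler_nat; apply: leq_card vinj. Qed.

Variable e0 : D.

Lemma cardD_gt0 : 0 < #|D|%:R :> R.
Proof. by rewrite ltr0n; apply/card_gt0P; exists e0. Qed.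

(** Cauchy-Schwarz in d, grouping by the value of xi, and Parseval. *)
Lemma fourier_spread s xi P t : 0 <= s -> bounded1 P -> spread s xi ->
  \E_d cn (fourier chi P (xi d - t)) <= s.
Proof.
move=> s0 bP hs; apply: sqr_le_abs => //; apply: le_trans (sqr_ex_le _) _.
have D0 := cardD_gt0; have G0 := cardG_gt0 R G.
rewrite exE ler_pdivrMl // -(ler_pM2l G0) (partition_big xi predT) //= mulr_sumr.
apply: (@le_trans _ _ (\sum_eta s ^+ 2 * #|D|%:R ^+ 2 * cn (fourier chi P (eta - t)) ^+ 2)).
  apply: ler_sum => eta _.
  rewrite (eq_bigr (fun=> cn (fourier chi P (eta - t)) ^+ 2)); last by move=> d /eqP ->.
  rewrite sumr_const -[X in #|G|%:R * X <= _]mulr_natl mulrA ler_wpM2r ?sqr_ge0 //.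
  by have := hs eta; rewrite cardsE.
rewrite -mulr_sumr (reindex_inj (addIr t)) /=.
under eq_bigr do rewrite addrK.
rewrite (parseval hchi).
have h1 : \E_x cn (P x) ^+ 2 <= 1 by apply: (ex_le (0 : G)) => x; rewrite expr_le1 ?cn_ge0.
apply: (@le_trans _ _ (s ^+ 2 * #|D|%:R ^+ 2)); first by rewrite ler_piMr // mulr_ge0 ?sqr_ge0.
have := card_DG; nra.
Qed.

(** Translating P by v d - v e0 turns its mean, up to e, into a Fourier coefficient at xi d - xi e0
    times a phase. The mean does not depend on d, so the average of these coefficients bounds it. *)
Lemma mean_spread s xi e P : 0 <= s -> quadf xi e P -> spread s xi -> cn (ex P) <= e + s.
Proof.
move=> s0 [bP h] hs.
have h1 d : cn (ex P) <= e + cn (fourier chi P (xi d - xi e0)).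
  have h2 : cn (ex P - chi (- ((xi d - xi e0) * v e0)) * fourier chi P (xi d - xi e0)) <= e.
    apply: le_trans (h d e0); rewrite -{1}(ex_shift (v d - v e0) P) /fourier -exZ -exB.
    apply: le_trans (cn_ex _) _; apply: ler_ex => x.
    rewrite (mulrC (P x)) mulrA -(chiD hchi) (_ : - _ + _ = (xi d - xi e0) * (x - v e0)) //.
    by ring.
  rewrite -[cn (fourier _ _ _)]mul1r -(cn_chi hchi (- ((xi d - xi e0) * v e0))) -cnM.
  apply: le_trans (lerD h2 (lexx _)); apply: le_trans (cnD _ _).
  by rewrite subrK.
apply: le_trans (_ : \E_d (e + cn (fourier chi P (xi d - xi e0))) <= _).
  by apply: (ex_ge e0).
by rewrite exD (ex_const e0) lerD2l; apply: fourier_spread.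
Qed.

(** By positivity the average over v d2 is at most |G| / |D| times the average over all of G, where
    orthogonality leaves the pairs with 2 (xi d1 - xi d2) = 0; as 2 is invertible, these are the
    pairs inside one fibre. *)
Lemma bilinear_spread s xi (u : D -> R[i]) t : 0 <= s -> (forall d, cn (u d) <= 1) -> spread s xi ->
  \E_d2 cn (\E_d1 u d1 * chi (- ((xi d1 - xi e0 + (xi d1 - xi e0)) * (v d2 - t)))) ^+ 2 <= s ^+ 2.
Proof.
move=> s0 u1 hs; have D0 := cardD_gt0; have G0 := cardG_gt0 R G.
pose H y := cn (\E_d1 u d1 * chi (- ((xi d1 - xi e0 + (xi d1 - xi e0)) * (y - t)))) ^+ 2.
have H0 y : 0 <= H y by rewrite sqr_ge0.
have h1 : #|D|%:R * (\E_d H (v d)) <= #|G|%:R * ex H.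
  rewrite -(sum_ex e0) -(sum_ex (0 : G)).
  rewrite -(big_imset H (h := v) (A := D)) /=; last by move=> a b _ _ /vinj.
  by rewrite [leRHS](bigID (mem (v @: D))) /= ler_wpDr // sumr_ge0.
rewrite -(ler_pM2l D0); apply: (le_trans h1).
have -> : ex H = \E_y cn (\E_d1 u d1 * chi (- ((xi d1 - xi e0 + (xi d1 - xi e0)) * y))) ^+ 2.
  by rewrite -[RHS](ex_shift (- t)).
have h2 : \E_y cn (\E_d1 u d1 * chi (- ((xi d1 - xi e0 + (xi d1 - xi e0)) * y))) ^+ 2 <=
   \E_d1 \E_d2 (xi d1 == xi d2)%:R.
  set L := ex _.
  have -> : L = cn (\E_d1 \E_d2 u d1 * (u d2)^* * (xi d1 == xi d2)%:R).
    rewrite -[LHS]ger0_norm; last by apply: ex_ge0 => y; rewrite sqr_ge0.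
    rewrite -cnR; congr cn; rewrite /L ex_real.
    under eq_ex => y.
      rewrite sqr_cn ex_conj -exZr.
      under eq_ex do rewrite -exZ.
      over.
    rewrite ex_exchange; apply: eq_ex => d1; rewrite ex_exchange; apply: eq_ex => d2.
    rewrite (_ : (xi d1 == xi d2) = (xi d2 - xi d1 + (xi d2 - xi d1) == 0)); last first.
      rewrite -[0 in RHS]addr0 (inj_eq (dbl_inj hchi)).
      by rewrite subr_eq0 eq_sym.
    rewrite -(chi_orth hchi) -exZ; apply: eq_ex => y.
    rewrite (rmorphM _ (u d2)) /= (chi_conj hchi) opprK mulrACA -(chiD hchi); congr (_ * chi _).
    by ring.
  apply: le_trans (cn_ex _) _; apply: ler_ex => d1; apply: le_trans (cn_ex _) _; apply: ler_ex => d2.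
  rewrite !cnM cn_conj cn_nat ler_piMl // mulr_ile1 ?cn_ge0 //.
apply: le_trans (_ : #|G|%:R * (\E_d1 \E_d2 (xi d1 == xi d2)%:R) <= _); first by rewrite ler_pM2l.
rewrite mulrC -exZr; apply: (ex_le e0) => d1; rewrite exE -natr_sum.
rewrite -mulrA ler_pdivrMl // mulrC.
have := hs (xi d1); rewrite -sum1_card big_mkcond /=.
rewrite (eq_bigr (fun d => (xi d1 == xi d) : nat)); last by move=> d _; rewrite inE eq_sym; case: eqP.
by move=> h; apply: le_trans h _; rewrite (_ : #|D|%:R * _ = s ^+ 2 * #|D|%:R ^+ 2) //; ring.
Qed.

(** Expanding the product gives two mixed terms, which [symf] makes nearly equal. What is left is a
    function of d1, a function of d2 and a bilinear phase with coefficient 2, to which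
    [bilinear_spread] applies. *)
Lemma quadphase_spread s sg xi : 0 <= s -> symf sg xi -> spread s xi ->
  cn (\E_d1 \E_d2 chi ((xi d1 - xi d2) * (v d1 - v d2))) <= sg + s.
Proof.
move=> s0 hsym hs.
pose M d := xi d - xi e0; pose w d := v d - v e0.
pose A d1 d2 := chi (M d1 * w d1) * chi (M d2 * w d2) * chi (- ((M d1 + M d1) * w d2)).
have h1 : cn (\E_d1 \E_d2 chi ((xi d1 - xi d2) * (v d1 - v d2)) - \E_d1 \E_d2 A d1 d2) <= sg.
  rewrite -exB; apply: le_trans (cn_ex _) _; apply: (ex_le e0) => d1.
  rewrite -exB; apply: le_trans (cn_ex _) _; apply: (ex_le e0) => d2.
  have e1 : chi ((xi d1 - xi d2) * (v d1 - v d2)) =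
      chi (M d1 * w d1) * chi (M d2 * w d2) * chi (- (M d1 * w d2)) * chi (- (M d2 * w d1)).
    by rewrite -!(chiD hchi); congr chi; rewrite /M /w; ring.
  have e2 : chi (- ((M d1 + M d1) * w d2)) = chi (- (M d1 * w d2)) * chi (- (M d1 * w d2)).
    by rewrite -!(chiD hchi); congr chi; ring.
  rewrite e1 /A e2 [X in _ - X]mulrA -mulrBr -(chiD hchi) -(chiD hchi) cn_chiM.
  rewrite !(chiN hchi) -rmorphB /= cn_conj; exact: hsym.
rewrite -[X in cn X](subrK (\E_d1 \E_d2 A d1 d2)); apply: le_trans (cnD _ _) _; apply: lerD => //.
rewrite ex_exchange; apply: sqr_le_abs => //.
apply: le_trans (bilinear_spread (u := fun d => chi (M d * w d)) (v e0) s0 _ hs); last first.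
  by move=> d; rewrite (cn_chi hchi).
apply: le_trans (sqr_cn_ex _) _; apply: ler_ex => d2.
rewrite (eq_ex (g := fun d1 => chi (M d2 * w d2) * (chi (M d1 * w d1) * chi (- ((M d1 + M d1) * w d2))))).
  by rewrite exZ cnM (cn_chi hchi) mul1r.
by move=> d1; rewrite /A; ring.
Qed.

(** This lemma, [term_M2] and [term_main] treat the three possibilities for four phases. A spread M1
    makes the Fourier coefficient small for most d1; if M1 is constant and M2 is spread, the
    quadratic phase in d cancels; if both are constant, all phases disappear. *)
Lemma term_M1 s xi1 xi2 xi3 e g0 g1 g2 g3
  (M1 := fun d => xi1 d + xi2 d + xi2 d + xi3 d + xi3 d + xi3 d) : 0 <= s ->
  bounded1 g0 -> quadf xi1 e g1 -> quadf xi2 e g2 -> quadf xi3 e g3 -> spread s M1 ->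
  cn (\E_d1 \E_d2 lam4 g0 g1 g2 g3 (v d1 - v d2)) <= 6 * e + s.
Proof.
move=> s0 b0 q1 q2 q3 hs.
pose P x := g0 x * g1 x * g2 x * g3 x.
have [b1 _] := q1; have [b2 _] := q2; have [b3 _] := q3.
have bP : bounded1 P by rewrite /P; do 3![apply: bounded1M => //].
rewrite ex_exchange; apply: le_trans (cn_ex _) _; apply: (ex_le e0) => d2.
apply: le_trans (cn_ex _) _.
apply: le_trans (_ : \E_d1 (6 * e + cn (fourier chi P (M1 d1 - M1 d2))) <= _); last first.
  by rewrite exD (ex_const e0) lerD2l; apply: fourier_spread.
apply: ler_ex => d1; have h := lam4_quadf d1 d2 b0 q1 q2 q3.
rewrite -[X in cn X](subrK (chi ((xi2 d1 + xi3 d1 + xi3 d1 + xi3 d1 -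
     (xi2 d2 + xi3 d2 + xi3 d2 + xi3 d2)) * (v d1 - v d2) - (M1 d1 - M1 d2) * v d2) *
     fourier chi P (M1 d1 - M1 d2))).
apply: le_trans (cnD _ _) _; apply: lerD; first exact: h.
by rewrite cnM (cn_chi hchi) mul1r.
Qed.

Lemma term_M2 s sg xi1 xi2 xi3 e g0 g1 g2 g3
  (M1 := fun d => xi1 d + xi2 d + xi2 d + xi3 d + xi3 d + xi3 d)
  (M2 := fun d => xi2 d + xi3 d + xi3 d + xi3 d) : 0 <= s ->
  bounded1 g0 -> quadf xi1 e g1 -> quadf xi2 e g2 -> quadf xi3 e g3 ->
  (forall d1 d2, M1 d1 = M1 d2) -> symf sg M2 -> spread s M2 ->
  cn (\E_d1 \E_d2 lam4 g0 g1 g2 g3 (v d1 - v d2)) <= 6 * e + (sg + s).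
Proof.
move=> s0 b0 q1 q2 q3 hM1 hsym hs.
pose P x := g0 x * g1 x * g2 x * g3 x.
have [b1 _] := q1; have [b2 _] := q2; have [b3 _] := q3.
have bP : bounded1 P by rewrite /P; do 3![apply: bounded1M => //].
rewrite -[X in cn X](subrK (\E_d1 \E_d2 chi ((M2 d1 - M2 d2) * (v d1 - v d2)) * ex P)).
apply: le_trans (cnD _ _) _; apply: lerD.
  rewrite -exB; apply: le_trans (cn_ex _) _; apply: (ex_le e0) => d1.
  rewrite -exB; apply: le_trans (cn_ex _) _; apply: (ex_le e0) => d2.
  have := lam4_quadf d1 d2 b0 q1 q2 q3.
  rewrite -/(M1 d1) -/(M1 d2) (hM1 d1 d2) subrr mul0r subr0 /fourier.
  by under [ex (fun x => _ * chi _)]eq_ex do rewrite mul0r (chi0 hchi) mulr1.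
under eq_ex do rewrite exZr.
by rewrite exZr cnM; apply: le_trans (quadphase_spread s0 hsym hs); rewrite ler_piMr ?cn_ge0 ?cn_ex_le1.
Qed.

Lemma term_main xi1 xi2 xi3 e g0 g1 g2 g3
  (M1 := fun d => xi1 d + xi2 d + xi2 d + xi3 d + xi3 d + xi3 d)
  (M2 := fun d => xi2 d + xi3 d + xi3 d + xi3 d) :
  bounded1 g0 -> quadf xi1 e g1 -> quadf xi2 e g2 -> quadf xi3 e g3 ->
  (forall d1 d2, M1 d1 = M1 d2) -> (forall d1 d2, M2 d1 = M2 d2) ->
  cn (\E_d1 \E_d2 lam4 g0 g1 g2 g3 (v d1 - v d2) - \E_x g0 x * g1 x * g2 x * g3 x) <= 6 * e.
Proof.
move=> b0 q1 q2 q3 hM1 hM2.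
set Q := (X in _ - X); rewrite -[Q](ex_const e0) -exB.
apply: le_trans (cn_ex _) _; apply: (ex_le e0) => d1.
rewrite -[Q](ex_const e0) -exB; apply: le_trans (cn_ex _) _; apply: (ex_le e0) => d2.
have := lam4_quadf d1 d2 b0 q1 q2 q3.
rewrite -/(M1 d1) -/(M1 d2) (hM1 d1 d2) -/(M2 d1) -/(M2 d2) (hM2 d1 d2).
rewrite !subrr !mul0r subr0 (chi0 hchi) mul1r /fourier /Q.
by under [ex (fun x => _ * chi _)]eq_ex do rewrite mul0r (chi0 hchi) mulr1.
Qed.
End QuadraticFunctions.

(** * Sets on which all frequencies are constant or spread *)

Section Refinement.
Variable R : realType.

Definition constin (G : finType) (T : eqType) (phi : G -> T) (E : {set G}) :=
  [forall x in E, forall y in E, phi x == phi y].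

Lemma constinP (G : finType) (T : eqType) (phi : G -> T) (E : {set G}) :
  reflect {in E &, forall x y, phi x = phi y} (constin phi E).
Proof.
apply: (iffP forall_inP) => [h x y hx hy|h x hx].
  by have /forall_inP/(_ y hy)/eqP := h x hx.
by apply/forall_inP => y hy; apply/eqP; apply: h.
Qed.

Definition spreadin (G : finType) (T : eqType) (s : R) (phi : G -> T) (E : {set G}) :=
  forall eta, #|G|%:R * #|[set x in E | phi x == eta]|%:R <= s ^+ 2 * #|E|%:R ^+ 2.

(** As long as some Phi j is neither constant nor spread, one of its fibres has density at least s^2
    e^2. Passing to this fibre makes Phi j constant and keeps constant maps constant, so at most r
    passages are needed. *)
Lemma refine (s : R) (r : nat) (e : R) : 0 < s -> 0 < e -> exists2 c : R, 0 < c &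
  forall (G J : finType) (T : eqType) (Phi : J -> G -> T) (E : {set G}), E != set0 ->
  e * #|G|%:R <= #|E|%:R -> (#|[set j | ~~ constin (Phi j) E]| <= r)%N ->
  exists2 E' : {set G}, [/\ E' \subset E, E' != set0 & c * #|G|%:R <= #|E'|%:R] &
    forall j, constin (Phi j) E' \/ spreadin s (Phi j) E'.
Proof.
move=> s0; elim: r e => [|r IH] e e0.
  exists e => // G J T Phi E En0 hE hr; exists E => // j; left.
  by move: hr; rewrite leqn0 cards_eq0 => /eqP/setP/(_ j); rewrite !inE => /negbFE.
have e1 : 0 < s ^+ 2 * e ^+ 2 by rewrite mulr_gt0 ?exprn_gt0.
have [c c0 hc] := IH _ e1; exists (Num.min e c); first by rewrite lt_min e0.
move=> G J T Phi E En0 hE hr.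
have G0 : 0 < #|G|%:R :> R.
  by case/set0Pn: En0 => x _; rewrite ltr0n; apply/card_gt0P; exists x.
have [all|no] := boolp.EM (forall j, constin (Phi j) E \/ spreadin s (Phi j) E).
  exists E => //; split => //; apply: le_trans hE.
  by rewrite ler_wpM2r // ge_min lexx.
have [j hj] : exists j, ~ (constin (Phi j) E \/ spreadin s (Phi j) E) by apply/boolp.existsNP.
have [eta heta] : exists eta, ~ (#|G|%:R * #|[set x in E | Phi j x == eta]|%:R <= s ^+ 2 * #|E|%:R ^+ 2).
  by apply/boolp.existsNP => h; apply: hj; right.
move/negP: heta; rewrite -ltNge => heta.
have nc : ~~ constin (Phi j) E by apply/negP => h; apply: hj; left.
pose E1 := [set x in E | Phi j x == eta].
have sE1 : E1 \subset E by apply/subsetP => x; rewrite inE => /andP[].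
have E0 : 0 < #|E|%:R :> R by rewrite ltr0n card_gt0.
have E1n0 : E1 != set0.
  rewrite -card_gt0 -(ltr0n R) -(pmulr_rgt0 _ G0); apply: lt_trans heta.
  by rewrite mulr_gt0 ?exprn_gt0.
have hE1 : s ^+ 2 * e ^+ 2 * #|G|%:R <= #|E1|%:R.
  rewrite -(ler_pM2l G0); apply: le_trans (ltW heta).
  rewrite [leLHS](_ : _ = s ^+ 2 * (e * #|G|%:R) ^+ 2); last by ring.
  by rewrite ler_pM2l ?exprn_gt0 // ler_pXn2r ?nnegrE ?mulr_ge0 // ltW.
have [|E' [h1 h2 h3] h4] := hc G J T Phi E1 E1n0 hE1.
  rewrite -ltnS; apply: leq_trans hr; apply: proper_card; apply/properP; split.
    apply/subsetP => i; rewrite !inE; apply: contra => /constinP h; apply/constinP => x y hx hy.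
    by apply: h; apply: (subsetP sE1).
  exists j; rewrite inE ?nc //; rewrite negbK; apply/constinP => x y.
  by rewrite !inE => /andP[_ /eqP->] /andP[_ /eqP->].
exists E' => //; split => //; first exact: subset_trans h1 sE1.
by apply: le_trans h3; rewrite ler_wpM2r // ge_min lexx orbT.
Qed.
End Refinement.

Section CommonSet.
Variable R : realType.

Lemma shift_inter (G : finZmodType) (E E1 : {set G}) :
  exists y, #|E|%:R * #|E1|%:R <= #|G|%:R * #|[set d in E | d + y \in E1]|%:R :> R.
Proof.
have [||y _ hy] := @exists_ge_avg R G predT (fun y => #|G|%:R * #|[set d in E | d + y \in E1]|%:R) (#|E|%:R * #|E1|%:R).
- by exists 0.
- rewrite sumr_const -mulr_sumr -[leLHS]mulr_natl (eq_card (B := G)) // ler_wpM2l //.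
  rewrite -natrM -natr_sum ler_nat -sum_nat_const.
  under [leqRHS]eq_bigr do rewrite -sum1dep_card.
  under [leqRHS]eq_bigr do rewrite big_mkcondr.
  rewrite [leqRHS]exchange_big /=; apply: leq_sum => d _.
  rewrite -big_mkcond /= sum1dep_card -[leqRHS](card_imset _ (@addrI _ d)).
  apply: subset_leq_card; apply/subsetP => x hx; apply/imsetP; exists (x - d).
    by rewrite inE addrC subrK.
  by rewrite addrC subrK.
by exists y.
Qed.

Definition phased (G : finComNzRingType) (chi : G -> R[i]) e g (E : {set G}) (xi : G -> G) h :=
  {in E, forall d, \E_x cn (g (x + d) - chi (xi d * x) * h x) <= e}.

(** Sets that belong to different phases need not meet, so the new set is translated by some y
    before intersecting. The translation multiplies its factor h by a scalar that depends on d; the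
    pigeonhole principle restricts to those d for which this scalar is nearly constant. *)
Lemma common_phased (K : nat) (prof : R -> R) (e : R) : (forall e, 0 < e -> 0 < prof e) ->
  0 < e -> exists2 c : R, 0 < c &
  forall (G : finComNzRingType) (chi : G -> R[i]), charsys chi ->
  forall nu (g : nat -> G -> R[i]), (forall j, (j < K)%N -> qphase chi prof nu (g j)) ->
  exists (E : {set G}) (xi : nat -> G -> G) (h : nat -> G -> R[i]),
    c * #|G|%:R <= #|E|%:R /\ forall j, (j < K)%N -> phased chi e (g j) E (xi j) (h j).
Proof.
move=> prof0 e0; pose e1 := Num.min e 1 / 4.
have e10 : 0 < e1 by rewrite divr_gt0 // lt_min e0 ltr01.
have e14 : 4 * e1 <= e by have : Num.min e 1 <= e; [rewrite ge_min lexx|rewrite /e1; lra].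
have e11 : 4 * e1 <= 1 by have : Num.min e 1 <= 1; [rewrite ge_min lexx orbT|rewrite /e1; lra].
have [cp cp0 hcp] := pigeonhole_cplx e10.
elim: K => [|K [c c0 IH]].
  exists 1 => // G chi hchi nu g _; exists [set: G], (fun _ _ => 0), (fun _ _ => 0).
  by rewrite mul1r cardsT.
have p0 := prof0 _ e10.
exists (cp * (c * prof e1)); first by rewrite !mulr_gt0.
move=> G chi hchi nu g hg.
have [E [xi [h [cE hE]]]] := IH G chi hchi nu g (fun j hj => hg j (ltnW hj)).
have [bg _ /(_ _ e10)[E1 [xi1 [h1 [cE1 hE1]]]]] := hg K (ltnSn K).
have [y hy] := shift_inter E E1.
have G0 := cardG_gt0 R G.
pose E2 := [set d in E | d + y \in E1].
pose lam d : R[i] := chi (- (xi1 (d + y) * y)).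
have lam1 d : cn (lam d) <= 1 by rewrite (cn_chi hchi).
have [E3 [sE3 cE3] hE3] := hcp G E2 lam lam1.
have cE2 : c * prof e1 * #|G|%:R <= #|E2|%:R.
  rewrite -(ler_pM2l G0); apply: le_trans hy.
  rewrite [leLHS](_ : _ = (c * #|G|%:R) * (prof e1 * #|G|%:R)); last by ring.
  by apply: ler_pM => //; rewrite mulr_ge0 // ltW.
have cE3' : cp * (c * prof e1) * #|G|%:R <= #|E3|%:R.
  by apply: le_trans cE3; rewrite -mulrA ler_pM2l.
have E3n0 : E3 != set0.
  by rewrite -card_gt0 -(ltr0n R); apply: lt_le_trans cE3'; rewrite !mulr_gt0.
have /set0Pn[d0 hd0] := E3n0.
have s32 d : d \in E3 -> d \in E /\ d + y \in E1.
  by move=> /(subsetP sE3); rewrite inE => /andP[].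
exists E3, (fun j d => if j == K then xi1 (d + y) else xi j d),
  (fun j x => if j == K then lam d0 * h1 (x - y) else h j x); split=> // j.
rewrite ltnS leq_eqVlt => /orP[/eqP->|jK]; last first.
  by rewrite (ltn_eqF jK) => d /s32[dE _]; apply: hE.
rewrite eqxx => d hd; have [dE dE1] := s32 d hd; have [_ d0E1] := s32 d0 hd0.
have hh : \E_x cn (h1 x) <= 2.
  apply: (@le_trans _ _ (\E_x (cn (g K (x + (d0 + y)) - chi (xi1 (d0 + y) * x) * h1 x) + 1))).
    apply: ler_ex => x; rewrite -(cn_chiM hchi (xi1 (d0 + y) * x)) cnB.
    have := cn_tri (chi (xi1 (d0 + y) * x) * h1 x) (g K (x + (d0 + y))) 0; rewrite !subr0.
    by move=> h2; apply: le_trans h2 _; rewrite lerD2l.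
  by rewrite exD (ex_const (0 : G)); have := hE1 _ d0E1; lra.
have := hE1 _ dE1; rewrite -(ex_shift (- y)) => hd1.
apply: (@le_trans _ _ (e1 + e1 * 2)); last by lra.
apply: le_trans (lerD hd1 (ler_wpM2l (ltW e10) hh)).
rewrite -(ex_shift (- y) (fun x => cn (h1 x))) -exZ -exD; apply: ler_ex => x.
have -> : x - y + (d + y) = x + d by ring.
apply: le_trans (cn_tri _ (chi (xi1 (d + y) * (x - y)) * h1 (x - y)) _) _; rewrite lerD2l.
have -> : chi (xi1 (d + y) * (x - y)) = chi (xi1 (d + y) * x) * lam d.
  by rewrite -(chiD hchi); congr chi; ring.
rewrite [X in cn X](_ : _ = chi (xi1 (d + y) * x) * ((lam d - lam d0) * h1 (x - y))); last by ring.
rewrite (cn_chiM hchi) (cnM (lam d - lam d0)) ler_wpM2r ?cn_ge0 //.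
exact: hE3.
Qed.
End CommonSet.

Section PhasedQuadf.
Variables (R : realType) (G : finComNzRingType) (chi : G -> R[i]).
Hypothesis hchi : charsys chi.

Definition sub_of (E : {set G}) := {x : G | x \in E}.

Lemma phased_quadf (E : {set G}) e (g : G -> R[i]) xi h : bounded1 g -> phased chi e g E xi h ->
  quadf chi (fun d : sub_of E => val d) (fun d => xi (val d)) (e + e) g.
Proof.
move=> b hp; split => // -[d1 hd1] [d2 hd2] /=.
have h1 := hp _ hd1; have h2 := hp _ hd2.
rewrite -(ex_shift (- d2)) in h1; rewrite -(ex_shift (- d2)) in h2.
apply: le_trans (lerD h1 h2); rewrite -exD; apply: ler_ex => x.
rewrite subrK (_ : x - d2 + d1 = x + (d1 - d2)); last by ring.
apply: le_trans (cn_tri _ (chi (xi d1 * (x - d2)) * h (x - d2)) _) _; rewrite lerD2l.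
have -> : chi (xi d1 * (x - d2)) = chi ((xi d1 - xi d2) * (x - d2)) * chi (xi d2 * (x - d2)).
  by rewrite -(chiD hchi); congr chi; ring.
by rewrite -mulrA -(mulrBr (chi _)) (cn_chiM hchi) cnB.
Qed.

(** Translating g by v d1 - v d2 and by v d3 - v d4 in either order gives the same function, and the
    two phases so obtained differ exactly by the two characters compared in [symf]. The lower bound
    nu for E|g| allows g to be divided out. *)
Lemma quadf_symf (D : finType) (v : D -> G) xi e nu (g : G -> R[i]) : 0 < nu ->
  nu <= \E_x cn (g x) -> quadf chi v xi e g -> symf chi v (4 * e / nu) xi.
Proof.
move=> nu0 hnu [b h] d1 d2 d3 d4; rewrite ler_pdivlMr //.
pose a := v d1 - v d2; pose z := xi d1 - xi d2; pose a' := v d3 - v d4; pose z' := xi d3 - xi d4.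
have two (c1 c2 c3 c4 : D) (t := v c1 - v c2) (w := xi c1 - xi c2) (t' := v c3 - v c4) (w' := xi c3 - xi c4) :
  \E_x cn (g (x + t' + t) - chi (w * (x - v c2) + w' * (x - v c4)) * chi (w * t') * g x) <= e + e.
  have h1 := h c1 c2; rewrite -(ex_shift t') in h1.
  apply: le_trans (lerD h1 (h c3 c4)); rewrite -exD; apply: ler_ex => x; rewrite -/t -/t' -/w -/w'.
  apply: le_trans (cn_tri _ (chi (w * (x + t' - v c2)) * g (x + t')) _) _; rewrite lerD2l.
  rewrite (_ : chi _ * chi _ = chi (w * (x + t' - v c2)) * chi (w' * (x - v c4))).
    by rewrite -(mulrA (chi _)) -(mulrBr (chi _)) (cn_chiM hchi).
  by rewrite -!(chiD hchi); congr chi; ring.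
have h1 := two d1 d2 d3 d4; have h2 := two d3 d4 d1 d2.
rewrite -/a -/z -/a' -/z' in h1 h2 *.
apply: (@le_trans _ _ (\E_x cn (chi (z * a') - chi (z' * a)) * cn (g x))).
  by rewrite exZ ler_wpM2l ?cn_ge0.
rewrite (_ : 4 * e = (e + e) + (e + e)); last by ring.
apply: le_trans (lerD h1 h2); rewrite -exD; apply: ler_ex => x.
rewrite -cnM -(cn_chiM hchi (z * (x - v d2) + z' * (x - v d4))).
rewrite [X in _ <= X + _]cnB; apply: le_trans (_ : _ <= cn (_ + _)) (cnD _ _).
rewrite le_eqVlt; apply/orP; left; apply/eqP; congr cn.
rewrite [z' * (x - v d4) + _]addrC (_ : x + a + a' = x + a' + a); last by ring.
move: (chi _) (chi (z * a')) (chi (z' * a)) (g x) (g _) => u1 u2 u3 u4 u5; ring.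
Qed.
End PhasedQuadf.

(** * Polynomials in quadratic phases *)
Section FormalPoly.
Variable R : realType.

(* The letter (j, b) stands for the j-th phase, conjugated when b holds. *)
Definition word := seq (nat * bool).
Definition fpoly := seq (R[i] * word).

Definition flipw (w : word) : word := [seq (l.1, ~~ l.2) | l <- w].
Definition conjp (p : fpoly) : fpoly := [seq (t.1^*, flipw t.2) | t <- p].
Definition inletters K (w : word) := all (fun l => l.1 < K)%N w.
Definition l1norm (p : fpoly) : R := \sum_(t <- p) cn t.1.

Section Eval.
Variables (G : finComNzRingType) (g : nat -> G -> R[i]).
Definition evl (l : nat * bool) x : R[i] := if l.2 then (g l.1 x)^* else g l.1 x.
Definition evw (w : word) x : R[i] := \prod_(l <- w) evl l x.
Definition evp (p : fpoly) x : R[i] := \sum_(t <- p) t.1 * evw t.2 x.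

Lemma evw_flip w x : evw (flipw w) x = (evw w x)^*.
Proof.
rewrite /evw big_map rmorph_prod; apply: eq_bigr => -[j b] _; rewrite /evl /=.
by case: b; rewrite /= ?conjCK.
Qed.
Lemma evp_conj p x : evp (conjp p) x = (evp p x)^*.
Proof.
rewrite /evp big_map rmorph_sum; apply: eq_bigr => t _ /=.
by rewrite evw_flip (rmorphM _ t.1).
Qed.
Lemma evw_cat w1 w2 x : evw (w1 ++ w2) x = evw w1 x * evw w2 x.
Proof. by rewrite /evw big_cat. Qed.
End Eval.

Lemma l1norm_ge0 p : 0 <= l1norm p.
Proof. by apply: sumr_ge0 => t _; apply: cn_ge0. Qed.
Lemma l1norm_conj p : l1norm (conjp p) = l1norm p.
Proof. by rewrite /l1norm big_map; apply: eq_bigr => t _; rewrite cn_conj. Qed.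

Definition sum4 (p0 p1 p2 p3 : fpoly) (f : word -> word -> word -> word -> R[i]) :=
  \sum_(t0 <- p0) \sum_(t1 <- p1) \sum_(t2 <- p2) \sum_(t3 <- p3)
    t0.1 * t1.1 * t2.1 * t3.1 * f t0.2 t1.2 t2.2 t3.2.

Lemma cn_sum_seq (I : eqType) (r : seq I) (c : I -> R[i]) (f : I -> R[i]) (b : R) : 0 <= b ->
  {in r, forall i, cn (f i) <= cn (c i) * b} -> cn (\sum_(i <- r) f i) <= (\sum_(i <- r) cn (c i)) * b.
Proof.
move=> b0 h; apply: le_trans (cn_sum _ _ _) _; rewrite mulr_suml !big_seq.
by apply: ler_sum => i ir; apply: h.
Qed.

Definition pwords (p : fpoly) := [seq t.2 | t <- p].

Lemma sum4_err p0 p1 p2 p3 f f' d : 0 <= d ->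
  (forall w0 w1 w2 w3, w0 \in pwords p0 -> w1 \in pwords p1 -> w2 \in pwords p2 -> w3 \in pwords p3 ->
     cn (f w0 w1 w2 w3 - f' w0 w1 w2 w3) <= d) ->
  cn (sum4 p0 p1 p2 p3 f - sum4 p0 p1 p2 p3 f') <= l1norm p0 * (l1norm p1 * (l1norm p2 * (l1norm p3 * d))).
Proof.
move=> d0 h.
have n3 : 0 <= l1norm p3 * d by rewrite mulr_ge0 ?l1norm_ge0.
have n2 : 0 <= l1norm p2 * (l1norm p3 * d) by rewrite mulr_ge0 ?l1norm_ge0.
have n1 : 0 <= l1norm p1 * (l1norm p2 * (l1norm p3 * d)) by rewrite mulr_ge0 ?l1norm_ge0.
have -> : sum4 p0 p1 p2 p3 f - sum4 p0 p1 p2 p3 f' = \sum_(t0 <- p0) t0.1 * (\sum_(t1 <- p1) t1.1 *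
   (\sum_(t2 <- p2) t2.1 * (\sum_(t3 <- p3) t3.1 * (f t0.2 t1.2 t2.2 t3.2 - f' t0.2 t1.2 t2.2 t3.2)))).
  rewrite /sum4 -sumrB; apply: eq_bigr => t0 _; rewrite -sumrB mulr_sumr; apply: eq_bigr => t1 _.
  rewrite -sumrB mulrA mulr_sumr; apply: eq_bigr => t2 _; rewrite -sumrB mulrA mulr_sumr.
  by apply: eq_bigr => t3 _; ring.
apply: cn_sum_seq => // t0 h0; rewrite (cnM t0.1) ler_wpM2l ?cn_ge0 //.
apply: cn_sum_seq => // t1 h1; rewrite (cnM t1.1) ler_wpM2l ?cn_ge0 //.
apply: cn_sum_seq => // t2 h2; rewrite (cnM t2.1) ler_wpM2l ?cn_ge0 //.
apply: cn_sum_seq => // t3 h3; rewrite (cnM t3.1) ler_wpM2l ?cn_ge0 //.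
by apply: h; apply: map_f.
Qed.

Lemma prod4_sum (G : finComNzRingType) (g : nat -> G -> R[i]) p0 p1 p2 p3 x0 x1 x2 x3 :
  evp g p0 x0 * evp g p1 x1 * evp g p2 x2 * evp g p3 x3 =
  sum4 p0 p1 p2 p3 (fun w0 w1 w2 w3 => evw g w0 x0 * evw g w1 x1 * evw g w2 x2 * evw g w3 x3).
Proof.
rewrite /evp /sum4 -!mulrA mulr_suml; apply: eq_bigr => t0 _.
rewrite mulr_suml mulr_sumr; apply: eq_bigr => t1 _.
rewrite mulr_suml !mulr_sumr; apply: eq_bigr => t2 _.
rewrite !mulr_sumr; apply: eq_bigr => t3 _; ring.
Qed.

Lemma ex_sum4 (T : finType) p0 p1 p2 p3 (f : T -> word -> word -> word -> word -> R[i]) :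
  \E_x sum4 p0 p1 p2 p3 (f x) = sum4 p0 p1 p2 p3 (fun w0 w1 w2 w3 => \E_x f x w0 w1 w2 w3).
Proof.
rewrite /sum4 ex_sum; apply: eq_bigr => t0 _; rewrite ex_sum; apply: eq_bigr => t1 _.
rewrite ex_sum; apply: eq_bigr => t2 _; rewrite ex_sum; apply: eq_bigr => t3 _.
by rewrite exZ.
Qed.

Lemma lam4_evp (G : finComNzRingType) (g : nat -> G -> R[i]) p0 p1 p2 p3 d :
  lam4 (evp g p0) (evp g p1) (evp g p2) (evp g p3) d =
  sum4 p0 p1 p2 p3 (fun w0 w1 w2 w3 => lam4 (evw g w0) (evw g w1) (evw g w2) (evw g w3) d).
Proof. by rewrite /lam4 -ex_sum4; apply: eq_ex => x; rewrite prod4_sum. Qed.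
End FormalPoly.

(** The frequencies of words from p, its conjugate, p and its conjugate are k, -a, b, -c. The first
    two equations say that M1 and M2 are constant, the third that the product of the words has
    frequency 0. The solution (k, -3k, 3k, -k) produces the squares |F_k|^2 |F_3k|^2. *)
Lemma lin_system (V : zmodType) (k a b c : V) :
  [&& (- a + b *+ 2 + (- c) *+ 3 == 0), (b + (- c) *+ 3 == 0) & (k - a + b - c == 0)] =
  [&& a == k *+ 3, b == k *+ 3 & c == k].
Proof.
rewrite mulNrn; set x := c *+ 3; apply/and3P/and3P => -[/eqP h1 /eqP h2 /eqP h3].
  have bx : b = x by apply/eqP; rewrite -subr_eq0 h2.
  have ax : a = x.
    move/eqP: h1; rewrite bx mulr2n addrA addrK addrC subr_eq0 => /eqP ->.
    by [].
  have kc : k = c by apply/eqP; move/eqP: h3; rewrite ax bx subrK subr_eq0.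
  by rewrite ax bx kc !eqxx.
have cx : x = k *+ 3 by rewrite /x h3.
by rewrite h1 h2 h3 cx mulr2n addrA addNr add0r !subrr subrK subrr.
Qed.

Section WordPhases.
Variables (R : realType) (G : finComNzRingType) (chi : G -> R[i]).
Hypothesis hchi : charsys chi.
Variables (D : finType) (v : D -> G).
Hypothesis vinj : injective v.
Variable e0 : D.
Variables (K : nat) (g : nat -> G -> R[i]) (xi : nat -> D -> G) (e sg : R).
Hypothesis e_ge0 : 0 <= e.
Hypothesis sg_ge0 : 0 <= sg.
Hypothesis hq : forall j, (j < K)%N -> quadf chi v (xi j) e (g j).
Hypothesis hs : forall j, (j < K)%N -> symf chi v sg (xi j).

Definition xiw (w : word) (d : D) : G := \sum_(l <- w) (if l.2 then - xi l.1 d else xi l.1 d).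

Lemma xiw_cat w1 w2 d : xiw (w1 ++ w2) d = xiw w1 d + xiw w2 d.
Proof. by rewrite /xiw big_cat. Qed.
Lemma xiw_nil d : xiw [::] d = 0.
Proof. by rewrite /xiw big_nil. Qed.
Lemma xiw_flip w d : xiw (flipw w) d = - xiw w d.
Proof.
rewrite /xiw big_map -sumrN; apply: eq_bigr => -[j b] _ /=; by case: b; rewrite /= ?opprK.
Qed.

(** The frequency of a word up to constants: [kap w = 0] means that [xiw w] is constant. A finite
    function, so that sums over all classes make sense. *)
Definition kap w : {ffun D -> G} := [ffun d => xiw w d - xiw w e0].

Lemma kap_cat w1 w2 : kap (w1 ++ w2) = kap w1 + kap w2.
Proof. by apply/ffunP => d; rewrite !ffunE !xiw_cat; ring. Qed.
Lemma kap_flip w : kap (flipw w) = - kap w.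
Proof. by apply/ffunP => d; rewrite !ffunE !xiw_flip; ring. Qed.
Lemma kap_nil : kap [::] = 0.
Proof. by apply/ffunP => d; rewrite !ffunE /xiw !big_nil subrr. Qed.
Lemma kap0 w d1 d2 : kap w = 0 -> xiw w d1 = xiw w d2.
Proof.
move=> h; have := congr1 (fun f : {ffun D -> G} => f d1) h; have := congr1 (fun f : {ffun D -> G} => f d2) h.
by rewrite !ffunE => /eqP; rewrite subr_eq0 => /eqP -> /eqP; rewrite subr_eq0 => /eqP.
Qed.

Lemma quadf_le x1 x2 a f : x1 <= x2 -> quadf chi v a x1 f -> quadf chi v a x2 f.
Proof. by move=> h [b hh]; split => // d1 d2; apply: le_trans h. Qed.

Lemma quadf_word w : inletters K w -> quadf chi v (xiw w) ((size w)%:R * e) (evw g w).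
Proof.
elim: w => [|l w IH] /=.
  move=> _; have -> : xiw [::] = fun=> 0 by apply: boolp.funext => d; rewrite /xiw big_nil.
  have -> : evw g [::] = fun=> 1 by apply: boolp.funext => x; rewrite /evw big_nil.
  by rewrite mul0r; apply: quadf1.
move=> /andP[hl hw].
have -> : xiw (l :: w) = fun d => (if l.2 then - xi l.1 d else xi l.1 d) + xiw w d.
  by apply: boolp.funext => d; rewrite /xiw big_cons.
have -> : evw g (l :: w) = fun x => evl g l x * evw g w x.
  by apply: boolp.funext => x; rewrite /evw big_cons.
rewrite -natr1 mulrDl mul1r addrC; apply: (quadf_mul hchi); last exact: IH.
by rewrite /evl; case: l hl => j [] /= hj; [apply: (quadf_conj hchi)|]; apply: hq.
Qed.

Lemma symf_word w : inletters K w -> symf chi v ((size w)%:R * sg) (xiw w).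
Proof.
elim: w => [|l w IH] /=.
  by move=> _ d1 d2 d3 d4; rewrite /xiw !big_nil !subrr !mul0r subrr cn0.
move=> /andP[hl hw] d1 d2 d3 d4.
pose a d := if l.2 then - xi l.1 d else xi l.1 d.
have ea d : xiw (l :: w) d = a d + xiw w d by rewrite /xiw big_cons.
have ha : cn (chi ((a d1 - a d2) * (v d3 - v d4)) - chi ((a d3 - a d4) * (v d1 - v d2))) <= sg.
  rewrite /a; case: l.2; last exact: hs.
  rewrite -cn_conj rmorphB /= !(chi_conj hchi).
  rewrite (_ : - ((- xi l.1 d1 - - xi l.1 d2) * _) = (xi l.1 d1 - xi l.1 d2) * (v d3 - v d4)); last by ring.
  rewrite (_ : - ((- xi l.1 d3 - - xi l.1 d4) * _) = (xi l.1 d3 - xi l.1 d4) * (v d1 - v d2)); last by ring.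
  exact: hs.
have hb := IH hw d1 d2 d3 d4.
rewrite [leRHS](_ : _ = sg + (size w)%:R * sg); last by rewrite -natr1 mulrDl mul1r addrC.
apply: le_trans (lerD ha hb).
rewrite !ea.
rewrite (_ : chi ((a d1 + xiw w d1 - _) * _) = chi ((a d1 - a d2) * (v d3 - v d4)) * chi ((xiw w d1 - xiw w d2) * (v d3 - v d4))); last first.
  by rewrite -(chiD hchi); congr chi; ring.
rewrite (_ : chi ((a d3 + xiw w d3 - _) * _) = chi ((a d3 - a d4) * (v d1 - v d2)) * chi ((xiw w d3 - xiw w d4) * (v d1 - v d2))); last first.
  by rewrite -(chiD hchi); congr chi; ring.
set u1 := chi ((a d1 - _) * _); set u2 := chi ((xiw w d1 - _) * _).
set u3 := chi ((a d3 - _) * _); set u4 := chi ((xiw w d3 - _) * _).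
rewrite (_ : u1 * u2 - u3 * u4 = (u1 - u3) * u2 + u3 * (u2 - u4)); last by ring.
apply: le_trans (cnD _ _) _; apply: lerD.
  by rewrite (cnM (u1 - u3)) (cn_chi hchi) mulr1.
by rewrite (cn_chiM hchi).
Qed.

Variables (n : nat) (s dl : R).
Hypothesis s_ge0 : 0 <= s.
Hypothesis hdl : 6 * (n%:R * e) + (4 * n%:R * sg + s) <= dl.
Variable L : seq word.
Hypothesis hL : forall w, w \in L -> inletters K w /\ (size w <= n)%N.
Hypothesis nilL : [::] \in L.
(** Six words suffice: M1 is w1 + 2 w2 + 3 w3, and shorter combinations are padded with the empty
    word. *)
Hypothesis dich : forall w1 w2 w3 w4 w5 w6, w1 \in L -> w2 \in L -> w3 \in L -> w4 \in L -> w5 \in L -> w6 \in L ->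
  let w := w1 ++ w2 ++ w3 ++ w4 ++ w5 ++ w6 in
  (forall d1 d2, xiw w d1 = xiw w d2) \/ spread s (xiw w).

Lemma const_kap w : (forall d1 d2, xiw w d1 = xiw w d2) -> kap w = 0.
Proof. by move=> h; apply/ffunP => d; rewrite !ffunE (h d e0) subrr. Qed.

Lemma quadf_wordL w : w \in L -> quadf chi v (xiw w) (n%:R * e) (evw g w).
Proof.
move=> /hL[h1 h2]; apply: quadf_le (quadf_word h1).
by rewrite ler_wpM2r // ler_nat.
Qed.

Lemma term_words w0 w1 w2 w3 : w0 \in L -> w1 \in L -> w2 \in L -> w3 \in L ->
  cn (\E_d1 \E_d2 lam4 (evw g w0) (evw g w1) (evw g w2) (evw g w3) (v d1 - v d2) -
      ((kap w1 + kap w2 *+ 2 + kap w3 *+ 3 == 0) && (kap w2 + kap w3 *+ 3 == 0))%:R *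
      \E_x evw g w0 x * evw g w1 x * evw g w2 x * evw g w3 x) <= dl.
Proof.
move=> h0 h1 h2 h3.
have q1 := quadf_wordL h1; have q2 := quadf_wordL h2; have q3 := quadf_wordL h3.
have [b0 _] := quadf_wordL h0.
pose M1 := w1 ++ w2 ++ w2 ++ w3 ++ w3 ++ w3.
pose M2 := w2 ++ w3 ++ w3 ++ w3 ++ [::] ++ [::].
have e1 : (fun d => xiw w1 d + xiw w2 d + xiw w2 d + xiw w3 d + xiw w3 d + xiw w3 d) = xiw M1.
  by apply: boolp.funext => d; rewrite /M1 !xiw_cat; ring.
have e2 : (fun d => xiw w2 d + xiw w3 d + xiw w3 d + xiw w3 d) = xiw M2.
  by apply: boolp.funext => d; rewrite /M2 !xiw_cat /xiw big_nil; ring.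
have k1 : kap w1 + kap w2 *+ 2 + kap w3 *+ 3 = kap M1 by rewrite /M1 !kap_cat !mulrS mulr0n !addr0 !addrA.
have k2 : kap w2 + kap w3 *+ 3 = kap M2 by rewrite /M2 !kap_cat kap_nil !mulrS mulr0n !addr0 !addrA.
have ne : 0 <= n%:R * e by rewrite mulr_ge0.
have ns : 0 <= n%:R * sg by rewrite mulr_ge0.
have ns4 : 0 <= 4 * n%:R * sg by rewrite -mulrA mulr_ge0.
rewrite k1 k2.
have dl0 : 0 <= dl by apply: le_trans hdl; rewrite addr_ge0 ?addr_ge0 ?mulr_ge0.
have [z1|nz1] := eqVneq (kap M1) 0; last first.
  rewrite /= mul0r subr0.
  have [/const_kap c1|s1] := dich h1 h2 h2 h3 h3 h3; first by rewrite c1 eqxx in nz1.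
  have t1 := term_M1 hchi vinj e0 s_ge0 b0 q1 q2 q3; rewrite e1 in t1.
  by apply: le_trans (t1 s1) _; apply: le_trans hdl; rewrite lerD2l lerDr.
have c1 d1 d2 : xiw w1 d1 + xiw w2 d1 + xiw w2 d1 + xiw w3 d1 + xiw w3 d1 + xiw w3 d1 =
    xiw w1 d2 + xiw w2 d2 + xiw w2 d2 + xiw w3 d2 + xiw w3 d2 + xiw w3 d2.
  by have := kap0 d1 d2 z1; rewrite /M1 !xiw_cat !addrA.
have [z2|nz2] := eqVneq (kap M2) 0; last first.
  rewrite /= mul0r subr0.
  have [/const_kap c2|s2] := dich h2 h3 h3 h3 nilL nilL; first by rewrite c2 eqxx in nz2.
  have sy : symf chi v (4 * n%:R * sg) (xiw M2).
    have [l2 sz2] := hL h2; have [l3 sz3] := hL h3.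
    have lM : inletters K M2 by rewrite /inletters /M2 !all_cat /= -!/(inletters _ _) l2 l3.
    move=> d1 d2 d3 d4; apply: le_trans (symf_word lM d1 d2 d3 d4) _.
    rewrite ler_wpM2r // -natrM ler_nat /M2 !size_cat /= !addn0.
    by rewrite !mulSn mul0n addn0; do !apply: leq_add.
  have t2 := term_M2 hchi vinj e0 s_ge0 b0 q1 q2 q3 c1; rewrite e2 in t2.
  exact: le_trans (t2 _ sy s2) hdl.
have c2 d1 d2 : xiw w2 d1 + xiw w3 d1 + xiw w3 d1 + xiw w3 d1 =
    xiw w2 d2 + xiw w3 d2 + xiw w3 d2 + xiw w3 d2.
  by have := kap0 d1 d2 z2; rewrite /M2 !xiw_cat !xiw_nil !addr0 !addrA.
rewrite /= mul1r; apply: le_trans (term_main hchi e0 b0 q1 q2 q3 c1 c2) _.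
by apply: le_trans hdl; rewrite lerDl addr_ge0.
Qed.

(** A word of nonzero class is spread by [dich], and [mean_spread] makes its mean small. *)
Lemma mean_words w1 w2 w3 w4 (w := w1 ++ w2 ++ w3 ++ w4) :
  w1 \in L -> w2 \in L -> w3 \in L -> w4 \in L ->
  cn (ex (evw g w) - (kap w == 0)%:R * ex (evw g w)) <= dl.
Proof.
move=> h1 h2 h3 h4.
have ne : 0 <= n%:R * e by rewrite mulr_ge0.
have ns : 0 <= n%:R * sg by rewrite mulr_ge0.
have ns4 : 0 <= 4 * n%:R * sg by rewrite -mulrA mulr_ge0.
have dl0 : 0 <= dl by apply: le_trans hdl; rewrite addr_ge0 ?addr_ge0 ?mulr_ge0.
have [z|nz] := eqVneq (kap w) 0; first by rewrite mul1r subrr cn0.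
rewrite mul0r subr0; have := dich h1 h2 h3 h4 nilL nilL; rewrite /= cats0 => -[/const_kap c|sp].
  by rewrite c eqxx in nz.
have [l1 s1] := hL h1; have [l2 s2] := hL h2; have [l3 s3] := hL h3; have [l4 s4] := hL h4.
have lw : inletters K w by rewrite /inletters /w !all_cat -!/(inletters _ _) l1 l2 l3 l4.
have := mean_spread hchi vinj e0 s_ge0 (quadf_word lw) sp.
move=> h; apply: le_trans h _; apply: le_trans hdl.
have : (size w)%:R * e <= (4 * n)%:R * e.
  rewrite ler_wpM2r // ler_nat /w !size_cat !mulSn mul0n addn0.
  by do !apply: leq_add.
rewrite natrM -mulrA => hsz; apply: lerD; last by rewrite lerDr.
by apply: le_trans hsz _; rewrite ler_wpM2r // ler_nat.
Qed.

Lemma dl_ge0 : 0 <= dl.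
Proof. by apply: le_trans hdl; rewrite addr_ge0 ?addr_ge0 ?mulr_ge0. Qed.

Variable p : fpoly R.
Hypothesis pL : forall w, w \in pwords p -> w \in L /\ flipw w \in L.

Definition onep : fpoly R := [:: (1, [::])].
(* The part of p whose words have frequency k. Up to a small error the progression counts depend only on these parts,
   and classp 0 has the mean of p. *)
Definition classp k x : R[i] := \sum_(t <- p) (kap t.2 == k)%:R * (t.1 * evw g t.2 x).

Lemma pwords_conj w : w \in pwords (conjp p) -> exists2 u, u \in pwords p & w = flipw u.
Proof.
rewrite /pwords /conjp -map_comp => /mapP[t ht ->]; exists t.2 => //; exact: map_f.
Qed.
Lemma pL1 w : w \in pwords p -> w \in L. Proof. by case/pL. Qed.
Lemma pL2 w : w \in pwords (conjp p) -> w \in L.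
Proof. by move=> /pwords_conj[u /pL[_ h] ->]. Qed.
Lemma pL3 w : w \in pwords onep -> w \in L.
Proof. by rewrite inE => /eqP ->. Qed.
Lemma evp_one x : evp g onep x = 1.
Proof. by rewrite /evp big_seq1 /evw big_nil mulr1. Qed.
Lemma l1norm_one : l1norm onep = 1.
Proof. by rewrite /l1norm big_seq1 cn1. Qed.

Lemma sum_class (H : {ffun D -> G} -> R[i]) x :
  \sum_(t <- p) t.1 * evw g t.2 x * H (kap t.2) = \sum_k classp k x * H k.
Proof.
rewrite /classp; under [RHS]eq_bigr do rewrite mulr_suml.
rewrite exchange_big /=; apply: eq_bigr => t _.
rewrite (bigD1 (kap t.2)) //= eqxx mul1r big1 ?addr0 // => k nk.
by rewrite eq_sym (negPf nk) !mul0r.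
Qed.

Lemma mean_classp : cn (ex (evp g p) - ex (classp 0)) <= l1norm p * dl.
Proof.
have -> : ex (evp g p) - ex (classp 0) =
    \sum_(t <- p) t.1 * (ex (evw g t.2) - (kap t.2 == 0)%:R * ex (evw g t.2)).
  rewrite /evp /classp !ex_sum -sumrB; apply: eq_bigr => t _.
  by rewrite !exZ; ring.
apply: cn_sum_seq; first exact: dl_ge0.
move=> t ht; rewrite (cnM t.1) ler_wpM2l ?cn_ge0 //.
have := mean_words (pL1 (map_f snd ht)) nilL nilL nilL.
by rewrite !cats0.
Qed.

(** Words of class 0 are nearly orthogonal to words of other classes, because the conjugate of one
    times the other is a word of nonzero class. For k = 3 this ties the mean of |F_0|^2 to F. *)
Lemma corr_classp : cn (\E_x (evp g p x)^* * classp 0 x - \E_x (classp 0 x)^* * classp 0 x) <=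
  l1norm p * (l1norm p * dl).
Proof.
pose a u w : R[i] := \E_x (evw g u x)^* * evw g w x.
have -> : \E_x (evp g p x)^* * classp 0 x - \E_x (classp 0 x)^* * classp 0 x =
    \sum_(s <- p) s.1^* * \sum_(t <- p) t.1 * ((kap t.2 == 0)%:R * (a s.2 t.2 - (kap s.2 == 0)%:R * a s.2 t.2)).
  rewrite -exB (eq_ex (g := fun x => \sum_(s <- p) \sum_(t <- p) s.1^* * t.1 * (kap t.2 == 0)%:R *
     (1 - (kap s.2 == 0)%:R) * ((evw g s.2 x)^* * evw g t.2 x))); last first.
    move=> x; rewrite -mulrBl /evp /classp -rmorphB -sumrB rmorph_sum mulr_suml; apply: eq_bigr => s' _.
    rewrite mulr_sumr; apply: eq_bigr => t _.
    rewrite -{1}[s'.1 * _]mul1r -mulrBl (rmorphM _ (1 - _)) (rmorphM _ s'.1) rmorphB /= rmorph1 rmorph_nat.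
    by ring.
  rewrite ex_sum; apply: eq_bigr => s' _; rewrite ex_sum mulr_sumr; apply: eq_bigr => t _.
  by rewrite exZ -/(a _ _); ring.
have d0 := dl_ge0.
have -> : l1norm p = \sum_(t <- p) cn t.1^* by apply: eq_bigr => t _; rewrite cn_conj.
apply: cn_sum_seq; first by rewrite mulr_ge0 // sumr_ge0 // => t _; apply: cn_ge0.
move=> s' hs'; rewrite (cnM _^*) ler_wpM2l ?cn_ge0 //.
under [X in _ <= X * _]eq_bigr do rewrite cn_conj.
apply: cn_sum_seq => // t ht; rewrite (cnM t.1) ler_wpM2l ?cn_ge0 //.
case: eqP => [k0|_]; last by rewrite mul0r cn0.
have := mean_words (proj2 (pL (map_f snd hs'))) (pL1 (map_f snd ht)) nilL nilL.
rewrite !cats0 kap_cat k0 addr0 kap_flip oppr_eq0 mul1r.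
congr (cn (_ - _ * _) <= _).
  by rewrite /a; apply: eq_ex => x; rewrite evw_cat evw_flip.
by rewrite /a; apply: eq_ex => x; rewrite evw_cat evw_flip.
Qed.

Definition avg4 (p0 p1 p2 p3 : fpoly R) :=
  \E_d1 \E_d2 lam4 (evp g p0) (evp g p1) (evp g p2) (evp g p3) (v d1 - v d2).

Lemma avg4_sum p0 p1 p2 p3 : avg4 p0 p1 p2 p3 = sum4 p0 p1 p2 p3 (fun w0 w1 w2 w3 =>
  \E_d1 \E_d2 lam4 (evw g w0) (evw g w1) (evw g w2) (evw g w3) (v d1 - v d2)).
Proof.
rewrite /avg4 -ex_sum4; apply: eq_ex => d1; rewrite -ex_sum4; apply: eq_ex => d2.
by rewrite lam4_evp.
Qed.

(** By [term_words] only the quadruples solving the first two equations of [lin_system] survive.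
    [mean_words] allows the third equation to be added at the cost of a second dl, and the solutions
    are then indexed by the class k of the first word. *)
Lemma count4_main :
  cn (avg4 p (conjp p) p (conjp p) -
      (\E_x \sum_k cn (classp k x) ^+ 2 * cn (classp (k *+ 3) x) ^+ 2)%:C) <=
  l1norm p * (l1norm p * (l1norm p * (l1norm p * (dl + dl)))).
Proof.
have d0 := dl_ge0.
pose b w0 w1 w2 w3 : bool := [&& (kap w1 + kap w2 *+ 2 + kap w3 *+ 3 == 0), (kap w2 + kap w3 *+ 3 == 0)
  & (kap w0 + kap w1 + kap w2 + kap w3 == 0)].
pose f w0 w1 w2 w3 := (b w0 w1 w2 w3)%:R * \E_x evw g w0 x * evw g w1 x * evw g w2 x * evw g w3 x.
have -> : (\E_x \sum_k cn (classp k x) ^+ 2 * cn (classp (k *+ 3) x) ^+ 2)%:C = sum4 p (conjp p) p (conjp p) f.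
  rewrite ex_real /f.
  transitivity (\E_x sum4 p (conjp p) p (conjp p) (fun w0 w1 w2 w3 =>
     (b w0 w1 w2 w3)%:R * (evw g w0 x * evw g w1 x * evw g w2 x * evw g w3 x))); last first.
    rewrite ex_sum4; congr (sum4 _ _ _ _ _).
    by do 4!(apply: boolp.funext => ?); rewrite exZ.
  apply: eq_ex => x; rewrite rmorph_sum /=.
  pose H k := (classp (k *+ 3) x)^* * classp (k *+ 3) x * (classp k x)^*.
  rewrite (eq_bigr (fun k => classp k x * H k)); last first.
    by move=> k _; rewrite rmorphM /= !sqr_cn /H; ring.
  rewrite -(sum_class H); apply: eq_bigr => t0 _.
  rewrite /H /classp !rmorph_sum big_map !mulr_suml mulr_sumr; apply: eq_bigr => t1 _.
  rewrite -!mulrA mulr_suml !mulr_sumr /=; apply: eq_bigr => t2 _.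
  rewrite big_map !mulr_sumr; apply: eq_bigr => t3 _ /=.
  rewrite /b !kap_flip lin_system !evw_flip.
  rewrite !(rmorphM _ (_ == _)%:R) !(rmorphM _ t1.1) !(rmorphM _ t3.1) /= !rmorph_nat.
  by case: eqP => _; case: eqP => _; case: eqP => _ /=; ring.
rewrite avg4_sum -(l1norm_conj p) {1 3}l1norm_conj.
rewrite {1}(_ : l1norm (conjp p) = l1norm p) ?l1norm_conj //.
have -> : l1norm p * (l1norm p * (l1norm p * (l1norm p * (dl + dl)))) =
  l1norm p * (l1norm (conjp p) * (l1norm p * (l1norm (conjp p) * (dl + dl)))) by rewrite l1norm_conj.
apply: sum4_err; first by rewrite addr_ge0.
move=> w0 w1 w2 w3 /pL1 h0 /pL2 h1 /pL1 h2 /pL2 h3.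
apply: le_trans (cn_tri _ _ _) (lerD (term_words h0 h1 h2 h3) _).
have := mean_words h0 h1 h2 h3.
have -> : ex (evw g (w0 ++ w1 ++ w2 ++ w3)) = \E_x evw g w0 x * evw g w1 x * evw g w2 x * evw g w3 x.
  by apply: eq_ex => x; rewrite !evw_cat !mulrA.
rewrite /f /b andbA !kap_cat !addrA; case: (_ && _) => /=; first by rewrite mul1r.
by rewrite !mul0r subrr cn0.
Qed.

(** The fourth word is empty, so the equations reduce to kap w2 = 0 and kap w1 = 0, and the first
    factor stays whole. *)
Lemma count3_main :
  cn (avg4 p (conjp p) p onep - \E_x evp g p x * ((classp 0 x)^* * classp 0 x)) <=
  l1norm p * (l1norm p * (l1norm p * dl)).
Proof.
have d0 := dl_ge0.
pose f w0 w1 w2 w3 := ((kap w1 + kap w2 *+ 2 + kap w3 *+ 3 == 0) && (kap w2 + kap w3 *+ 3 == 0))%:R *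
   \E_x evw g w0 x * evw g w1 x * evw g w2 x * evw g w3 x.
have -> : \E_x evp g p x * ((classp 0 x)^* * classp 0 x) = sum4 p (conjp p) p onep f.
  rewrite /f.
  transitivity (\E_x sum4 p (conjp p) p onep (fun w0 w1 w2 w3 =>
     ((kap w1 + kap w2 *+ 2 + kap w3 *+ 3 == 0) && (kap w2 + kap w3 *+ 3 == 0))%:R *
     (evw g w0 x * evw g w1 x * evw g w2 x * evw g w3 x))); last first.
    rewrite ex_sum4; congr (sum4 _ _ _ _ _).
    by do 4!(apply: boolp.funext => ?); rewrite exZ.
  apply: eq_ex => x; rewrite /evp mulr_suml; apply: eq_bigr => t0 _.
  rewrite /classp rmorph_sum big_map mulr_suml mulr_sumr; apply: eq_bigr => t1 _.
  rewrite !mulr_sumr; apply: eq_bigr => t2 _ /=.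
  rewrite big_seq1 /= kap_nil mul0rn !addr0 kap_flip evw_flip.
  have -> : (- kap t1.2 + kap t2.2 *+ 2 == 0) && (kap t2.2 == 0) = (kap t1.2 == 0) && (kap t2.2 == 0).
    by case: (eqVneq (kap t2.2) 0) => [->|]; rewrite ?andbF // mul0rn addr0 oppr_eq0.
  rewrite !(rmorphM _ (_ == _)%:R) !(rmorphM _ t1.1) /= !rmorph_nat /evw big_nil.
  by case: eqP => _; case: eqP => _ /=; ring.
rewrite avg4_sum.
have -> : l1norm p * (l1norm p * (l1norm p * dl)) =
  l1norm p * (l1norm (conjp p) * (l1norm p * (l1norm onep * dl))) by rewrite l1norm_conj l1norm_one mul1r.
apply: sum4_err => // w0 w1 w2 w3 /pL1 h0 /pL2 h1 /pL1 h2 /pL3 h3.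
exact: term_words.
Qed.
End WordPhases.

(** * Progression counts of polynomials in phases *)

Section Counting.
Variable R : realType.

(** Progressions of fewer than four terms are padded with the constant 1, so that one four-point
    form serves every k. *)
Definition slot (G : finComNzRingType) (F : G -> R) (k i : nat) : G -> R[i] :=
  fun x => if (i < k)%N then (F x)%:C else 1.

Definition apcorr (G : finComNzRingType) (F : G -> R) k d : R[i] :=
  lam4 (slot F k 0) (slot F k 1) (slot F k 2) (slot F k 3) d.

Definition apavg (G : finComNzRingType) (D : finType) (v : D -> G) (F : G -> R) k : R :=
  Re (\E_d1 \E_d2 apcorr F k (v d1 - v d2)).

Section Basic.
Variables (G : finComNzRingType) (D : finType) (v : D -> G) (e0 : D) (F : G -> R).

Lemma apavg1 : apavg v F 1 = ex F.
Proof.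
rewrite /apavg -[RHS]/(Re (ex F)%:C); congr Re; rewrite -[RHS](ex_const e0); apply: eq_ex => d1.
rewrite -[RHS](ex_const e0); apply: eq_ex => d2; rewrite /apcorr /lam4 ex_real; apply: eq_ex => x.
by rewrite /slot /= !mulr1.
Qed.

Lemma apavg2 : ex F ^+ 2 <= apavg v F 2.
Proof.
have -> : apavg v F 2 = \E_x (\E_d F (x + v d)) ^+ 2.
  rewrite /apavg -[RHS]/(Re (ex _)%:C); congr Re.
  rewrite ex_real.
  under [RHS]eq_ex => x.
    rewrite expr2 -exZr ex_real.
    under eq_ex do rewrite -exZ ex_real.
    over.
  rewrite [RHS]ex_exchange; apply: eq_ex => d1; rewrite [RHS]ex_exchange; apply: eq_ex => d2.
  rewrite /apcorr /lam4 -[LHS](ex_shift (v d2)); apply: eq_ex => x.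
  rewrite /slot /= !mulr1 -rmorphM /= mulrC (_ : x + v d2 + (v d1 - v d2) = x + v d1) //.
  by ring.
have -> : ex F = \E_x \E_d F (x + v d).
  rewrite ex_exchange -[LHS](ex_const e0); apply: eq_ex => d; by rewrite ex_shift.
exact: sqr_ex_le.
Qed.
End Basic.

Lemma pow4_sub (a t u : R) : 0 <= a <= 1 -> 0 <= t -> 0 <= u -> a - t <= u -> a ^+ 4 - 4 * t <= u ^+ 4.
Proof.
move=> /andP[a0 a1] t0 u0 h.
have [ta|ta] := leP a t.
  have : a ^+ 4 <= a by rewrite exprS ler_piMr // exprn_ile1.
  have := exprn_ge0 4 u0; lra.
have h1 : (a - t) ^+ 2 <= u ^+ 2 by nra.
have h2 : a ^+ 2 - 2 * t <= u ^+ 2 by nra.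
have b0 := sqr_ge0 u; have b1 := sqr_ge0 a; have b2 : a ^+ 2 <= 1 by nra.
rewrite (_ : 4 = 2 * 2)%N // !exprM; move: h2 b0 b1 b2; move: (u ^+ 2) (a ^+ 2) => y x h2 y0 x0 x1.
have [|/ltW] := leP x (2 * t); nra.
Qed.

(** Used with a = E F, u = |E F_0|, q = E |F_0|^2, z the correlation of F with F_0, and X = E F
    |F_0|^2. The chain gives a^4 - 6t <= z^2 <= a X; dividing by a is harmless, because a <= d
    leaves nothing to prove. *)
Lemma pow3_sub (a t u q z X d : R) : 0 <= a <= 1 -> 0 < d -> 0 <= t -> 0 <= u -> 0 <= X -> 0 <= z ->
  a - t <= u -> u ^+ 2 <= q -> q - t <= z -> z ^+ 2 <= a * X -> 6 * t <= d * d -> a ^+ 3 - d <= X.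
Proof.
move=> /andP[a0 a1] d0 t0 u0 X0 z0 h1 h2 h3 h4 h5.
have [ad|ad] := leP a d.
  have : a ^+ 3 <= a by rewrite exprS ler_piMr // exprn_ile1.
  lra.
have a0' : 0 < a by apply: lt_trans ad.
have k1 : a ^+ 2 - 2 * t <= u ^+ 2.
  have [|] := leP a t => h; last by nra.
  have := sqr_ge0 u; nra.
have k2 : a ^+ 2 - 3 * t <= z by lra.
have k3 : a ^+ 4 - 6 * t <= z ^+ 2.
  have b1 := sqr_ge0 a; have b2 : a ^+ 2 <= 1 by nra.
  rewrite (_ : 4 = 2 * 2)%N // exprM; move: k2 b1 b2; move: (a ^+ 2) => x k2 x0 x1.
  have [|/ltW] := leP x (3 * t) => h; last by nra.
  have := sqr_ge0 z; nra.
have k4 : a ^+ 4 - d * a <= a * X by nra.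
have k5 : a * (a ^+ 3 - d) <= a * X by nra.
by rewrite ler_pM2l in k5.
Qed.

Lemma spread_sub (G : finComNzRingType) (s : R) (phi : G -> G) (E : {set G}) :
  spreadin s phi E -> spread s (fun d : sub_of E => phi (val d)).
Proof.
move=> h eta; have := h eta; congr (_ <= _).
  congr (_ * _%:R); rewrite -(card_imset (f := val) [set d : sub_of E | phi (val d) == eta]); last exact: val_inj.
  congr #|pred_of_set _|; apply/setP => x; rewrite inE; apply/andP/imsetP.
    by move=> [xE hx]; exists (exist _ x xE) => //; rewrite inE.
  by move=> [[y yE]]; rewrite inE /= => hy ->.
by congr (_ * _%:R ^+ 2); rewrite card_sig.
Qed.

Lemma Re_ge_cn (a b : R[i]) (c : R) : cn (a - b) <= c -> Re b - c <= Re a.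
Proof.
move=> h; have := le_trans (Re_le_cn _) h; rewrite ler_norml => /andP[h1 _].
have -> : Re a = Re (a - b) + Re b by case: (a) (b) => [? ?] [? ?] /=; rewrite subrK.
lra.
Qed.

Lemma cn_ge_sub (a b : R[i]) (c : R) : cn (a - b) <= c -> cn a - c <= cn b.
Proof. by move=> h; have := cnD (a - b) b; rewrite subrK; lra. Qed.

(** E comes from three reductions: a set common to all phases, one colour class, and a refinement
    after which every sum of six word frequencies is constant or spread. *)
Theorem counting (k : nat) (p : fpoly R) (K : nat) (prof : R -> R) (nu : R) (m : nat) (dlt : R) :
  (0 < k <= 4)%N -> all (fun t => inletters K t.2) p ->
  (forall e, 0 < e -> 0 < prof e) -> 0 < nu -> 0 < dlt ->
  exists2 c : R, 0 < c &
  forall (G : finComNzRingType) (chi : G -> R[i]), charsys chi ->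
  forall (col : G -> 'I_m.+1) (g : nat -> G -> R[i]) (F : G -> R),
    (forall j, (j < K)%N -> qphase chi prof nu (g j)) -> (forall x, 0 <= F x <= 1) ->
    (forall x, evp g p x = (F x)%:C) ->
  exists E : {set G}, [/\ E != set0, c * #|G|%:R <= #|E|%:R, {in E &, forall x y, col x = col y} &
    ex F ^+ k - dlt <= apavg (fun d : sub_of E => val d) F k].
Proof.
move=> hk hp prof0 nu0 dlt0.
pose W := l1norm p + 1; have W1 : 1 <= W by rewrite lerDr l1norm_ge0.
pose d' := Num.min dlt 1.
have d'0 : 0 < d' by rewrite lt_min dlt0 ltr01.
have d'1 : d' <= 1 by rewrite ge_min lexx orbT.
have d'd : d' <= dlt by rewrite ge_min lexx.
(* Quadratic in d', because [pow3_sub] divides by E F and needs 6 W^2 dl <= (d'/2)^2. *)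
pose dl := d' ^+ 2 / (48 * W ^+ 4).
have W0 : 0 < W by apply: lt_le_trans W1.
have dl0 : 0 < dl by rewrite divr_gt0 ?exprn_gt0 // mulr_gt0 ?exprn_gt0.
have dlW : W ^+ 4 * dl = d' ^+ 2 / 48.
  by rewrite /dl invfM; field; rewrite gt_eqF.
pose L : seq word := pwords p ++ map flipw (pwords p) ++ [:: [::]].
pose n := (\max_(w <- L) size w)%N.
pose s := dl / 4; have s0 : 0 < s by rewrite divr_gt0.
(* Chosen for [he]: the phases have error 2e and symmetry defect 8e / nu, so words of length at most
   n cost n e (12 + 32 / nu) <= dl / 2. *)
pose e := dl / 2 / (n.+1%:R * (12 + 32 / nu)).
have c0 : 0 < 12 + 32 / nu by rewrite addr_gt0 // divr_gt0.
have B0 : 0 < n.+1%:R * (12 + 32 / nu) by rewrite mulr_gt0 // ltr0n.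
have e0 : 0 < e by rewrite /e divr_gt0 // divr_gt0.
have he : 6 * (n%:R * (e + e)) + (4 * n%:R * (4 * (e + e) / nu) + s) <= dl.
  have h1 : n.+1%:R * e * (12 + 32 / nu) = dl / 2.
    by rewrite mulrAC /e [LHS]mulrC divfK // gt_eqF.
  have h2 : n%:R * e * (12 + 32 / nu) <= dl / 2.
    by rewrite -h1 ler_wpM2r ?(ltW c0) // ler_wpM2r ?(ltW e0) // ler_nat.
  have -> : 6 * (n%:R * (e + e)) + (4 * n%:R * (4 * (e + e) / nu) + s) = n%:R * e * (12 + 32 / nu) + s by ring.
  rewrite /s; lra.
have [c1 c10 hc1] := common_phased K prof0 e0.
pose q := size L.
pose J := ('I_q * 'I_q * 'I_q * 'I_q * 'I_q * 'I_q)%type.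
have [c2 c20 hc2] := refine #|{: J}| s0 (divr_gt0 c10 (ltr0Sn R m)).
exists c2 => // G chi hchi col g F hg hF evF.
have G0 := cardG_gt0 R G.
have [E1 [xi [h [cE1 hE1]]]] := hc1 G chi hchi nu g hg.
have [|E2 [sE2 cE2] hE2] := pigeonhole R E1 col; first by rewrite card_ord.
rewrite card_ord in cE2.
have cE2' : c1 / m.+1%:R * #|G|%:R <= #|E2|%:R.
  by rewrite mulrAC ler_pdivrMr ?ltr0n // [leRHS]mulrC; exact: le_trans cE1 cE2.
have E2n0 : E2 != set0.
  by rewrite -card_gt0 -(ltr0n R); apply: lt_le_trans cE2'; rewrite mulr_gt0 // divr_gt0 // ltr0n.
pose wd (j : J) : word := let: (i1, i2, i3, i4, i5, i6) := j in
  nth [::] L i1 ++ nth [::] L i2 ++ nth [::] L i3 ++ nth [::] L i4 ++ nth [::] L i5 ++ nth [::] L i6.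
pose Phi (j : J) (x : G) : G := xiw xi (wd j) x.
have [E [sE En0 cE] hE] := hc2 G J G Phi E2 E2n0 cE2' (max_card _).
exists E; split => //.
  by move=> x y hx hy; apply: hE2; apply: (subsetP sE).
pose D := sub_of E; pose v := fun d : D => val d.
have vinj : injective v by apply: val_inj.
have /set0Pn[x0 hx0] := En0; pose e1 : D := exist _ x0 hx0.
pose xiD j (d : D) := xi j (val d).
have hq j : (j < K)%N -> quadf chi v (xiD j) (e + e) (g j).
  move=> jK; have [b _ _] := hg j jK; apply: (phased_quadf hchi b (h := h j)).
  by move=> d hd; apply: hE1 => //; apply: (subsetP sE2); apply: (subsetP sE).
have hs j : (j < K)%N -> symf chi v (4 * (e + e) / nu) (xiD j).
  by move=> jK; have [_ b _] := hg j jK; apply: (quadf_symf hchi nu0 b); apply: hq.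
have ee0 : 0 <= e + e by rewrite addr_ge0 // ltW.
have sg0 : 0 <= 4 * (e + e) / nu by rewrite divr_ge0 ?mulr_ge0 // ltW.
have hL w : w \in L -> inletters K w /\ (size w <= n)%N.
  move=> wL; split; last by rewrite /n; apply: leq_bigmax_seq.
  have flipK u : inletters K (flipw u) = inletters K u by rewrite /inletters all_map.
  move: wL; rewrite !mem_cat inE => /or3P[/mapP[t tp ->]|/mapP[u /mapP[t tp ->] ->]|/eqP ->] //.
    exact: (allP hp).
  by rewrite flipK; apply: (allP hp).
have nilL : [::] \in L by rewrite !mem_cat inE eqxx !orbT.
have pL w : w \in pwords p -> w \in L /\ flipw w \in L.
  by move=> wp; rewrite !mem_cat wp (map_f _ wp) !orbT.
have dich w1 w2 w3 w4 w5 w6 : w1 \in L -> w2 \in L -> w3 \in L -> w4 \in L -> w5 \in L -> w6 \in L ->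
  let w := w1 ++ w2 ++ w3 ++ w4 ++ w5 ++ w6 in
  (forall d1 d2, xiw xiD w d1 = xiw xiD w d2) \/ spread s (xiw xiD w).
  move=> h1 h2 h3 h4 h5 h6 w.
  pose ix u (hu : u \in L) : 'I_q := Ordinal (etrans (index_mem u L) hu).
  have hw : wd (ix _ h1, ix _ h2, ix _ h3, ix _ h4, ix _ h5, ix _ h6) = w by rewrite /wd /= !nth_index.
  have [/constinP hh|hh] := hE (ix _ h1, ix _ h2, ix _ h3, ix _ h4, ix _ h5, ix _ h6).
    by left => -[d1 hd1] [d2 hd2]; have := hh d1 d2 hd1 hd2; rewrite /Phi hw.
  by right; move: (spread_sub hh); rewrite /Phi hw.
have bF : bounded1 (evp g p).
  by move=> x; rewrite evF cnR; have /andP[h1 h2] := hF x; rewrite ger0_norm.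
have evpC : evp g (conjp p) = evp g p.
  by apply: boolp.funext => x; rewrite evp_conj evF conjR.
have evp1 : evp g (onep R) = fun=> 1 by apply: boolp.funext => x; apply: evp_one.
have slotE i : (i < k)%N -> slot F k i = evp g p.
  by move=> ik; apply: boolp.funext => x; rewrite /slot ik evF.
have slot1 i : (k <= i)%N -> slot F k i = evp g (onep R).
  by move=> ik; rewrite evp1; apply: boolp.funext => x; rewrite /slot ltnNge ik.
have exF : ex (evp g p) = (ex F)%:C by rewrite ex_real; apply: eq_ex.
have a01 : 0 <= ex F <= 1.
  apply/andP; split; first by apply: ex_ge0 => x; case/andP: (hF x).
  by apply: (ex_le (0 : G)) => x; case/andP: (hF x).
pose cl := classp e1 g xiD p 0.
have lW : l1norm p <= W by rewrite lerDl.
have l0 := l1norm_ge0 p.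
have hm : ex F - W * dl <= cn (ex cl).
  have hh := mean_classp hchi vinj e1 ee0 sg0 hq (ltW s0) he hL nilL dich pL.
  have := cn_ge_sub hh; rewrite exF cnR ger0_norm; last by case/andP: a01.
  have : l1norm p * dl <= W * dl by rewrite ler_wpM2r // ltW.
  rewrite -/cl => h1 h2; apply: le_trans h2; by rewrite lerD2l lerN2.
have W2 : W * dl <= W ^+ 2 * dl by rewrite ler_wpM2r ?(ltW dl0) // expr2 ler_peMl ?(ltW W0).
have W3 : W ^+ 2 * dl <= W ^+ 3 * dl by rewrite ler_wpM2r ?(ltW dl0) // [leRHS]exprS ler_peMl ?exprn_ge0 ?(ltW W0).
have W4 : W ^+ 3 * dl <= W ^+ 4 * dl by rewrite ler_wpM2r ?(ltW dl0) // [leRHS]exprS ler_peMl ?exprn_ge0 ?(ltW W0).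
have d2 : d' ^+ 2 <= d' by rewrite expr2 ler_piMl // ltW.
have Wdl0 : 0 <= W * dl by rewrite mulr_ge0 // ltW.
have mono (A : R) : 0 <= A -> l1norm p * A <= W * A by move=> A0; rewrite ler_wpM2r.
case: k hk slotE slot1 => [|[|[|[|[|k]]]]] // _ slotE slot1.
- by rewrite (apavg1 v e1) expr1 lerBlDr lerDl ltW.
- by apply: le_trans (apavg2 v e1 F); rewrite lerBlDr lerDl ltW.
- pose X : R := \E_x F x * cn (cl x) ^+ 2.
  have h3 := count3_main hchi vinj e1 ee0 sg0 hq hs (ltW s0) he hL nilL dich pL.
  have eX : \E_x evp g p x * ((cl x)^* * cl x) = X%:C.
    by rewrite ex_real; apply: eq_ex => x; rewrite evF rmorphM /= sqr_cn mulrC [cl x * _]mulrC mulrC.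
  rewrite -/cl eX in h3.
  have hX := Re_ge_cn h3.
  have -> : apavg v F 3 = Re (avg4 v g p (conjp p) p (onep R)).
    by rewrite /apavg /apcorr /avg4 evpC (slotE 0%N) // (slotE 1%N) // (slotE 2%N) // (slot1 3%N).
  have hc := corr_classp hchi vinj e1 ee0 sg0 hq (ltW s0) he hL nilL dich pL.
  pose q' : R := \E_x cn (cl x) ^+ 2.
  have eq' : \E_x (cl x)^* * cl x = q'%:C.
    by rewrite ex_real; apply: eq_ex => x; rewrite sqr_cn mulrC.
  rewrite -/cl eq' in hc; rewrite cnB in hc; have hc' := cn_ge_sub hc.
  have q0 : 0 <= q' by apply: ex_ge0 => x; rewrite sqr_ge0.
  rewrite cnR ger0_norm // in hc'.
  set z := cn (\E_x _) in hc'.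
  (* Cauchy-Schwarz with F written as the square of its root, so that one factor is E F and the
     other E F |F_0|^2. *)
  have zX : z ^+ 2 <= ex F * X.
    have hz : z <= \E_x Num.sqrt (F x) * (Num.sqrt (F x) * cn (cl x)).
      apply: le_trans (cn_ex _) _; apply: ler_ex => x; have /andP[f0 _] := hF x.
      by rewrite mulrA -expr2 sqr_sqrtr // (cnM _^*) cn_conj evF cnR ger0_norm.
    have z0 : 0 <= z by apply: cn_ge0.
    apply: (@le_trans _ _ ((\E_x Num.sqrt (F x) * (Num.sqrt (F x) * cn (cl x))) ^+ 2)).
      by rewrite ler_pXn2r ?nnegrE // (le_trans z0).
    apply: le_trans (CS_ex _ _) _; rewrite le_eqVlt; apply/orP; left; apply/eqP.
    congr (_ * _); apply: eq_ex => x; have /andP[f0 _] := hF x; first by rewrite sqr_sqrtr.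
    by rewrite exprMn sqr_sqrtr.
  have l2 : l1norm p * (l1norm p * dl) <= W ^+ 2 * dl.
    rewrite expr2 -mulrA; apply: le_trans (mono _ _) _; first by rewrite mulr_ge0 // ltW.
    by rewrite ler_pM2l //; apply: mono; apply: ltW.
  have l3 : l1norm p * (l1norm p * (l1norm p * dl)) <= W ^+ 3 * dl.
    rewrite exprS -mulrA; apply: le_trans (mono _ _) _; first by do 2!apply: mulr_ge0 => //; apply: ltW.
    by rewrite ler_pM2l.
  have := @pow3_sub (ex F) (W ^+ 2 * dl) (cn (ex cl)) q' z X (d' / 2) a01 _ _ (cn_ge0 _) _ (cn_ge0 _) _ (sqr_cn_ex _) _ zX _.
  have X0 : 0 <= X by apply: ex_ge0 => x; rewrite mulr_ge0 ?sqr_ge0 //; case/andP: (hF x).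
  have t1 : 0 < d' / 2 by rewrite divr_gt0.
  have t2 := le_trans Wdl0 W2.
  have t3 : ex F - W ^+ 2 * dl <= cn (ex cl) by apply: le_trans hm; rewrite lerD2l lerN2.
  have t4 : q' - W ^+ 2 * dl <= z by apply: le_trans hc'; rewrite lerD2l lerN2.
  have t5 : 6 * (W ^+ 2 * dl) <= d' / 2 * (d' / 2) by clear -W2 W3 W4 dlW dl0 d'0 ; move: (sqr_ge0 d'); lra.
  move=> /(_ t1 t2 X0 t3 t4 t5) hfin.
  have hX' : X - l1norm p * (l1norm p * (l1norm p * dl)) <= Re (avg4 v g p (conjp p) p (onep R)) := hX.
  by clear -hX' hfin l3 W2 W3 W4 dlW d2 d'd d'0; lra.
- pose S : R := \E_x \sum_k cn (classp e1 g xiD p k x) ^+ 2 * cn (classp e1 g xiD p (k *+ 3) x) ^+ 2.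
  have h4 := count4_main hchi vinj e1 ee0 sg0 hq hs (ltW s0) he hL nilL dich pL.
  have hS := Re_ge_cn h4.
  have -> : apavg v F 4 = Re (avg4 v g p (conjp p) p (conjp p)).
    by rewrite /apavg /apcorr /avg4 evpC !slotE.
  have hS' : S - l1norm p * (l1norm p * (l1norm p * (l1norm p * (dl + dl)))) <= Re (avg4 v g p (conjp p) p (conjp p)) := hS.
  have S4 : cn (ex cl) ^+ 4 <= S.
    apply: (@le_trans _ _ (\E_x (cn (cl x) ^+ 2) ^+ 2)).
      rewrite (_ : 4 = 2 * 2)%N // exprM; apply: le_trans (sqr_ex_le _).
      by rewrite ler_pXn2r ?nnegrE ?sqr_ge0 ?sqr_cn_ex // ex_ge0 // => x; rewrite sqr_ge0.
    apply: ler_ex => x; rewrite (bigD1 (0 : {ffun D -> G})) //= mul0rn -/cl expr2 lerDl.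
    by apply: sumr_ge0 => i _; rewrite mulr_ge0 ?sqr_ge0.
  have l4 : l1norm p * (l1norm p * (l1norm p * (l1norm p * (dl + dl)))) <= 2 * (W ^+ 4 * dl).
    have dd0 : 0 <= dl + dl by rewrite addr_ge0 // ltW.
    rewrite (_ : 2 * _ = W * (W * (W * (W * (dl + dl))))); last by ring.
    do 3![apply: le_trans (mono _ _) _; [by rewrite !mulr_ge0|rewrite ler_pM2l //]].
    exact: mono.
  have := pow4_sub a01 Wdl0 (cn_ge0 _) hm.
  by clear -hS' S4 l4 W2 W3 W4 dlW d2 d'd Wdl0 d'0; lra.
Qed.
End Counting.

(** * Energy increment *)
Section Bernstein.
Variable R : realType.

(** The expectation of phi at a binomial variable with parameters n and t, by conditioning on the
    first toss. The recursion carries over to formal polynomials in [pbern]. *)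
Fixpoint bern (n : nat) (phi : nat -> R) (t : R) : R :=
  if n is n'.+1 then t * bern n' (fun j => phi j.+1) t + (1 - t) * bern n' phi t else phi 0%N.

Lemma bern_le n phi psi t : 0 <= t <= 1 -> (forall j, phi j <= psi j) -> bern n phi t <= bern n psi t.
Proof.
move=> /andP[t0 t1]; elim: n phi psi => [|n IH] phi psi h //=.
by apply: lerD; rewrite ler_wpM2l ?subr_ge0 // IH.
Qed.

Lemma bern_affine n phi a b t : bern n (fun j => a * phi j + b) t = a * bern n phi t + b.
Proof. by elim: n phi => [|n IH] phi //=; rewrite !IH; ring. Qed.

Lemma bern_sqr n t a : bern n (fun j => (j%:R - a) ^+ 2) t = (n%:R * t - a) ^+ 2 + n%:R * t * (1 - t).
Proof.
elim: n a => [|n IH] a /=; first by ring.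
rewrite IH (_ : (fun j : nat => (j.+1%:R - a) ^+ 2) = (fun j => (j%:R - (a - 1)) ^+ 2)).
  by rewrite IH -natr1; ring.
by apply: boolp.funext => j; rewrite -natr1; congr (_ ^+ 2); ring.
Qed.

Definition clamp (x : R) : R := Num.min (Num.max x 0) 1.

Lemma clamp01 x : 0 <= clamp x <= 1.
Proof. by rewrite /clamp le_min ge_min lexx orbT le_max lexx orbT ler01. Qed.

Lemma clampE x : clamp x = if x <= 0 then 0 else if x <= 1 then x else 1.
Proof.
rewrite /clamp; case: (leP x 0) => h0; first by rewrite min_l ?ler01.
by case: (leP x 1).
Qed.

Lemma clamp_lip x y : `|clamp x - clamp y| <= `|x - y|.
Proof.
have h5 := ler_norm (x - y); have h6 : y - x <= `|x - y| by rewrite distrC ler_norm.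
move: (`|x - y|) h5 h6 => w h5 h6.
rewrite !clampE; case: (leP x 0) => h1; case: (leP y 0) => h2; case: (leP x 1) => h3; case: (leP y 1) => h4;
  by rewrite ler_norml; lra.
Qed.

Lemma clamp_closer f y : 0 <= f <= 1 -> (f - clamp y) ^+ 2 <= (f - y) ^+ 2.
Proof. by move=> /andP[f0 f1]; rewrite clampE; case: (leP y 0) => h1; [nra|case: (leP y 1) => h2; nra]. Qed.

(** The corrected function must have values in [0, 1] and still be a polynomial in the phases; a
    Bernstein polynomial of [clamp] achieves both. The range [-1, 2] contains every value F + c1 Re
    h. Convergence is Chebyshev's argument: the Lipschitz bound in |j/n - t| is replaced by a
    quadratic one, whose expectation is given by [bern_sqr]. *)
Lemma bernstein_clamp (d : R) : 0 < d -> exists n (phi : nat -> R), (forall j, 0 <= phi j <= 1) /\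
  forall y, -1 <= y <= 2 -> `|bern n phi ((y + 1) / 3) - clamp y| <= d.
Proof.
move=> d0; pose th := d / 3; have th0 : 0 < th by rewrite divr_gt0.
pose n := (Num.bound (1 / th ^+ 2)).+1.
have nb : 1 <= n%:R * th ^+ 2.
  rewrite -ler_pdivrMr ?exprn_gt0 //; apply: (@le_trans _ _ (Num.bound (1 / th ^+ 2))%:R); last by rewrite ler_nat.
  by apply/ltW/archi_boundP; rewrite divr_ge0 // sqr_ge0.
have n0 : 0 < n%:R :> R by rewrite ltr0n.
exists n, (fun j => clamp (3 * j%:R / n%:R - 1)); split => [j|y /andP[y0 y1]]; first exact: clamp01.
pose t := (y + 1) / 3; have yt : y = 3 * t - 1 by rewrite /t; field.
have t01 : 0 <= t <= 1 by rewrite /t; lra.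
pose c := 3 / (2 * th * n%:R ^+ 2).
have key j : `|clamp (3 * j%:R / n%:R - 1) - clamp y| <= c * (j%:R - n%:R * t) ^+ 2 + 3 / 2 * th.
  apply: le_trans (clamp_lip _ _) _.
  pose z := j%:R / n%:R - t.
  have -> : 3 * j%:R / n%:R - 1 - y = 3 * z by rewrite yt /z; ring.
  have -> : c * (j%:R - n%:R * t) ^+ 2 = 3 / (2 * th) * z ^+ 2.
    by rewrite /c /z; field; rewrite !gt_eqF.
  have zz : `|z| ^+ 2 = z ^+ 2 by rewrite real_normK ?num_real.
  rewrite normrM ger0_norm // -zz; move: (`|z|) => w.
  rewrite -subr_ge0 (_ : _ - _ = 3 / (2 * th) * (w - th) ^+ 2); last by field; rewrite gt_eqF.
  by rewrite mulr_ge0 ?sqr_ge0 // divr_ge0 // mulr_ge0 // ltW.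
have main : c * (n%:R * t * (1 - t)) + 3 / 2 * th <= d.
  have -> : c * (n%:R * t * (1 - t)) = 3 / 2 * (t * (1 - t)) / (th * n%:R).
    by rewrite /c; field; rewrite !gt_eqF.
  have -> : d = 3 / 2 * th + 3 / 2 * th by rewrite /th; field.
  rewrite lerD2r ler_pdivrMr; last exact: mulr_gt0.
  have : t * (1 - t) <= 1 by nra.
  by move: nb; nra.
have bs : bern n (fun j => (j%:R - n%:R * t) ^+ 2) t = n%:R * t * (1 - t).
  by rewrite bern_sqr subrr expr0n /= add0r.
have up : bern n (fun j => clamp (3 * j%:R / n%:R - 1)) t <= clamp y + d.
  apply: (@le_trans _ _ (bern n (fun j => c * (j%:R - n%:R * t) ^+ 2 + (clamp y + 3 / 2 * th)) t)).
    by apply: bern_le => // j; have := key j; rewrite ler_norml; lra.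
  by rewrite bern_affine bs; move: main; move: (n%:R * t * (1 - t)) => w; lra.
have dn : clamp y - d <= bern n (fun j => clamp (3 * j%:R / n%:R - 1)) t.
  apply: (@le_trans _ _ (bern n (fun j => (- c) * (j%:R - n%:R * t) ^+ 2 + (clamp y - 3 / 2 * th)) t)).
    by rewrite bern_affine bs mulNr; move: main; move: (n%:R * t * (1 - t)) => w; lra.
  by apply: bern_le => // j; have := key j; rewrite ler_norml; lra.
by rewrite ler_norml; lra.
Qed.

Lemma bern01 n phi t : 0 <= t <= 1 -> (forall j, 0 <= phi j <= 1) -> 0 <= bern n phi t <= 1.
Proof.
move=> ht h; have bc (a : R) : bern n (fun=> a) t = a.
  transitivity (bern n (fun j => 0 * 0 + a) t).
    by congr bern; apply: boolp.funext => j; rewrite mul0r add0r.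
  by rewrite (bern_affine n (fun=> 0)) mul0r add0r.
rewrite -{1}[0](bc 0) -[X in _ && (_ <= X)](bc 1); apply/andP.
by split; apply: bern_le => // j; case/andP: (h j).
Qed.

Definition pconst (a : R) : fpoly R := [:: (a%:C, [::])].
Definition pmul (p q : fpoly R) : fpoly R := [seq (s.1 * t.1, s.2 ++ t.2) | s <- p, t <- q].
Fixpoint pbern n (phi : nat -> R) (q : fpoly R) : fpoly R :=
  if n is n'.+1 then pmul q (pbern n' (fun j => phi j.+1) q) ++
    pmul (pconst 1 ++ pmul (pconst (-1)) q) (pbern n' phi q) else pconst (phi 0%N).
Lemma pbernS n phi q : pbern n.+1 phi q = pmul q (pbern n (fun j => phi j.+1) q) ++
    pmul (pconst 1 ++ pmul (pconst (-1)) q) (pbern n phi q).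
Proof. by []. Qed.
Definition pletters K (p : fpoly R) := all (fun t => inletters K t.2) p.

Lemma pletters_cat K p q : pletters K (p ++ q) = pletters K p && pletters K q.
Proof. exact: all_cat. Qed.
Lemma pletters_mul K p q : pletters K p -> pletters K q -> pletters K (pmul p q).
Proof.
move=> /allP hp /allP hq; apply/allP => t /allpairsP[[a b] [/= ha hb ->]] /=.
by rewrite /inletters all_cat; apply/andP; split; [apply: hp|apply: hq].
Qed.
Lemma pletters_bern K n phi q : pletters K q -> pletters K (pbern n phi q).
Proof.
move=> hq; elim: n phi => [|n IH] phi //.
rewrite pbernS pletters_cat !pletters_mul //.
by rewrite (pletters_cat _ (pconst 1)) pletters_mul.
Qed.
Lemma pletters_le K K' p : (K <= K')%N -> pletters K p -> pletters K' p.
Proof.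
by move=> h; apply: sub_all => t; apply: sub_all => l /leq_trans; apply.
Qed.

Section Ev.
Variables (G : finComNzRingType) (g : nat -> G -> R[i]).
Lemma evp_cat p q x : evp g (p ++ q) x = evp g p x + evp g q x.
Proof. by rewrite /evp big_cat. Qed.
Lemma evp_mul p q x : evp g (pmul p q) x = evp g p x * evp g q x.
Proof.
rewrite /evp /pmul big_allpairs_dep mulr_suml; apply: eq_bigr => s _; rewrite mulr_sumr; apply: eq_bigr => t _ /=.
by rewrite evw_cat; ring.
Qed.
Lemma evp_const a x : evp g (pconst a) x = a%:C.
Proof. by rewrite /evp big_seq1 /evw big_nil mulr1. Qed.
Lemma evp_bern n phi q (y : R) x : evp g q x = y%:C -> evp g (pbern n phi q) x = (bern n phi y)%:C.
Proof.
move=> hq; elim: n phi => [|n IH] phi; first exact: evp_const.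
rewrite pbernS evp_cat !evp_mul evp_cat evp_mul !evp_const hq !IH !rmorphD !rmorphM rmorphB /= !rmorphN /= rmorph1.
by ring.
Qed.
End Ev.

Lemma evp_ext (G : finComNzRingType) (g g' : nat -> G -> R[i]) K p : pletters K p ->
  (forall j, (j < K)%N -> g j = g' j) -> evp g p =1 evp g' p.
Proof.
move=> /allP hp hg x; rewrite /evp !big_seq; apply: eq_bigr => t /hp /allP ht; congr (_ * _).
by rewrite /evw !big_seq; apply: eq_bigr => l /ht hl; rewrite /evl hg.
Qed.
End Bernstein.

Section Increment.
Variable R : realType.

Lemma qphase_weaken (G : finComNzRingType) (chi : G -> R[i]) prof prof' nu nu' g :
  (forall e, prof' e <= prof e) -> nu' <= nu -> qphase chi prof nu g -> qphase chi prof' nu' g.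
Proof.
move=> hp hn [b1 b2 b3]; split => //; first exact: le_trans b2.
move=> e e0; have [E [xi [h [h1 h2]]]] := b3 e e0; exists E, xi, h; split => //.
by apply: le_trans h1; rewrite ler_wpM2r.
Qed.

(* The type (p', prof', nu') of the corrected function depends only on the type of F and not on G; this uniformity keeps all
   constants absolute. *)
Definition incremental (eta rho : R) := forall (p : fpoly R) K prof nu, pletters K p -> (forall e, 0 < e -> 0 < prof e) -> 0 < nu ->
    exists (p' : fpoly R) (prof' : R -> R) (nu' : R),
    [/\ pletters K.+1 p', (forall e, 0 < e -> 0 < prof' e), 0 < nu' &
    forall (G : finComNzRingType) (chi : G -> R[i]), charsys chi ->
    forall (g : nat -> G -> R[i]) (f F : G -> R), (forall j, (j < K)%N -> qphase chi prof nu (g j)) ->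
      (forall x, 0 <= f x <= 1) -> (forall x, 0 <= F x <= 1) -> (forall x, evp g p x = (F x)%:C) ->
      eta <= U3 (fun x => (f x - F x)%:C) ->
      exists (g' : nat -> G -> R[i]) (F' : G -> R), [/\ forall j, (j < K)%N -> g' j = g j,
        forall j, (j < K.+1)%N -> qphase chi prof' nu' (g' j), forall x, 0 <= F' x <= 1,
        forall x, evp g' p' x = (F' x)%:C &
        \E_x (f x - F' x) ^+ 2 <= (\E_x (f x - F x) ^+ 2) - rho]].

(** If h is the phase correlating with f - F, adding c1 Re h to F lowers the energy by at least 2
    c1^2 - c1^2. Clamping does not move the result away from f, and the Bernstein approximation
    costs 3 d = c1^2 / 2. *)
Lemma increment (eta : R) : 0 < eta -> exists2 rho : R, 0 < rho & incremental eta rho.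
Proof.
move=> eta0; have [c [prof1 [c0 hprof1 hinv]]] := inverse_U3 eta0.
pose c1 := Num.min c 1; have c10 : 0 < c1 by rewrite lt_min c0 ltr01.
have c11 : c1 <= 1 by rewrite ge_min lexx orbT.
have c1c : c1 <= c by rewrite ge_min lexx.
exists (c1 ^+ 2 / 2); first by rewrite divr_gt0 ?exprn_gt0.
move=> p K prof nu hp hprof nu0.
pose d := c1 ^+ 2 / 6; have d0 : 0 < d by rewrite divr_gt0 ?exprn_gt0.
have [n [phi [phi01 hb]]] := bernstein_clamp d0.
(* The new letter K plus its conjugate is 2 Re h, so q evaluates to (F + c1 Re h + 1) / 3, the
   argument of the Bernstein polynomial. *)
pose gp : fpoly R := [:: (1, [:: (K, false)]); (1, [:: (K, true)])].
pose q := pmul (pconst (1 / 3)) (p ++ pmul (pconst (c1 / 2)) gp ++ pconst 1).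
exists (pbern n phi q), (fun e => Num.min (prof e) (prof1 e)), (Num.min nu c); split.
- apply: pletters_bern; apply: pletters_mul => //.
  rewrite pletters_cat (pletters_le (leqnSn K) hp) (pletters_cat _ (pmul _ _)) pletters_mul //.
  by rewrite /= /inletters /= ltnSn.
- by move=> e e0; rewrite lt_min hprof // hprof1.
- by rewrite lt_min nu0.
move=> G chi hchi g f F hg hf hF evF hU.
pose u x : R[i] := (f x - F x)%:C.
have bu : bounded1 u.
  by move=> x; rewrite cnR ler_norml; move: (hf x) (hF x) => /andP[? ?] /andP[? ?]; lra.
have [h qh hcor] := hinv G chi hchi u bu hU.
pose g' j := if j == K then h else g j.
pose y x := F x + c1 * Re (h x).
have y12 x : -1 <= y x <= 2.
  have [bh _ _] := qh; have := le_trans (Re_le_cn _) (bh x); rewrite ler_norml => /andP[h1 h2].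
  by have /andP[F0 F1] := hF x; rewrite /y; nra.
have yt x : 0 <= (y x + 1) / 3 <= 1 by have := y12 x; lra.
have g'K j : (j < K)%N -> g j = g' j by move=> jK; rewrite /g' (ltn_eqF jK).
exists g', (fun x => bern n phi ((y x + 1) / 3)); split.
- by move=> j jK; rewrite g'K.
- move=> j; rewrite ltnS leq_eqVlt /g' => /orP[/eqP ->|jK]; rewrite ?eqxx ?(ltn_eqF jK).
    by apply: qphase_weaken qh => [e|]; rewrite ge_min lexx orbT.
  by apply: (qphase_weaken _ _ (hg j jK)) => [e|]; rewrite ge_min lexx.
- by move=> x; apply: bern01.
- move=> x; apply: evp_bern.
  rewrite /q evp_mul (evp_cat _ p) (evp_cat _ (pmul _ _)) (evp_mul _ _ gp) !evp_const -(evp_ext hp g'K) evF /y.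
  rewrite /evp /gp big_cons big_seq1 /evw !big_seq1 /evl /= /g' eqxx !mul1r.
  have -> : h x + (h x)^* = (2 * Re (h x))%:C.
    by case: (h x) => a b; apply/eqP; rewrite eq_complex /= subrr eqxx andbT; apply/eqP; ring.
  by rewrite -!rmorphM -!rmorphD -rmorphM; congr (_%:C); field.
have e1 : \E_x (f x - bern n phi ((y x + 1) / 3)) ^+ 2 <= \E_x ((f x - y x) ^+ 2 + 3 * d).
  apply: ler_ex => x; have hc := clamp_closer (y x) (hf x).
  have := hb (y x) (y12 x); have /andP[? ?] := hf x; have /andP[+ +] := clamp01 (y x).
  have d1 : d <= 1 by rewrite /d; nra.
  rewrite ler_norml; move: (bern _ _ _) (clamp _) hc => b cl hc b0 b1 /andP[h1 h2].
  have w1 : (cl - b) ^+ 2 <= d by nra.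
  have w2 : (f x - cl) * (cl - b) <= d by nra.
  by nra.
apply: le_trans e1 _.
have -> : \E_x ((f x - y x) ^+ 2 + 3 * d) = (\E_x (f x - F x) ^+ 2) - 2 * c1 * (\E_x (f x - F x) * Re (h x)) +
    c1 ^+ 2 * (\E_x Re (h x) ^+ 2) + 3 * d.
  rewrite -exZ -exZ -exB -exD -{2}(ex_const (0 : G) (3 * d)) -exD; apply: eq_ex => x; rewrite /y; ring.
have hc : c <= \E_x (f x - F x) * Re (h x).
  apply: le_trans hcor _; rewrite Re_ex le_eqVlt; apply/orP; left; apply/eqP.
  apply: eq_ex => x; rewrite /u ReM_real; congr (_ * _).
  by case: (h x).
have hr : \E_x Re (h x) ^+ 2 <= 1.
  have [bh _ _] := qh; apply: (ex_le (0 : G)) => x.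
  by rewrite -[_ ^+ 2]real_normK ?num_real // expr_le1 //; apply: le_trans (Re_le_cn _) (bh x).
have t1 : 2 * c1 * c1 <= 2 * c1 * (\E_x (f x - F x) * Re (h x)).
  by rewrite ler_pM2l ?mulr_gt0 //; lra.
have t2 : c1 ^+ 2 * (\E_x Re (h x) ^+ 2) <= c1 ^+ 2 by rewrite ler_piMr ?sqr_ge0.
by rewrite /d; nra.
Qed.
End Increment.

(** * The von Neumann inequality for differences in E - E *)

Section WeightedGvN.
Variables (R : realType) (G : finComNzRingType) (chi : G -> R[i]).
Hypothesis hchi : charsys chi.
Variables (D : finType) (v : D -> G).
Hypothesis vinj : injective v.
Variable e0 : D.
Implicit Types a b : G -> R[i].

Definition davg4 a0 a1 a2 a3 : R[i] := \E_d1 \E_d2 lam4 a0 a1 a2 a3 (v d1 - v d2).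
Definition ind (x : G) : R[i] := (x \in codom v)%:R.

Lemma bounded1_ind t : bounded1 (fun x => ind (x + t)).
Proof. by move=> x; rewrite /ind; case: (_ \in _); rewrite ?cn1 ?cn0 ?ler01. Qed.

Lemma sum_ind (H : G -> R[i]) : \sum_d H (v d) = \sum_y ind y * H y.
Proof.
rewrite -(big_imset H (h := v) (A := D)) /=; last by move=> a b _ _ /vinj.
rewrite big_mkcond /=; apply: eq_bigr => y _; rewrite /ind.
have -> : (y \in [set v x | x in D]) = (y \in codom v).
  by apply/imsetP/codomP => [[x _ ->]|[x ->]]; exists x.
by case: (_ \in _); rewrite ?mul1r ?mul0r.
Qed.

Lemma davg4_ind (H : G -> R[i]) : #|D|%:R ^+ 2 * (\E_d1 \E_d2 H (v d1 - v d2)) =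
  #|G|%:R ^+ 2 * (\E_d (\E_y ind y * ind (y + d)) * H d).
Proof.
have -> : \E_d1 \E_d2 H (v d1 - v d2) = \E_d2 \E_d1 H (v d1 - v d2) by rewrite ex_exchange.
rewrite !expr2 -!mulrA -(sum_ex e0).
have -> : \sum_d2 \E_d1 H (v d1 - v d2) = #|D|%:R^-1 * \sum_y ind y * \sum_z ind z * H (z - y).
  rewrite -(sum_ind (fun y => \sum_z ind z * H (z - y))) mulr_sumr; apply: eq_bigr => d2 _.
  by rewrite exE (sum_ind (fun z => H (z - v d2))).
rewrite mulVKf; last by rewrite pnatr_eq0 -lt0n; apply/card_gt0P; exists e0.
rewrite -(sum_ex (0 : G)) mulr_sumr.
transitivity (\sum_y \sum_d ind y * ind (y + d) * H d).
  apply: eq_bigr => y _; rewrite mulr_sumr (reindex_inj (addrI y)) /=; apply: eq_bigr => d _.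
  by rewrite (addrC y d) addrK mulrA.
rewrite exchange_big /=; apply: eq_bigr => d _.
by rewrite mulrA -(sum_ex (0 : G)) mulr_suml.
Qed.

(** The weight of d is E_y [ind y * ind (y + d)]. With y = x + t its factors sit at x + t and x + d
    + t and are absorbed into a0 and a1, for each t separately; [davg4_hi] uses a2 and a3 instead.
    So the weight never touches the function whose U3 norm is used. *)
Lemma davg4_lo (rho : R) a0 a1 a2 a3 : bounded1 a0 -> bounded1 a1 ->
  (forall b0 b1, bounded1 b0 -> bounded1 b1 -> cn (\E_d lam4 b0 b1 a2 a3 d) <= rho) ->
  #|D|%:R ^+ 2 * cn (davg4 a0 a1 a2 a3) <= #|G|%:R ^+ 2 * rho.
Proof.
move=> h0 h1 h.
have -> : #|D|%:R ^+ 2 * cn (davg4 a0 a1 a2 a3) = cn (#|D|%:R ^+ 2 * davg4 a0 a1 a2 a3).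
  by rewrite (cnM (#|D|%:R ^+ 2)) expr2 cnM cn_nat.
rewrite davg4_ind (cnM (#|G|%:R ^+ 2)) expr2 (cnM #|G|%:R) cn_nat -expr2 ler_wpM2l ?sqr_ge0 //.
have -> : \E_d (\E_y ind y * ind (y + d)) * lam4 a0 a1 a2 a3 d =
    \E_t \E_d lam4 (fun x => a0 x * ind (x + t)) (fun x => a1 x * ind (x + t)) a2 a3 d.
  rewrite ex_exchange; apply: eq_ex => d; rewrite /lam4 ex_exchange mulrC -exZr; apply: eq_ex => x.
  rewrite -[in LHS](ex_shift x) -exZ; apply: eq_ex => t.
  rewrite [t + x]addrC (_ : x + t + d = x + d + t); last by ring.
  by ring.
apply: le_trans (cn_ex _) _; apply: (ex_le (0 : G)) => t.
by apply: h; apply: bounded1M => //; apply: bounded1_ind.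
Qed.

Lemma davg4_hi (rho : R) a0 a1 a2 a3 : bounded1 a2 -> bounded1 a3 ->
  (forall b2 b3, bounded1 b2 -> bounded1 b3 -> cn (\E_d lam4 a0 a1 b2 b3 d) <= rho) ->
  #|D|%:R ^+ 2 * cn (davg4 a0 a1 a2 a3) <= #|G|%:R ^+ 2 * rho.
Proof.
move=> h0 h1 h.
have -> : #|D|%:R ^+ 2 * cn (davg4 a0 a1 a2 a3) = cn (#|D|%:R ^+ 2 * davg4 a0 a1 a2 a3).
  by rewrite (cnM (#|D|%:R ^+ 2)) expr2 cnM cn_nat.
rewrite davg4_ind (cnM (#|G|%:R ^+ 2)) expr2 (cnM #|G|%:R) cn_nat -expr2 ler_wpM2l ?sqr_ge0 //.
have -> : \E_d (\E_y ind y * ind (y + d)) * lam4 a0 a1 a2 a3 d =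
    \E_t \E_d lam4 a0 a1 (fun x => a2 x * ind (x + t)) (fun x => a3 x * ind (x + t)) d.
  rewrite ex_exchange; apply: eq_ex => d; rewrite /lam4 ex_exchange mulrC -exZr; apply: eq_ex => x.
  rewrite -[in LHS](ex_shift (x + d + d)) -exZ; apply: eq_ex => t.
  rewrite [t + _]addrC (_ : x + d + d + t + d = x + d + d + d + t); last by ring.
  by ring.
apply: le_trans (cn_ex _) _; apply: (ex_le (0 : G)) => t.
by apply: h; apply: bounded1M => //; apply: bounded1_ind.
Qed.

Definition negligible (e : R) a := [/\ forall b1 b2 b3, bounded1 b1 -> bounded1 b2 -> bounded1 b3 -> cn (davg4 a b1 b2 b3) <= e,
  forall b1 b2 b3, bounded1 b1 -> bounded1 b2 -> bounded1 b3 -> cn (davg4 b1 a b2 b3) <= e,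
  forall b1 b2 b3, bounded1 b1 -> bounded1 b2 -> bounded1 b3 -> cn (davg4 b1 b2 a b3) <= e &
  forall b1 b2 b3, bounded1 b1 -> bounded1 b2 -> bounded1 b3 -> cn (davg4 b1 b2 b3 a) <= e].

(** [davg4_lo] and [davg4_hi] lose (|G| / |D|)^2 <= c^-2, and U3 bounds an eighth power. *)
Lemma negligible_U3 (e c : R) a : 0 <= e -> 0 < c -> c * #|G|%:R <= #|D|%:R -> U3 a <= (c ^+ 2 * e) ^+ 8 ->
  negligible e a.
Proof.
move=> e_0 c0 hD hU; have G0 := cardG_gt0 R G.
have fin x : #|D|%:R ^+ 2 * x <= #|G|%:R ^+ 2 * (c ^+ 2 * e) -> x <= e.
  move=> h; have h2 : (c * #|G|%:R) ^+ 2 <= #|D|%:R ^+ 2.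
    by rewrite ler_pXn2r ?nnegrE // mulr_ge0 // ltW.
  have h3 : 0 < (c * #|G|%:R) ^+ 2 by rewrite exprn_gt0 // mulr_gt0.
  rewrite (_ : #|G|%:R ^+ 2 * (c ^+ 2 * e) = (c * #|G|%:R) ^+ 2 * e) in h; last by ring.
  rewrite -(ler_pM2l (lt_le_trans h3 h2)); apply: le_trans h _.
  by rewrite ler_wpM2r.
have root x : 0 <= x -> x ^+ 8 <= U3 a -> x <= c ^+ 2 * e.
  move=> x0 hx; have := le_trans hx hU; rewrite ler_pXn2r ?nnegrE //.
  by rewrite mulr_ge0 // exprn_ge0 // ltW.
split=> b1 b2 b3 h1 h2 h3; apply: fin.
- by apply: davg4_hi => // c2 c3 hc2 hc3; apply: root; rewrite ?cn_ge0 //; apply: (gvn0 hchi).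
- by apply: davg4_hi => // c2 c3 hc2 hc3; apply: root; rewrite ?cn_ge0 //; apply: (gvn1 hchi).
- by apply: davg4_lo => // c2 c3 hc2 hc3; apply: root; rewrite ?cn_ge0 //; apply: (gvn2 hchi).
- by apply: davg4_lo => // c2 c3 hc2 hc3; apply: root; rewrite ?cn_ge0 //; apply: (gvn3 hchi).
Qed.

Lemma negligible_L1 (e : R) a : \E_x cn (a x) <= e -> negligible e a.
Proof.
move=> h.
have av (H : G -> R[i]) : (forall d, cn (H d) <= e) -> cn (\E_d1 \E_d2 H (v d1 - v d2)) <= e.
  move=> hH; apply: le_trans (cn_ex _) _; apply: (ex_le e0) => d1.
  by apply: le_trans (cn_ex _) _; apply: (ex_le e0) => d2.
have m (z w : R[i]) : cn w <= 1 -> cn (z * w) <= cn z.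
  by move=> hw; rewrite (cnM z) ler_piMr ?cn_ge0.
have m3 (x y z : R[i]) : cn x <= 1 -> cn y <= 1 -> cn z <= 1 -> cn (x * y * z) <= 1.
  by move=> hx hy hz; rewrite (cnM (x * y)) (cnM x) mulr_ile1 ?mulr_ge0 ?cn_ge0 // mulr_ile1 ?cn_ge0.
split=> b1 b2 b3 h1 h2 h3; apply: av => d; apply: le_trans (cn_ex _) _; apply: le_trans h.
- apply: ler_ex => x; rewrite -!mulrA mulrA mulrA -mulrA -mulrA; apply: m.
  by rewrite mulrA; apply: m3.
- rewrite -(ex_shift d (fun x => cn (a x))); apply: ler_ex => x.
  rewrite (_ : _ * _ = a (x + d) * (b1 x * b2 (x + d + d) * b3 (x + d + d + d))); last by ring.
  by apply: m; apply: m3.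
- rewrite -(ex_shift (d + d) (fun x => cn (a x))); apply: ler_ex => x; rewrite addrA.
  rewrite (_ : _ * _ = a (x + d + d) * (b1 x * b2 (x + d) * b3 (x + d + d + d))); last by ring.
  by apply: m; apply: m3.
- rewrite -(ex_shift (d + d + d) (fun x => cn (a x))); apply: ler_ex => x; rewrite !addrA mulrC.
  by apply: m; apply: m3.
Qed.

Lemma negligibleD (e1 e2 : R) a b : negligible e1 a -> negligible e2 b -> negligible (e1 + e2) (fun x => a x + b x).
Proof.
move=> [p0 p1 p2 p3] [q0 q1 q2 q3].
have lin (H H1 H2 : G -> R[i]) : (forall d, H d = H1 d + H2 d) ->
    cn (\E_d1 \E_d2 H1 (v d1 - v d2)) <= e1 -> cn (\E_d1 \E_d2 H2 (v d1 - v d2)) <= e2 ->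
    cn (\E_d1 \E_d2 H (v d1 - v d2)) <= e1 + e2.
  move=> hH h1 h2; apply: le_trans (lerD h1 h2); apply: le_trans (cnD _ _).
  rewrite -exD (eq_ex (g := fun d1 => (\E_d2 H1 (v d1 - v d2)) + \E_d2 H2 (v d1 - v d2))) //.
  by move=> d1; rewrite -exD; apply: eq_ex => d2.
split=> b1 b2 b3 h1 h2 h3.
- apply: (lin _ (lam4 a b1 b2 b3) (lam4 b b1 b2 b3) _ (p0 _ _ _ h1 h2 h3) (q0 _ _ _ h1 h2 h3)) => d.
  by rewrite /lam4 -exD; apply: eq_ex => x /=; ring.
- apply: (lin _ (lam4 b1 a b2 b3) (lam4 b1 b b2 b3) _ (p1 _ _ _ h1 h2 h3) (q1 _ _ _ h1 h2 h3)) => d.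
  by rewrite /lam4 -exD; apply: eq_ex => x /=; ring.
- apply: (lin _ (lam4 b1 b2 a b3) (lam4 b1 b2 b b3) _ (p2 _ _ _ h1 h2 h3) (q2 _ _ _ h1 h2 h3)) => d.
  by rewrite /lam4 -exD; apply: eq_ex => x /=; ring.
- apply: (lin _ (lam4 b1 b2 b3 a) (lam4 b1 b2 b3 b) _ (p3 _ _ _ h1 h2 h3) (q3 _ _ _ h1 h2 h3)) => d.
  by rewrite /lam4 -exD; apply: eq_ex => x /=; ring.
Qed.

Lemma apavg_close (k : nat) (e : R) (f F : G -> R) : 0 <= e -> (forall x, 0 <= f x <= 1) -> (forall x, 0 <= F x <= 1) ->
  negligible e (fun x => (f x - F x)%:C) -> apavg v F k - 4 * e <= apavg v f k.
Proof.
move=> e_0 hf hF hn.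
have bs (h : G -> R) i : (forall x, 0 <= h x <= 1) -> bounded1 (slot h k i).
  move=> hh x; rewrite /slot; case: ifP => _; last by rewrite cn1.
  by rewrite cnR; have /andP[h1 h2] := hh x; rewrite ger0_norm.
pose dl i x := slot f k i x - slot F k i x.
have nd i : negligible e (dl i).
  rewrite /dl /slot; case: (i < k)%N.
    by rewrite (_ : (fun x => _) = (fun x => (f x - F x)%:C)) //; apply: boolp.funext => x; rewrite rmorphB.
  apply: negligible_L1; apply: (ex_le (0 : G)) => x; by rewrite subrr cn0.
have [n0 _ _ _] := nd 0%N; have [_ n1 _ _] := nd 1%N; have [_ _ n2 _] := nd 2%N; have [_ _ _ n3] := nd 3%N.
apply: le_trans (Re_ge_cn (a := \E_d1 \E_d2 apcorr f k (v d1 - v d2)) (b := \E_d1 \E_d2 apcorr F k (v d1 - v d2)) (c := 4 * e) _) => //.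
have -> : (\E_d1 \E_d2 apcorr f k (v d1 - v d2)) - (\E_d1 \E_d2 apcorr F k (v d1 - v d2)) =
  davg4 (dl 0%N) (slot f k 1) (slot f k 2) (slot f k 3) +
  davg4 (slot F k 0) (dl 1%N) (slot f k 2) (slot f k 3) +
  davg4 (slot F k 0) (slot F k 1) (dl 2%N) (slot f k 3) +
  davg4 (slot F k 0) (slot F k 1) (slot F k 2) (dl 3%N).
  rewrite /davg4 -exB -!exD; apply: eq_ex => d1; rewrite -exB -!exD; apply: eq_ex => d2.
  rewrite /apcorr /lam4 -exB -!exD; apply: eq_ex => x; rewrite /dl; ring.
have -> : 4 * e = e + e + e + e by ring.
apply: le_trans (cnD _ _) _; apply: lerD; last by apply: n3; apply: bs.
apply: le_trans (cnD _ _) _; apply: lerD; last by apply: n2; apply: bs.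
by apply: le_trans (cnD _ _) _; apply: lerD; [apply: n0|apply: n1]; apply: bs.
Qed.

Lemma cn_ex_U3 (e : R) a : 0 <= e -> U3 a <= e ^+ 8 -> cn (ex a) <= e.
Proof.
move=> e_0 hU; have b1 : bounded1 (fun _ : G => 1 : R[i]) by move=> x; rewrite cn1.
have := gvn0 hchi a b1 b1 b1.
have -> : \E_d lam4 a (fun=> 1) (fun=> 1) (fun=> 1) d = ex a.
  rewrite -[RHS](ex_const (0 : G)); apply: eq_ex => d; apply: eq_ex => x; by rewrite !mulr1.
by move=> h; have := le_trans h hU; rewrite ler_pXn2r ?nnegrE ?cn_ge0.
Qed.
End WeightedGvN.

(** * The double induction *)

Section Popular.
Variable R : realType.

(* col is an arbitrary colouring: intervals as colour classes will confine the differences of E to short integers. *)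
Definition good (G : finComNzRingType) m (col : G -> 'I_m.+1) (k : nat) (e c : R) (f : G -> R) :=
  exists E : {set G}, [/\ E != set0, c * #|G|%:R <= #|E|%:R, {in E &, forall x y, col x = col y} &
    ex f ^+ k - e <= apavg (fun d : sub_of E => val d) f k].

Lemma good_le (G : finComNzRingType) m (col : G -> 'I_m.+1) k e c c' (f : G -> R) :
  c' <= c -> good col k e c f -> good col k e c' f.
Proof.
move=> h [E [h1 h2 h3 h4]]; exists E; split => //.
by apply: le_trans h2; rewrite ler_wpM2r.
Qed.

Lemma pow_close (k : nat) (a b t : R) : 0 <= a <= 1 -> 0 <= b <= 1 -> 0 <= t -> a - b <= t ->
  a ^+ k - k%:R * t <= b ^+ k.
Proof.
move=> /andP[a0 a1] /andP[b0 b1] t0 h; elim: k => [|k IH].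
  by rewrite !expr0 mul0r subr0.
rewrite !exprS -natr1.
have ak : 0 <= a ^+ k <= 1 by rewrite exprn_ge0 // exprn_ile1.
have bk : 0 <= b ^+ k <= 1 by rewrite exprn_ge0 // exprn_ile1.
have kt : 0 <= k%:R * t by rewrite mulr_ge0.
move: IH ak bk kt; move: (a ^+ k) (b ^+ k) => x y; rewrite mulrDl mul1r; move: (k%:R * t) => w.
by move=> ? /andP[? ?] /andP[? ?] ?; nra.
Qed.

(** f - F is the sum of f - F1, small in U3 relative to the density c, and of F1 - F, small in L^1.
    The loss 16 e1 consists of 4 (2 e1) for the four slots and k (2 e1) <= 8 e1 for the power of the
    mean. *)
Lemma close_good (G : finComNzRingType) (chi : G -> R[i]) m (col : G -> 'I_m.+1) k (e' e1 c : R) (f F F1 : G -> R) :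
  charsys chi -> (k <= 4)%N -> 0 < c -> 0 <= e1 ->
  (forall x, 0 <= f x <= 1) -> (forall x, 0 <= F x <= 1) ->
  U3 (fun x => (f x - F1 x)%:C) <= (c ^+ 2 * e1) ^+ 8 -> \E_x (F1 x - F x) ^+ 2 <= e1 ^+ 2 ->
  good col k e' c F -> good col k (e' + 16 * e1) c f.
Proof.
move=> hchi k4 c0 e10 hf hF hU hL2 [E [En0 cE cE' hE]]; exists E; split => //.
have G0 := cardG_gt0 R G.
have /set0Pn[x0 hx0] := En0; pose d0 : sub_of E := exist _ x0 hx0.
pose v := fun d : sub_of E => val d; have vinj : injective v by apply: val_inj.
have cD : c * #|G|%:R <= #|{: sub_of E}|%:R by rewrite card_sig.
have c1 : c <= 1.
  by rewrite -(ler_pM2r G0) mul1r; apply: le_trans cE _; rewrite ler_nat max_card.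
have r1 : \E_x cn ((F1 x - F x)%:C : R[i]) <= e1.
  apply: sqr_le_abs => //; apply: le_trans (sqr_ex_le _) _; apply: le_trans hL2.
  by apply: ler_ex => x; rewrite cnR real_normK ?num_real.
have split_fF : (fun x => (f x - F x)%:C : R[i]) = (fun x => (f x - F1 x)%:C + (F1 x - F x)%:C).
  by apply: boolp.funext => x; rewrite -rmorphD /= addrA subrK.
have ng : negligible v (e1 + e1) (fun x => (f x - F x)%:C).
  rewrite split_fF; apply: negligibleD; first exact: (negligible_U3 hchi vinj d0 e10 c0 cD hU).
  exact: (negligible_L1 v d0 r1).
have e20 : 0 <= e1 + e1 by rewrite addr_ge0.
have h1 := apavg_close d0 k e20 hf hF ng.
have U1 : U3 (fun x => (f x - F1 x)%:C) <= e1 ^+ 8.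
  have c20 : 0 <= c ^+ 2 by apply: sqr_ge0.
  have ce : c ^+ 2 * e1 <= e1 by apply: ler_piMl => //; rewrite expr_le1 // ltW.
  by apply: le_trans hU _; apply: lerXn2r => //; rewrite nnegrE // mulr_ge0.
have h2 : cn (ex (fun x => (f x - F x)%:C : R[i])) <= e1 + e1.
  rewrite split_fF exD; apply: le_trans (cnD _ _) _; apply: lerD; first exact: (cn_ex_U3 hchi).
  by apply: le_trans (cn_ex _) _.
have h3 : ex f - ex F <= e1 + e1.
  apply: le_trans h2; rewrite -ex_real cnR exB; exact: ler_norm.
have u01 (h : G -> R) : (forall x, 0 <= h x <= 1) -> 0 <= ex h <= 1.
  move=> hh; apply/andP; split; first by apply: ex_ge0 => x; case/andP: (hh x).
  by apply: (ex_le (0 : G)) => x; case/andP: (hh x).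
have h4 := pow_close k (u01 f hf) (u01 F hF) e20 h3.
have h5 : k%:R * (e1 + e1) <= 4 * (e1 + e1) by rewrite ler_wpM2r // (ler_nat _ k 4).
by rewrite -/v in hE; move: h1 h4 h5 hE; lra.
Qed.

Section Fixed.
Variables (k m : nat) (e : R).
Hypothesis hk : (0 < k <= 4)%N.
Hypothesis e0 : 0 < e.
(** The loss 16 e1 of [close_good] is e / 2. By the parallelogram law the midpoint of two functions
    at L^2 distance at least e1 gains [kp]. *)
Let e1 := e / 32.
Let kp := e1 ^+ 2 / 4.

Definition represented (G : finComNzRingType) (chi : G -> R[i]) (g : nat -> G -> R[i]) K prof nu p (F : G -> R) :=
  [/\ forall j, (j < K)%N -> qphase chi prof nu (g j), forall x, 0 <= F x <= 1 &
      forall x, evp g p x = (F x)%:C].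

(** The statement of the outer induction, in which b, a bound for the squared L^2 distance from f to
    F, grows in steps of [kp]. *)
Definition popular_upto (b : R) := forall (p : fpoly R) K prof nu, pletters K p -> (forall e, 0 < e -> 0 < prof e) -> 0 < nu ->
  exists2 c : R, 0 < c & forall (G : finComNzRingType) (chi : G -> R[i]) (col : G -> 'I_m.+1) g (f F : G -> R),
    charsys chi -> represented chi g K prof nu p F -> (forall x, 0 <= f x <= 1) ->
    \E_x (f x - F x) ^+ 2 <= b -> good col k e c f.

(* Either F1 is close to F, and the good set of F serves f, or the midpoint of F and F1 is closer to f by the parallelogram law. *)
Lemma popular_uniform (b c' : R) (p p1 : fpoly R) K prof nu : 0 < c' -> popular_upto b ->
  pletters K p -> pletters K p1 -> (forall e, 0 < e -> 0 < prof e) -> 0 < nu ->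
  exists2 c : R, 0 < c & forall (G : finComNzRingType) (chi : G -> R[i]) (col : G -> 'I_m.+1) g (f F F1 : G -> R),
    charsys chi -> represented chi g K prof nu p F -> represented chi g K prof nu p1 F1 ->
    (forall x, 0 <= f x <= 1) -> \E_x (f x - F x) ^+ 2 <= b + kp -> \E_x (f x - F1 x) ^+ 2 <= b + kp ->
    U3 (fun x => (f x - F1 x)%:C : R[i]) <= (c' ^+ 2 * e1) ^+ 8 -> good col k (e / 4) c' F ->
    good col k e c f.
Proof.
move=> c'0 hb lp lp1 prof0 nu0.
have e10 : 0 < e1 by rewrite divr_gt0.
have lm : pletters K (pmul (pconst (1 / 2)) (p ++ p1)) by rewrite pletters_mul // pletters_cat lp.
have [cm cm0 hm] := hb _ K prof nu lm prof0 nu0.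
exists (Num.min c' cm); first by rewrite lt_min c'0.
move=> G chi col g f F F1 hchi [hq hF eF] [_ hF1 eF1] hf hE hE1 hU hg.
have [h|/ltW h] := leP (\E_x (F1 x - F x) ^+ 2) (e1 ^+ 2).
  have [_ k4] := andP hk; apply: (good_le (c := c')); first by rewrite ge_min lexx.
  have := close_good hchi k4 c'0 (ltW e10) hf hF hU h hg.
  by move=> [E [q1 q2 q3 q4]]; exists E; split => //; apply: le_trans q4; rewrite /e1; move: e0; lra.
apply: (good_le (c := cm)); first by rewrite ge_min lexx orbT.
apply: (hm G chi col g f (fun x => 1 / 2 * (F x + F1 x)) hchi) => //.
  split => //; first by move=> x; move: (hF x) (hF1 x) => /andP[? ?] /andP[? ?]; lra.
  by move=> x; rewrite evp_mul evp_cat evp_const eF eF1 -rmorphD -rmorphM.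
have -> : \E_x (f x - 1 / 2 * (F x + F1 x)) ^+ 2 =
    1 / 2 * (\E_x (f x - F x) ^+ 2) + 1 / 2 * (\E_x (f x - F1 x) ^+ 2) - 1 / 4 * (\E_x (F1 x - F x) ^+ 2).
  by rewrite -!exZ -exD -exB; apply: eq_ex => x; field.
by rewrite /kp in hE hE1; lra.
Qed.

(** The inner loop: F and the density c' of its set stay fixed, while F1 is corrected until f - F1
    meets the threshold set by c'. Each correction lowers the energy by rho, so t bounds their
    number. F is carried along, represented by the growing family of phases, because its midpoint
    with F1 may be needed at the end. *)
Lemma popular_inner (b c' rho : R) : 0 < c' -> popular_upto b -> 0 < rho -> incremental ((c' ^+ 2 * e1) ^+ 8) rho ->
  forall t : nat, forall (p p1 : fpoly R) K prof nu, pletters K p -> pletters K p1 ->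
    (forall e, 0 < e -> 0 < prof e) -> 0 < nu ->
  exists2 c : R, 0 < c & forall (G : finComNzRingType) (chi : G -> R[i]) (col : G -> 'I_m.+1) g (f F F1 : G -> R),
    charsys chi -> represented chi g K prof nu p F -> represented chi g K prof nu p1 F1 ->
    (forall x, 0 <= f x <= 1) -> \E_x (f x - F x) ^+ 2 <= b + kp -> \E_x (f x - F1 x) ^+ 2 <= b + kp ->
    \E_x (f x - F1 x) ^+ 2 <= t%:R * rho -> good col k (e / 4) c' F -> good col k e c f.
Proof.
move=> c'0 hb rho0 hinc; elim => [|t IH] p p1 K prof nu lp lp1 prof0 nu0.
  have [c c0 fin] := popular_uniform c'0 hb lp lp1 prof0 nu0.
  exists c => // G chi col g f F F1 hchi rF rF1 hf hE hE1 ht hg; rewrite mul0r in ht.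
  have [hU|/ltW hU] := leP (U3 (fun x => (f x - F1 x)%:C : R[i])) ((c' ^+ 2 * e1) ^+ 8).
    by apply: (fin G chi col g f F F1).
  have [p2 [prof2 [nu2 [_ _ _ h2]]]] := hinc p1 K prof nu lp1 prof0 nu0.
  have [hq hF1 eF1] := rF1.
  have [g' [F' [_ _ _ _ hn]]] := h2 G chi hchi g f F1 hq hf hF1 eF1 hU.
  have : 0 <= \E_x (f x - F' x) ^+ 2 by apply: ex_ge0 => x; rewrite sqr_ge0.
  by move: hn ht rho0; lra.
have [c c0 fin] := popular_uniform c'0 hb lp lp1 prof0 nu0.
have [p2 [prof2 [nu2 [lp2 prof20 nu20 h2]]]] := hinc p1 K prof nu lp1 prof0 nu0.
have [cn' cn0' hn'] := IH p p2 K.+1 prof2 nu2 (pletters_le (leqnSn K) lp) lp2 prof20 nu20.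
exists (Num.min c cn'); first by rewrite !lt_min c0.
move=> G chi col g f F F1 hchi rF rF1 hf hE hE1 ht hg.
have [hU|/ltW hU] := leP (U3 (fun x => (f x - F1 x)%:C : R[i])) ((c' ^+ 2 * e1) ^+ 8).
  apply: (good_le (c := c)); first by rewrite ge_min lexx.
  by apply: (fin G chi col g f F F1).
have [hq hF1 eF1] := rF1; have [_ hF eF] := rF.
have [g' [F' [gg' hq' hF' eF' hn]]] := h2 G chi hchi g f F1 hq hf hF1 eF1 hU.
apply: (good_le (c := cn')); first by rewrite ge_min lexx orbT.
apply: (hn' G chi col g' f F F') => //.
- split => // x; rewrite -eF; apply: (evp_ext lp) => j jK; exact: gg'.
- by apply: le_trans hn _; move: hE1 rho0; lra.
- by apply: le_trans hn _; move: ht; rewrite -natr1 mulrDl mul1r; lra.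
Qed.

(** Order of choice: the set of F fixes c', this the U3 threshold, this the gain rho, and rho the
    number t of corrections. The loop starts at F1 = F. *)
Lemma popular_step (b : R) : popular_upto b -> popular_upto (b + kp).
Proof.
move=> hb p K prof nu lp prof0 nu0.
have e10 : 0 < e1 by rewrite divr_gt0.
have [c' c'0 hc'] := counting m hk lp prof0 nu0 (divr_gt0 e0 (ltr0Sn R 3)).
have eta0 : 0 < (c' ^+ 2 * e1) ^+ 8 by rewrite exprn_gt0 // mulr_gt0 // exprn_gt0.
have [rho rho0 hinc] := increment eta0.
pose t := Num.bound (`|b + kp| / rho).
have ht : b + kp <= t%:R * rho.
  rewrite -ler_pdivrMr //; apply: ltW; apply: le_lt_trans (archi_boundP _); last by rewrite divr_ge0 // ltW.
  by rewrite ler_pM2r ?invr_gt0 // ler_norm.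
have [c c0 hc] := popular_inner c'0 hb rho0 hinc t lp lp prof0 nu0.
exists c => // G chi col g f F hchi rF hf hE.
apply: (hc G chi col g f F F) => //; first exact: le_trans hE ht.
have [hq hF eF] := rF.
exact: (hc' G chi hchi col g F hq hF eF).
Qed.

Lemma popular_base : popular_upto 0.
Proof.
move=> p K prof nu lp prof0 nu0.
have [c' c'0 hc'] := counting m hk lp prof0 nu0 e0.
exists c' => // G chi col g f F hchi [hq hF eF] hf hE.
suff -> : f = F by apply: (hc' G chi hchi col g F hq hF eF).
have s0 : \sum_x (f x - F x) ^+ 2 <= 0.
  by rewrite (sum_ex (0 : G)) pmulr_rle0 //; apply: cardG_gt0.
apply: boolp.funext => x; apply/eqP; rewrite -subr_eq0 -sqrf_eq0 eq_le sqr_ge0 andbT.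
apply: le_trans s0; rewrite (bigD1 x) //= lerDl sumr_ge0 // => y _; exact: sqr_ge0.
Qed.

Theorem popular_differences : exists2 c : R, 0 < c &
  forall (G : finComNzRingType) (chi : G -> R[i]) (col : G -> 'I_m.+1) (f : G -> R),
    charsys chi -> (forall x, 0 <= f x <= 1) -> good col k e c f.
Proof.
have e10 : 0 < e1 by rewrite divr_gt0.
have kp0 : 0 < kp by rewrite divr_gt0 // exprn_gt0.
pose n := Num.bound (1 / kp).
have hn : 1 <= n%:R * kp.
  by rewrite -ler_pdivrMr //; apply/ltW/archi_boundP; rewrite divr_ge0 // ltW.
have P j : popular_upto (j%:R * kp).
  elim: j => [|j IH]; first by rewrite mul0r; apply: popular_base.
  by rewrite -natr1 mulrDl mul1r; apply: popular_step.
(* The empty polynomial represents F = 0, whose squared distance to f is at most 1 <= n kp. *)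
have [c c0 hc] := P n [::] 0%N (fun=> 1) 1 isT (fun _ _ => ltr01) ltr01.
exists c => // G chi col f hchi hf.
apply: (hc G chi col (fun _ _ => 0) f (fun=> 0) hchi) => //.
  split => // x; first by rewrite lexx ler01.
  by rewrite /evp big_nil.
apply: le_trans hn; apply: (ex_le (0 : G)) => x; rewrite subr0.
by have /andP[h1 h2] := hf x; rewrite expr_le1.
Qed.
End Fixed.
End Popular.

End FiniteRing.

(** * Transfer to residues modulo an integer prime to 6 *)

Module Cyclic.

Import all_boot all_order all_algebra reals ring lra.
Import cyclic separable cyclotomic zify Rstruct.
Set Implicit Arguments. Unset Strict Implicit. Unset Printing Implicit Defensive.
Import Order.TTheory GRing.Theory Num.Theory.
Import complex.
Import FiniteRing.
Local Open Scope ring_scope.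
Local Notation "x %:C" := (real_complex _ x) : ring_scope.
Local Notation "R [i]" := (complex R) : type_scope.


Section CyclicGroup.
Variable R : realType.

Lemma prim_root_exists n : (0 < n)%N -> exists z : R[i], n.-primitive_root z.
Proof.
move=> n_gt0; pose p : {poly R[i]} := 'X^n - 1; have [r Dp] := closed_field_poly_normal p.
rewrite (monicP _) ?monicXnsubC // scale1r in Dp.
have rn1: all n.-unity_root r by apply/allP=> z; rewrite -root_prod_XsubC -Dp.
have sz_r: (n < (size r).+1)%N by rewrite -(size_prod_XsubC r id) -Dp size_XnsubC.
have [|z] := hasP (has_prim_root n_gt0 rn1 _ sz_r); last by exists z.
by rewrite -separable_prod_XsubC -Dp separable_Xn_sub_1 // pnatr_eq0 -lt0n.
Qed.

Lemma ord_mulrn_eq0 n j (t : 'I_n.+2) : coprime n.+2 j -> t *+ j = 0 -> t = 0.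
Proof.
move=> cj /(congr1 val); rewrite Zp_mulrn /= => /eqP h.
have : (n.+2 %| t)%N by rewrite -(Gauss_dvdl _ cj).
move=> ht; apply: val_inj => /=; case: (posnP t) => [//|t0].
by have := dvdn_leq t0 ht; rewrite leqNgt ltn_ord.
Qed.

(** Nondegeneracy is the vanishing of a geometric sum; coprimality with 6 makes doubling and
    tripling injective. *)
Lemma charsys_ord n (z : R[i]) : coprime n.+2 6 -> n.+2.-primitive_root z ->
  charsys (fun x : 'I_n.+2 => z ^+ x).
Proof.
move=> c6 hz; have zn := prim_expr_order hz.
have [c2 c3] : coprime n.+2 2 /\ coprime n.+2 3.
  by move: c6; rewrite (_ : 6%N = (2 * 3)%N) // coprimeMr => /andP[].
have chiX (x y : 'I_n.+2) : z ^+ ((x * y)%R : 'I_n.+2) = z ^+ x ^+ y by rewrite /= (prim_expr_mod hz) exprM.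
split.
- by move=> x y; rewrite /= (prim_expr_mod hz) exprD.
- move=> x; apply/eqP; rewrite -(@pexpr_eq1 _ _ n.+2) ?cn_ge0 //.
  have cnX (w : R[i]) j : cn (w ^+ j) = cn w ^+ j.
    by elim: j => [|j IH]; rewrite ?expr0 ?cn1 // !exprS cnM IH.
  by rewrite -cnX exprAC zn expr1n cn1.
- move=> k k0; under eq_bigr => x _ do rewrite chiX.
  have h := subrX1 (z ^+ k) n.+2; rewrite exprAC zn expr1n subrr in h.
  have /eqP := esym h; rewrite mulf_eq0 => /orP[|/eqP //].
  rewrite subr_eq0 -(prim_order_dvd hz) => ht.
  have kpos : (0 < k)%N by rewrite lt0n.
  by have := dvdn_leq kpos ht; rewrite leqNgt ltn_ord.
- move=> x y /= h; apply/eqP; rewrite -subr_eq0; apply/eqP/(ord_mulrn_eq0 c2).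
  by rewrite mulr2n addrACA -opprD h subrr.
- move=> x y /= h; apply/eqP; rewrite -subr_eq0; apply/eqP/(ord_mulrn_eq0 c3).
  by rewrite !mulrS mulr0n addr0 !addrA in h *; rewrite -(subrr (y + y + y)) -{1}h; ring.
Qed.

Definition ap_starts (G : finZmodType) (S : {set G}) (k : nat) (d : G) : {set G} :=
  [set x | [forall i : 'I_k, x + d *+ i \in S]].

Lemma sum_indicator (T : finType) (A : {set T}) : \sum_x (x \in A)%:R = #|A|%:R :> R.
Proof. by rewrite -sum1_card natr_sum [RHS]big_mkcond; apply: eq_bigr => x _; case: (_ \in _). Qed.

Lemma apcorr_indicator (G : finComNzRingType) (S : {set G}) k d : (k <= 4)%N ->
  apcorr (fun x => (x \in S)%:R : R) k d = (#|ap_starts S k d|%:R / #|G|%:R)%:C.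
Proof.
move=> k4.
have -> : apcorr (fun x => (x \in S)%:R : R) k d = (\E_x (x \in ap_starts S k d)%:R)%:C.
  rewrite /apcorr /lam4 ex_real; apply: eq_ex => x.
  have sl i y : slot (fun x => (x \in S)%:R : R) k i y = ((i < k)%N ==> (y \in S))%:R.
    by rewrite /slot; case: (i < k)%N => //=; rewrite rmorph_nat.
  rewrite !sl -!natrM !mulnb rmorph_nat; congr (nat_of_bool _)%:R.
  rewrite inE -!andbA; apply/and4P/forallP => [[h0 h1 h2 h3] [[|[|[|[|i]]]] hi] /=|h].
  - by rewrite mulr0n addr0; exact: (implyP h0).
  - by rewrite mulr1n; exact: (implyP h1).
  - by rewrite mulr2n addrA; exact: (implyP h2).
  - by rewrite !mulrS mulr0n addr0 !addrA; exact: (implyP h3).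
  - by have := leq_trans hi k4.
  split; apply/implyP => hi.
  - by have := h (Ordinal hi); rewrite mulr0n addr0.
  - by have := h (Ordinal hi); rewrite mulr1n.
  - by have := h (Ordinal hi); rewrite mulr2n addrA.
  - by have := h (Ordinal hi); rewrite /= !mulrS mulr0n addr0 !addrA.
by rewrite exE sum_indicator mulrC.
Qed.

(** Averaging over the second point of E - E fixes some y, so that distinct x give distinct
    differences x - y. A Markov argument then costs a second e and keeps at least e |E| of the x. *)
Lemma cyclic_popular (k m : nat) (e : R) : (0 < k <= 4)%N -> 0 < e <= 1 ->
  exists2 c : R, 0 < c & forall n w, coprime n.+2 6 -> (n.+2 <= m.+1 * w)%N ->
  forall S : {set 'I_n.+2}, exists (y : 'I_n.+2) (X : {set 'I_n.+2}),
  [/\ c * n.+2%:R <= #|X|%:R, forall x, x \in X -> (x < y + w)%N && (y < x + w)%N &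
   forall x, x \in X -> ((#|S|%:R / n.+2%:R) ^+ k - 2 * e) * n.+2%:R <= #|ap_starts S k (x - y)|%:R].
Proof.
move=> hk /andP[e0 e1]; have /andP[_ k4] := hk.
have [c1 c10 hc] := popular_differences m hk e0.
exists (e * c1); first by rewrite mulr_gt0.
move=> n w c6 hw S.
have [z hz] := prim_root_exists (ltn0Sn n.+1).
(* Colour classes are blocks of w consecutive residues, so points of E differ by less than w as
   integers. *)
pose col (x : 'I_n.+2) : 'I_m.+1 := inord (x %/ w).
have w0 : (0 < w)%N by case: w hw {col} => //; rewrite muln0.
have f01 (x : 'I_n.+2) : 0 <= ((x \in S)%:R : R) <= 1 by case: (_ \in _); rewrite ?lexx ?ler01.
have [E [En0 cE Ecol hE]] := hc _ _ col _ (charsys_ord c6 hz) f01.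
have N0 : 0 < n.+2%:R :> R by rewrite ltr0n.
have exS : ex (fun x : 'I_n.+2 => (x \in S)%:R : R) = #|S|%:R / n.+2%:R.
  by rewrite exE sum_indicator card_ord mulrC.
rewrite exS in hE; set a := _ ^+ k in hE; rewrite -/a.
have /set0Pn[x0 hx0] := En0; pose d0 : sub_of E := exist _ x0 hx0.
pose r (d : 'I_n.+2) : R := #|ap_starts S k d|%:R / n.+2%:R.
have avE : apavg (fun d : sub_of E => val d) (fun x => (x \in S)%:R : R) k =
    \E_d2 \E_d1 r (val (d1 : sub_of E) - val (d2 : sub_of E)).
  rewrite /apavg ex_exchange -[RHS]/(Re (_)%:C); congr Re.
  rewrite ex_real; apply: eq_ex => d2; rewrite ex_real; apply: eq_ex => d1.
  by rewrite apcorr_indicator // card_ord.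
have [y _ hy] : exists2 y : sub_of E, predT y & a - e <= \E_d1 r (val (d1 : sub_of E) - val y).
  apply: exists_ge_avg; first by exists d0.
  by rewrite !(sum_ex d0) ler_wpM2l // (ex_const d0) -avE.
have r1 d : 0 <= r d <= 1.
  rewrite /r divr_ge0 //= ler_pdivrMr // mul1r ler_nat -[X in (_ <= X)%N](card_ord n.+2); exact: max_card.
pose X := [set x in E | a - 2 * e <= r (x - val y)].
exists (val y), X; split.
- have NE : 0 < #|E|%:R :> R by rewrite ltr0n card_gt0.
  suff h : e * #|E|%:R <= #|X|%:R.
    by rewrite card_ord in cE; apply: le_trans h; rewrite -mulrA; apply: ler_wpM2l => //; apply: ltW.
  have [T0|T0] := leP 0 (a - 2 * e); last first.
    have -> : X = E.
      apply/setP => x; rewrite inE; apply: andb_idr => _.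
      by have /andP[h _] := r1 (x - val y); apply: le_trans h; apply: ltW.
    by apply: ler_piMl => //; apply: ltW.
  have h1 : \sum_(x in E) r (x - val y) <= #|X|%:R + (a - 2 * e) * #|E|%:R.
    rewrite -sum_indicator -[in leRHS]sum_indicator mulr_sumr -big_split /= big_mkcond.
    apply: ler_sum => x _; rewrite inE; case: (x \in E) => /=; last by rewrite add0r mulr0.
    have := r1 (x - val y); rewrite mulr1 /=; move: (r _) => t /andP[? ?].
    by have [h|h] := leP (a - 2 * e) t; move: T0; rewrite /=; lra.
  have h2 : (a - e) * #|E|%:R <= \sum_(x in E) r (x - val y).
    have -> : \sum_(x in E) r (x - val y) = \sum_(x : sub_of E) r (val x - val y).
      exact: big_sub.
    by rewrite (sum_ex d0) card_sig mulrC ler_wpM2l.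
  by move: h1 h2; move: (\sum_(x in E) _) => s; lra.
- move=> x; rewrite inE => /andP[xE _].
  have h := Ecol x (val y) xE (valP y).
  have q (t : 'I_n.+2) : (t %/ w < m.+1)%N by rewrite ltn_divLR //; apply: leq_trans hw.
  have near (s t : 'I_n.+2) : (s %/ w = t %/ w)%N -> (s < t + w)%N.
    move=> st; apply: (leq_trans (ltn_ceil s w0)); rewrite st mulSn addnC leq_add2r.
    exact: leq_trunc_div.
  have h' := congr1 val h; rewrite /col /= !inordK ?q // in h'.
  by rewrite !near.
- by move=> x; rewrite inE => /andP[_ h]; rewrite -ler_pdivlMr.
Qed.

Lemma card_window n a c (B : {set 'I_n}) : (forall x, x \in B -> a <= x < a + c)%N -> (#|B| <= c)%N.
Proof.
move=> h; rewrite -[c in leqRHS](size_iota a) cardE -(size_map val).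
apply: uniq_leq_size; first by rewrite (map_inj_uniq val_inj) enum_uniq.
by move=> _ /mapP[x hx ->]; rewrite mem_iota; apply: h; rewrite mem_enum in hx.
Qed.

(** Written with sums instead of differences, because x - y may be negative as an integer. *)
Lemma ord_no_wrap n (u v x y : 'I_n.+2) : v + y = u + x -> (y <= u + x)%N -> (u + x < n.+2 + y)%N ->
  (v + y = u + x)%N.
Proof.
move=> /(congr1 val) /= h h1 h2.
have s : (u + x - y < n.+2)%N by lia.
have /eqP : (v + y = (u + x - y) + y %[mod n.+2])%N by rewrite h subnK.
by rewrite eqn_modDr !modn_small // => /eqP ->; rewrite subnK.
Qed.

(* Progressions of small difference wrap around the cyclic group only near the ends of the interval. *)
Lemma ap_starts_no_wrap n (S : {set 'I_n.+2}) k w (x y : 'I_n.+2) : (k <= 4)%N ->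
  (x < y + w)%N -> (y < x + w)%N ->
  exists Y : {set 'I_n.+2}, (#|ap_starts S k (x - y)%R| <= #|Y| + 6 * w)%N /\
    forall z, z \in Y -> forall i, (i < k)%N -> exists2 t : 'I_n.+2, t \in S & (t + i * y = z + i * x)%N.
Proof.
move=> k4 h1 h2; set Z := ap_starts _ _ _.
(* Margins of 3w at both ends: at most three steps of length below w are taken, in either
   direction. *)
pose lo := [set z : 'I_n.+2 | (z < 3 * w)%N]; pose hi := [set z : 'I_n.+2 | (n.+2 <= z + 3 * w)%N].
exists (Z :\: (lo :|: hi)); split.
  have clo : (#|lo| <= 3 * w)%N by apply: (@card_window _ 0) => z; rewrite inE.
  have chi : (#|hi| <= 3 * w)%N.
    by apply: (@card_window _ (n.+2 - 3 * w)) => z; rewrite inE; have := ltn_ord z; lia.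
  rewrite -(cardsID (lo :|: hi) Z) addnC leq_add2l.
  apply: leq_trans (subset_leq_card (subsetIr _ _)) _; apply: leq_trans (leq_card_setU _ _).1 _.
  by rewrite (_ : 6 * w = 3 * w + 3 * w)%N; [apply: leq_add | lia].
move=> z; rewrite !inE negb_or -leqNgt -ltnNge => /andP[/andP[zl zh] /forallP hz] i ik.
exists (z + (x - y) *+ i); first exact: (hz (Ordinal ik)).
have step j : z + (x - y) *+ j.+1 + y = z + (x - y) *+ j + x by rewrite mulrSr !addrA subrK.
have e1 := @ord_no_wrap n (z + (x - y) *+ 0) (z + (x - y) *+ 1) x y (step 0%N).
have e2 := @ord_no_wrap n (z + (x - y) *+ 1) (z + (x - y) *+ 2) x y (step 1%N).
have e3 := @ord_no_wrap n (z + (x - y) *+ 2) (z + (x - y) *+ 3) x y (step 2%N).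
have e0 : z + (x - y) *+ 0 = z by rewrite mulr0n addr0.
have ez := congr1 (@nat_of_ord _) e0.
have := leq_trans ik k4; move: i {ik} => [|[|[|[|//]]]] _; move: e1 e2 e3 ez;
move: (z + (x - y) *+ 0) (z + (x - y) *+ 1) (z + (x - y) *+ 2) (z + (x - y) *+ 3) => t0 t1 t2 t3; lia.
Qed.

(** The density of S may fall short of a by e, since the modulus exceeds N; by [pow_close] this
    costs 4 e on top of 2 e. *)
Lemma cyclic_popular_nat (k m : nat) (e : R) : (0 < k <= 4)%N -> 0 < e <= 1 ->
  exists2 c : R, 0 < c & forall n w, coprime n.+2 6 -> (n.+2 <= m.+1 * w)%N ->
  forall (S : {set 'I_n.+2}) (a : R), 0 <= a <= 1 -> (a - e) * n.+2%:R <= #|S|%:R ->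
  exists (y : 'I_n.+2) (X : {set 'I_n.+2}),
  [/\ c * n.+2%:R <= #|X|%:R, forall x, x \in X -> (x < y + w)%N && (y < x + w)%N &
   forall x, x \in X -> exists Y : {set 'I_n.+2}, (a ^+ k - 6 * e) * n.+2%:R <= (#|Y| + 6 * w)%:R /\
    forall z, z \in Y -> forall i, (i < k)%N -> exists2 t : 'I_n.+2, t \in S & (t + i * y = z + i * x)%N].
Proof.
move=> hk he; have [c c0 hc] := cyclic_popular m hk he; exists c => // n w c6 hw S a ha haS.
have [y [X [h1 h2 h3]]] := hc n w c6 hw S; exists y, X; split => // x hx.
have /andP[xy yx] := h2 x hx; have /andP[_ k4] := hk; have /andP[e0 e1] := he.
have [Y [cY hY]] := ap_starts_no_wrap S k4 xy yx; exists Y; split => //.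
have N0 : 0 < n.+2%:R :> R by rewrite ltr0n.
move: cY; rewrite -(ler_nat R); apply: le_trans; apply: le_trans (h3 x hx).
have b01 : 0 <= (#|S|%:R / n.+2%:R : R) <= 1.
  by rewrite divr_ge0 //= ler_pdivrMr // mul1r ler_nat -[X in (_ <= X)%N](card_ord n.+2); exact: max_card.
have hab : a - #|S|%:R / n.+2%:R <= e by rewrite lerBlDl -lerBlDr ler_pdivlMr.
have := pow_close k ha b01 (ltW e0) hab.
have : k%:R * e <= 4 * e by apply: ler_wpM2r; [exact: ltW | rewrite (ler_nat _ k 4)].
by move=> h4 h5; apply: ler_wpM2r; [exact: ltW | lra].
Qed.
End CyclicGroup.

Delimit Scope R_scope with coqR.

Lemma cyclic_popular_INR (k m : nat) (e : R) : (0 < k <= 4)%N -> Rlt 0%coqR e -> Rle e 1%coqR ->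
  exists2 c : R, Rlt 0%coqR c & forall n w, coprime n.+2 6 -> (n.+2 <= m.+1 * w)%N ->
  forall (S : {set 'I_n.+2}) (a : R), Rle 0%coqR a -> Rle a 1%coqR ->
    Rle ((a - e) * INR n.+2)%coqR (INR #|S|) ->
  exists (y : 'I_n.+2) (X : {set 'I_n.+2}),
  [/\ Rle (c * INR n.+2)%coqR (INR #|X|), forall x, x \in X -> (x < y + w)%N && (y < x + w)%N &
   forall x, x \in X -> exists Y : {set 'I_n.+2}, Rle ((a ^ k - 6 * e) * INR n.+2)%coqR (INR (#|Y| + 6 * w)%N) /\
    forall z, z \in Y -> forall i, (i < k)%N -> exists2 t : 'I_n.+2, t \in S & (t + i * y = z + i * x)%N].
Proof.
move=> hk /RltP e0 /RleP e1; have he : 0 < e <= 1 by apply/andP.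
have [c c0 hc] := cyclic_popular_nat m hk he; exists c; first exact/RltP.
move=> n w c6 hw S a /RleP a0 /RleP a1 /RleP haS; rewrite !INRE in haS.
have ha : 0 <= a <= 1 by apply/andP.
have [y [X [h1 h2 h3]]] := hc n w c6 hw S a ha haS; exists y, X; split => //.
  by apply/RleP; rewrite !INRE.
move=> x hx; have [Y [cY hY]] := h3 x hx; exists Y; split => //.
have six : IZR 6 = 6 :> R by rewrite IZRposE INRE.
by apply/RleP; rewrite !INRE RpowE six.
Qed.

End Cyclic.

(** * Counting over the integers *)

Module Integers.

Import all_boot zify.
Import Lia Lra FinFun.
Set Implicit Arguments. Unset Strict Implicit. Unset Printing Implicit Defensive.
Import Cyclic.

Lemma In_mem (T : eqType) (x : T) (s : seq T) : In x s <-> x \in s.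
Proof.
elim: s => //= y s IH; rewrite inE IH eq_sym; split => [[->|->]|/orP[/eqP->|h]].
- by rewrite eqxx.
- by rewrite orbT.
- by left.
- by right.
Qed.

Lemma uniq_NoDup_map (T : eqType) (h : T -> Z) (s : seq T) : {in s &, injective h} -> uniq s -> NoDup (List.map h s).
Proof.
elim: s => [|x s IH] hi /=; first by constructor.
move=> /andP[xs us]; constructor; last first.
  by apply: IH => // y z ys zs; apply: hi; rewrite inE ?ys ?zs orbT.
move=> /in_map_iff [y [e /In_mem ys]]; case/negP: xs.
by rewrite -(hi y x _ _ e) // inE ?eqxx // ys orbT.
Qed.

Lemma In_Zrange a b z : In z (Zrange a b) <-> (a <= z <= b)%Z.
Proof.
rewrite /Zrange in_map_iff; split => [[i [<- /in_seq]]|h]; first lia.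
exists (Z.to_nat (z - a)); rewrite in_seq; lia.
Qed.

Lemma NoDup_Zrange a b : NoDup (Zrange a b).
Proof.
apply: Injective_map_NoDup; last exact: seq_NoDup.
move=> i j; lia.
Qed.

Lemma card_le_countZ (T : finType) (h : T -> Z) (X : {set T}) (P : Z -> bool) a b :
  {in X &, injective h} -> (forall x, x \in X -> (a <= h x <= b)%Z /\ P (h x)) -> (#|X| <= countZ P a b)%coq_nat.
Proof.
move=> hi hX; rewrite cardE /countZ -[size _](length_map h (enum X)).
apply: NoDup_incl_length.
  apply: uniq_NoDup_map; last exact: enum_uniq.
  by move=> x y; rewrite !mem_enum; apply: hi.
move=> z /in_map_iff [x [<- /In_mem]]; rewrite mem_enum => /hX [h1 h2].
by apply/filter_In; split => //; apply/In_Zrange.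
Qed.

Lemma countZ_le_card (T : finType) (h : T -> Z) (X : {set T}) (P : Z -> bool) a b :
  (forall z, (a <= z <= b)%Z -> P z -> exists2 x, x \in X & h x = z) -> (countZ P a b <= #|X|)%coq_nat.
Proof.
move=> hX; rewrite cardE /countZ -[size _](length_map h (enum X)).
apply: NoDup_incl_length; first exact/NoDup_filter/NoDup_Zrange.
move=> z /filter_In [/In_Zrange h1 h2]; have [x hx <-] := hX z h1 h2.
by apply/in_map_iff; exists x; split => //; apply/In_mem; rewrite mem_enum.
Qed.

Lemma RlebP x y : Rle x y -> Rleb x y.
Proof. by rewrite /Rleb; case: Rle_dec. Qed.

Lemma ap_inP (A : Z -> bool) k n d : (forall i, (i < k)%coq_nat -> A (n + Z.of_nat i * d)%Z) -> ap_in A k n d.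
Proof. by move=> h; apply/forallb_forall => i /in_seq hi; apply: h; lia. Qed.

Lemma coprime_6 q : coprime (6 * q).+1 6.
Proof. by rewrite /coprime -addn1 mulnC gcdnC gcdnMDl gcdn1. Qed.

Lemma pow_le_base (a : R) k : 0 < a < 1 -> (1 <= k)%coq_nat -> a ^ k <= a.
Proof.
move=> ha; case: k => [|k] hk; first lia.
have h : a ^ k <= 1 by rewrite -(pow1 k); apply: pow_incr; lra.
have h0 : 0 <= a ^ k by apply: pow_le; lra.
by rewrite /=; nra.
Qed.

Lemma apcount_0 A k N : (1 <= k)%coq_nat -> apcount A k 0 N = countZ A 1 N.
Proof.
move=> hk; rewrite /apcount /countZ; congr length; apply: filter_ext => n.
apply/idP/idP => [/forallb_forall h|An].
  by have := h 0%nat (proj2 (in_seq _ _ _) (conj (le_n 0) hk)); rewrite Z.add_0_r.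
by apply: ap_inP => i _; rewrite Z.mul_0_r Z.add_0_r.
Qed.

(** The difference d = 0 is always popular, since alpha^k <= alpha. This settles small N, where one
    difference is enough. *)
Lemma zero_popular (k : nat) (alpha eps : R) (N : Z) (A : Z -> bool) :
  (1 <= k)%coq_nat -> 0 < alpha < 1 -> 0 < eps -> (1 <= N)%Z -> alpha * IZR N <= INR (countZ A 1 N) ->
  1 <= INR (countZ (fun d => Rleb ((alpha ^ k - eps) * IZR N) (INR (apcount A k d N))) (- N) N).
Proof.
move=> hk ha he hN hA; set P := fun d => _; apply: (le_INR 1).
suff P0 : P 0%Z.
  have := @card_le_countZ _ (fun _ => 0%Z) [set tt] P (- N) N; rewrite cards1; apply.
    by move=> [] [].
  by move=> _ _; split => //; lia.
apply: RlebP; rewrite apcount_0 //; have := pow_le_base ha hk.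
have := IZR_le _ _ hN; nra.
Qed.

Lemma countZ_differences (k : nat) (N : Z) (A : Z -> bool) (n w : nat) (y : 'I_n) (X : {set 'I_n}) (T : R) :
  (1 <= k)%coq_nat -> (Z.of_nat w <= N)%Z -> (forall x, A x = true -> (1 <= x <= N)%Z) ->
  (forall x : 'I_n, x \in X -> (x < y + w)%N && (y < x + w)%N) ->
  (forall x, x \in X -> exists Y : {set 'I_n}, T <= INR #|Y| /\
     forall z, z \in Y -> forall i, (i < k)%N ->
       exists2 t : 'I_n, t \in [set t : 'I_n | A (Z.of_nat t)] & (t + i * y = z + i * x)%N) ->
  (#|X| <= countZ (fun d => Rleb T (INR (apcount A k d N))) (- N) N)%coq_nat.
Proof.
move=> hk hw hA hX hY; apply: (card_le_countZ (h := fun x : 'I_n => Z.of_nat x - Z.of_nat y)%Z).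
  by move=> x x' _ _ h; apply: val_inj => /=; lia.
move=> x xX; have [Y [TY hYx]] := hY x xX; split.
  by have /andP[/ltP h1 /ltP h2] := hX x xX; lia.
apply/RlebP/(Rle_trans _ _ _ TY)/le_INR; apply: (card_le_countZ (h := fun z : 'I_n => Z.of_nat z)).
  by move=> z z' _ _ h; apply: val_inj => /=; lia.
have key z (i : nat) : z \in Y -> (i < k)%coq_nat -> A (Z.of_nat z + Z.of_nat i * (Z.of_nat x - Z.of_nat y))%Z.
  move=> zY /ltP ik; have [t] := hYx z zY i ik; rewrite inE => At /(congr1 Z.of_nat) e.
  by move: At; congr (is_true (A _)); rewrite -!plusE -!multE in e; lia.
move=> z zY; split; last by apply: ap_inP => i; apply: key.
by apply: hA; have := key z 0%nat zY hk; rewrite Z.mul_0_l Z.add_0_r.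
Qed.

Lemma large_popular (k : nat) (alpha eps e : R) : (1 <= k)%coq_nat -> (k <= 4)%coq_nat -> 0 < alpha < 1 ->
  0 < e -> 9 * e <= 1 -> 9 * e <= eps ->
  exists2 c : R, 0 < c & forall (N : Z) (A : Z -> bool), (1 <= N)%Z -> 12 <= e * IZR N ->
      (forall x, A x = true -> (1 <= x <= N)%Z) ->
      alpha * IZR N <= INR (countZ A 1 N) ->
      c * IZR N <= INR (countZ (fun d => Rleb ((alpha ^ k - eps) * IZR N) (INR (apcount A k d N))) (- N) N).
Proof.
move=> k1 k4 ha e0 e1 e2.
(* With at least 12 / e blocks and 12 <= e N, both the main term of 6 w and the 6 from rounding are
   at most half of e times the modulus. *)
pose m := Z.to_nat (up (12 / e)).
have hm : 12 <= e * INR m.+1.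
  have [u1 _] := archimed (12 / e).
  have u2 : 12 / e <= INR m.+1.
    rewrite S_INR INR_IZR_INZ; apply: Rle_trans (_ : IZR (up (12 / e)) <= _); first lra.
    by rewrite -plus_IZR; apply: IZR_le; rewrite /m; lia.
  by apply: (Rmult_le_reg_l (/ e)); [exact: Rinv_0_lt_compat | rewrite -Rmult_assoc Rinv_l; lra].
have hk' : (0 < k <= 4)%N by lia.
have e1' : e <= 1 by lra.
have [c c0 hc] := cyclic_popular_INR m hk' e0 e1'.
exists c => // N A hN hNe hA hAN.
(* The modulus n + 2 is 1 modulo 6, hence prime to 6, and lies between N + 1 and N + 7. *)
pose n := (6 * (Z.to_nat N %/ 6) + 5)%N.
have n6 : coprime n.+2 6.
  by rewrite (_ : n.+2 = (6 * (Z.to_nat N %/ 6).+1).+1) ?coprime_6 // /n mulnS addnC.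
have hn : (Z.to_nat N < n.+2 <= Z.to_nat N + 7)%N.
  by have := divn_eq (Z.to_nat N) 6; have := ltn_pmod (Z.to_nat N) (isT : (0 < 6)%N); rewrite /n; lia.
pose w := (n.+2 %/ m.+1).+1.
have hw : (n.+2 <= m.+1 * w)%N by rewrite mulnC; apply/ltnW/ltn_ceil.
have hw2 : (n.+2 %/ m.+1 * m.+1 <= n.+2)%N by apply: leq_trunc_div.
pose S := [set t : 'I_n.+2 | A (Z.of_nat t)].
have hS : alpha * IZR N <= INR #|S|.
  apply: Rle_trans hAN _; apply/le_INR/(countZ_le_card (h := fun t : 'I_n.+2 => Z.of_nat t)) => z hz Az.
  have zn : (Z.to_nat z < n.+2)%N by lia.
  by exists (Ordinal zn); rewrite ?inE /= Z2Nat.id //; lia.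
pose NN := INR n.+2.
have N1 : IZR N + 1 <= NN by rewrite -plus_IZR /NN INR_IZR_INZ; apply: IZR_le; lia.
have N2 : NN <= IZR N + 7 by rewrite -plus_IZR /NN INR_IZR_INZ; apply: IZR_le; lia.
have w6 : 6 * INR w <= e * NN.
  have h : INR (n.+2 %/ m.+1) * INR m.+1 <= NN by rewrite -mult_INR; apply: le_INR; lia.
  have q0 := pos_INR (n.+2 %/ m.+1).
  by rewrite /w S_INR; nra.
have haS : (alpha - e) * NN <= INR #|S| by nra.
have [y [X [h1 h2 h3]]] := hc n w n6 hw S alpha (Rlt_le _ _ (proj1 ha)) (Rlt_le _ _ (proj2 ha)) haS.
have N0 := IZR_le _ _ hN.
apply: Rle_trans (_ : c * NN <= _); first nra.
apply: Rle_trans h1 _; apply/le_INR/(countZ_differences (w := w) (y := y)) => //.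
  apply: le_IZR; rewrite -INR_IZR_INZ; nra.
move=> x xX; have [Y [hY1 hY2]] := h3 x xX; exists Y; split => //.
rewrite plus_INR mult_INR in hY1.
have Y0 := pos_INR #|Y|.
have [h|h] := Rle_lt_dec (alpha ^ k - eps) 0; first nra.
have six : INR 6 = 6 by rewrite /=; lra.
rewrite six -/NN in hY1; have NN0 : 0 <= NN by lra.
have g1 : (alpha ^ k - eps) * IZR N <= (alpha ^ k - eps) * NN by apply: Rmult_le_compat_l; lra.
(* The loss is 6 e from [cyclic_popular_INR] and e from the 6 w starting points near the ends; 9 e
   <= eps covers it. *)
have g2 : (alpha ^ k - eps) * NN <= (alpha ^ k - 7 * e) * NN by apply: Rmult_le_compat_r; lra.
by lra.
Qed.

(** If e N < 12, the constant e / 12 asks for less than one difference, which d = 0 provides. *)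
Lemma popular (k : nat) (alpha eps : R) : (1 <= k)%coq_nat -> (k <= 4)%coq_nat -> 0 < alpha < 1 -> 0 < eps ->
  exists c : R, 0 < c /\ forall (N : Z) (A : Z -> bool), (1 <= N)%Z -> (forall x, A x = true -> (1 <= x <= N)%Z) ->
      alpha * IZR N <= INR (countZ A 1 N) ->
      c * IZR N <= INR (countZ (fun d => Rleb ((alpha ^ k - eps) * IZR N) (INR (apcount A k d N))) (- N) N).
Proof.
move=> k1 k4 ha eps0; pose e := Rmin eps 1 / 9.
have m1 := Rmin_l eps 1; have m2 := Rmin_r eps 1.
have m0 : 0 < Rmin eps 1 by apply: Rmin_pos; lra.
have e0 : 0 < e by rewrite /e; lra.
have e1 : 9 * e <= 1 by rewrite /e; lra.
have e2 : 9 * e <= eps by rewrite /e; lra.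
have [c c0 hc] := large_popular k1 k4 ha e0 e1 e2.
have [n1 n2] := (Rmin_l c (e / 12), Rmin_r c (e / 12)).
exists (Rmin c (e / 12)); split; first by apply: Rmin_pos; lra.
move=> N A hN hA hAN; have N1 := IZR_le _ _ hN.
have [h|h] := Rle_lt_dec 12 (e * IZR N).
  by apply: Rle_trans (hc N A hN h hA hAN); apply: Rmult_le_compat_r; lra.
apply: Rle_trans (zero_popular k1 ha eps0 hN hAN).
have : Rmin c (e / 12) * IZR N <= e / 12 * IZR N by apply: Rmult_le_compat_r; lra.
lra.
Qed.

End Integers.

Theorem mainTheorem3 (k : nat) (alpha eps : R) :
  (1 <= k <= 4)%nat -> 0 < alpha < 1 -> 0 < eps ->
  exists c : R, 0 < c /\
    forall (N : Z) (A : Z -> bool),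
      (1 <= N)%Z ->
      (forall x, A x = true -> (1 <= x <= N)%Z) ->
      alpha * IZR N <= INR (countZ A 1 N) ->
      c * IZR N <=
        INR (countZ (fun d => Rleb ((alpha ^ k - eps) * IZR N)
                                   (INR (apcount A k d N))) (- N) N).
Proof.
intros [h1 h4] ha he.
exact (Integers.popular h1 h4 ha he).
Qed.
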